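(* Among real nilpotent Lie algebras of dimension $6$ (up to isomorphism): (1) $N_{6,1,4}$ does not admit a nice basis; (2) $N_{6,2,5}$, $N_{6,3,1}$ and $N_{3,2}\oplus N_{3,2}$ admit exactly two inequivalent nice bases (i.e. exactly two nice bases up to equivalence); (3) the remaining Lie algebras admit exactly one nice basis up to equivalence.
   Context: A nice basis of a finite-dimensional real Lie algebra $\mathfrak{g}$ is a basis $\{e_1,\dots,e_n\}$, with dual basis $\{e^1,\dots,e^n\}$, such that each $[e_i,e_j]$ is a (possibly zero) scalar multiple of a single basis element $e_k$ depending on $i,j$, and each interior product $e_i\lrcorner\, de^j$ is a (possibly zero) scalar multiple of a single $e^h$ depending on $i,j$; here $d\colon\mathfrak{g}^*\to\Lambda^2\mathfrak{g}^*$ is the Chevalley–Eilenberg differential. Two nice bases $\mathcal{B},\mathcal{B}'$ of $\mathfrak{g}$ are equivalent if there is a Lie algebra automorphism of $\mathfrak{g}$ mapping each element of $\mathcal{B}$ to a nonzero multiple of an element of $\mathcal{B}'$. Notation: $e^{ij}=e^i\wedge e^j$; a tuple $(\theta_1,\dots,\theta_6)$ of 2-forms denotes the real Lie algebra having a basis whose dual basis $e^1,\dots,e^6$ satisfies $de^k=\theta_k$. The named Lie algebras are - $N_{6,1,4}=(0,0,e^{12},e^{13},0,e^{14}+e^{23}+e^{25})$; - $N_{6,2,5}=(0,0,e^{12},e^{13},e^{23},e^{24}+e^{15})$; - $N_{6,3,1}=(0,0,0,e^{12},e^{13},e^{25}+e^{34})$; - $N_{3,2}\oplus N_{3,2}=(0,0,0,0,e^{12},e^{34})$,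 the direct sum of two copies of the $3$-dimensional Heisenberg Lie algebra $N_{3,2}=(0,0,e^{12})$. *)

(* Defs.v *)
From HB Require Import structures.
From mathcomp Require Import all_boot all_order all_algebra.
From mathcomp Require Import ring reals.

Set Implicit Arguments.
Unset Strict Implicit.
Unset Printing Implicit Defensive.

Import GRing.Theory.
Local Open Scope ring_scope.

(* Finite-dimensionality is part of vectType. *)
Record lieAlgebra (K : fieldType) := LieAlgebra {
  lie_space :> vectType K;
  lie_bracket : lie_space -> lie_space -> lie_space;
  lie_bracket_linear_l : forall y, linear (fun x => lie_bracket x y);
  lie_bracket_linear_r : forall x, linear (lie_bracket x);
  lie_bracketxx : forall x, lie_bracket x x = 0;
  lie_jacobi : forall x y z,
    lie_bracket x (lie_bracket y z) + lie_bracket y (lie_bracket z x)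
      + lie_bracket z (lie_bracket x y) = 0
}.

Section LieAlgebra.

Variables (K : fieldType) (g : lieAlgebra K).

Implicit Types (U V : {vspace g}) (alpha beta : g -> K).

(* [U, V], the span of all brackets of u in U and v in V; bases suffice by
   bilinearity (see lie_prodv_subP). *)
Definition lie_prodv U V : {vspace g} :=
  <<[seq lie_bracket u v | u <- vbasis U, v <- vbasis V]>>%VS.

Fixpoint lower_central (k : nat) : {vspace g} :=
  if k is k'.+1 then lie_prodv fullv (lower_central k') else fullv.

Definition lie_nilpotent : Prop := exists k, lower_central k = 0%VS.

Definition lie_automorphism (f : 'End(g)) : Prop :=
  bijective f /\ forall x y, f (lie_bracket x y) = lie_bracket (f x) (f y).

(* 2-forms are represented as functions of two vectors, with
   (alpha /\ beta)(x, y) = alpha(x) beta(y) - alpha(y) beta(x). *)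
Definition wedge alpha beta : g -> g -> K :=
  fun x y => alpha x * beta y - alpha y * beta x.

(* (d alpha)(x, y) = - alpha([x, y]) *)
Definition CE_diff alpha : g -> g -> K := fun x y => - alpha (lie_bracket x y).

Definition interior (x : g) (omega : g -> g -> K) : g -> K := omega x.

(* When e is a basis, the dual basis is given by e^j = coord e j. *)
Definition nice_basis n (e : n.-tuple g) : Prop :=
  [/\ basis_of fullv e,
      forall i j : 'I_n, exists (k : 'I_n) (c : K),
        lie_bracket e`_i e`_j = c *: e`_k
    & forall i j : 'I_n, exists (h : 'I_n) (c : K), forall y : g,
        interior e`_i (CE_diff (coord e j)) y = c * coord e h y].

Definition equivalent_bases n (e e' : n.-tuple g) : Prop :=
  exists f : 'End(g), lie_automorphism f /\
    forall i : 'I_n, exists (j : 'I_n) (c : K), c != 0 /\ f e`_i = c *: e'`_j.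

Definition exactly_nice_bases (n m : nat) : Prop :=
  exists E : 'I_m -> n.-tuple g,
    [/\ forall i, nice_basis (E i),
        forall i j, i != j -> ~ equivalent_bases (E i) (E j)
      & forall e : n.-tuple g, nice_basis e ->
          exists i, equivalent_bases e (E i)].

(* A tuple (theta_1, ..., theta_6) of sums of forms e^{ij} = e^i /\ e^j is coded
   by listing, for each k, the pairs (i, j), numbered from 1, that occur in
   theta_k. *)
Definition has_structure (theta : seq (seq (nat * nat))) : Prop :=
  exists e : 6.-tuple g, basis_of fullv e /\
    forall (k : 'I_6) (x y : g),
      CE_diff (coord e k) x y
      = \sum_(p <- nth [::] theta k)
          wedge (coord e (inord p.1.-1)) (coord e (inord p.2.-1)) x y.

End LieAlgebra.

(* (0, 0, e12, e13, 0, e14 + e23 + e25) *)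
Definition N_6_1_4 : seq (seq (nat * nat)) :=
  [:: [::]; [::]; [:: (1, 2)]; [:: (1, 3)]; [::];
      [:: (1, 4); (2, 3); (2, 5)]]%N.

(* (0, 0, e12, e13, e23, e24 + e15) *)
Definition N_6_2_5 : seq (seq (nat * nat)) :=
  [:: [::]; [::]; [:: (1, 2)]; [:: (1, 3)]; [:: (2, 3)];
      [:: (2, 4); (1, 5)]]%N.

(* (0, 0, 0, e12, e13, e25 + e34) *)
Definition N_6_3_1 : seq (seq (nat * nat)) :=
  [:: [::]; [::]; [::]; [:: (1, 2)]; [:: (1, 3)];
      [:: (2, 5); (3, 4)]]%N.

(* (0, 0, 0, 0, e12, e34) *)
Definition N_3_2_plus_N_3_2 : seq (seq (nat * nat)) :=
  [:: [::]; [::]; [::]; [::]; [:: (1, 2)]; [:: (3, 4)]]%N.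

Section LieProductTheory.

Variables (K : fieldType) (g : lieAlgebra K).
Implicit Types U V W : {vspace g}.

HB.instance Definition _ (x : g) := GRing.isLinear.Build K g g _
  (lie_bracket x) (@lie_bracket_linear_r K g x).
Let lie_flip (y x : g) := lie_bracket x y.
HB.instance Definition _ (y : g) := GRing.isLinear.Build K g g _
  (lie_flip y) (@lie_bracket_linear_l K g y).

Lemma lie_prodv_subP U V W :
  reflect (forall u v, u \in U -> v \in V -> lie_bracket u v \in W)
          (lie_prodv U V <= W)%VS.
Proof.
apply: (iffP span_subvP) =>
    [sW u v Uu Vv | sW _ /allpairsP[[u v] /= [Uu Vv ->]]].
  rewrite (coord_vbasis Uu) -/(lie_flip v _) linear_sum rpred_sum // => i _.
  rewrite linearZ /= rpredZ // /lie_flip (coord_vbasis Vv) linear_sum.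
  rewrite rpred_sum // => j _; rewrite linearZ /= rpredZ //; apply: sW.
  by apply/allpairsP; exists ((vbasis U)`_i, (vbasis V)`_j);
     rewrite !mem_nth ?size_tuple.
by apply: sW; apply: vbasis_mem.
Qed.

End LieProductTheory.

(* The four tuples do define six-dimensional nilpotent Lie algebras. *)
Section Existence.

Variable K : fieldType.

Section Model.

Variable theta : seq (seq (nat * nat)).

Definition model_bracket (x y : 'rV[K]_6) : 'rV[K]_6 :=
  - \row_k \sum_(p <- nth [::] theta k)
      (x 0 (inord p.1.-1) * y 0 (inord p.2.-1)
       - y 0 (inord p.1.-1) * x 0 (inord p.2.-1)).

Lemma model_linear_l y : linear (fun x => model_bracket x y).
Proof.
move=> a u v; apply/rowP=> k; rewrite !mxE mulrN -opprD; congr (- _).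
rewrite big_distrr -big_split /=; apply: eq_bigr => p _; rewrite !mxE; ring.
Qed.

Lemma model_linear_r x : linear (model_bracket x).
Proof.
move=> a u v; apply/rowP=> k; rewrite !mxE mulrN -opprD; congr (- _).
rewrite big_distrr -big_split /=; apply: eq_bigr => p _; rewrite !mxE; ring.
Qed.

Lemma model_xx x : model_bracket x x = 0.
Proof.
by apply/rowP=> k; rewrite !mxE big1 ?oppr0 // => p _; rewrite subrr.
Qed.

Hypothesis jac : forall x y z,
  model_bracket x (model_bracket y z) + model_bracket y (model_bracket z x)
    + model_bracket z (model_bracket x y) = 0.

Definition model : lieAlgebra K :=
  @LieAlgebra K 'rV[K]_6 model_bracket model_linear_l model_linear_r
    model_xx jac.

Lemma model_has_structure : has_structure model theta.
Proof.
pose e := [tuple (delta_mx 0 i : 'rV[K]_6) | i < 6].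
have eE (i : 'I_6) : e`_i = delta_mx 0 i by rewrite -tnth_nth tnth_mktuple.
have sume (x : 'rV[K]_6) : x = \sum_i x 0 i *: e`_i.
  by rewrite {1}[x]row_sum_delta; apply: eq_bigr => i _; rewrite eE.
have efull : <<e>>%VS = fullv.
  apply/eqP; rewrite eqEsubv subvf; apply/subvP => x _; rewrite (sume x).
  rewrite rpred_sum // => i _; rewrite rpredZ // memv_span //.
  by rewrite mem_nth ?size_tuple.
have eb : basis_of fullv e.
  by rewrite basisEdim efull subvv size_tuple dimvf dim_matrix.
have cE i (x : 'rV[K]_6) : coord e i x = x 0 i.
  by rewrite {1}(sume x) (coord_sum_free _ _ (basis_free eb)).
exists e; split=> // k x y; rewrite /CE_diff /= cE !mxE opprK.
by apply: eq_bigr => p _; rewrite /wedge !cE.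
Qed.

Hypothesis low : forall k, (k < 6)%N ->
  all (fun p => [&& 0 < p.1 <= k & 0 < p.2 <= k])%N (nth [::] theta k).

Lemma model_nilpotent : lie_nilpotent model.
Proof.
have H m (v : model) : v \in lower_central model m ->
    forall i : 'I_6, (i < m)%N -> (v : 'rV[K]_6) 0 i = 0.
  elim: m v => // m IHm v /= /(@coord_span _ _ _ (in_tuple _)) -> i im.
  rewrite summxE big1 // => j _; rewrite mxE.
  have /allpairsP[[x y] /= [_ /vbasis_mem/IHm y0 ->]] :=
    mem_nth 0 (ltn_ord j).
  rewrite /= !mxE big_seq big1 ?oppr0 ?mulr0 // => p /(allP (low (ltn_ord i))).
  move=> /andP[/andP[p10 p1i] /andP[p20 p2i]].
  have lt_i q : (0 < q <= i)%N -> (q.-1 < 6)%N && (q.-1 < m)%N.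
    case: q => //= q qi; rewrite (ltn_trans qi (ltn_ord i)).
    exact: leq_trans qi im.
  have /andP[q1 r1] := lt_i p.1 (introT andP (conj p10 p1i)).
  have /andP[q2 r2] := lt_i p.2 (introT andP (conj p20 p2i)).
  by rewrite !y0 ?inordK // mulr0 mul0r subrr.
exists 6; apply/eqP; rewrite -subv0; apply/subvP=> v /H v0.
by rewrite memv0; apply/eqP/rowP=> i; rewrite mxE v0.
Qed.

End Model.

Lemma named_algebras_exist theta :
  theta \in [:: N_6_1_4; N_6_2_5; N_6_3_1; N_3_2_plus_N_3_2] ->
  exists g : lieAlgebra K,
    [/\ \dim {:g} = 6%N, lie_nilpotent g & has_structure g theta].
Proof.
move=> th.
have low k : (k < 6)%N ->
    all (fun p => [&& 0 < p.1 <= k & 0 < p.2 <= k])%N (nth [::] theta k).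
  move: th; rewrite !inE => /or4P[] /eqP->;
  by do 6?[case: k => [|k] //].
have jac x y z : model_bracket theta x (model_bracket theta y z)
    + model_bracket theta y (model_bracket theta z x)
    + model_bracket theta z (model_bracket theta x y) = 0.
  apply/rowP=> k; rewrite !mxE; move: th {low}; rewrite !inE.
  case: k => [] [|[|[|[|[|[|//]]]]]] ? /or4P[] /eqP-> /=;
  rewrite !(big_cons, big_nil) /= ?mxE ?inordK //= ?(big_cons, big_nil) /=;
  ring.
exists (model jac); split; first by rewrite dimvf dim_matrix.
  exact: model_nilpotent.
exact: model_has_structure.
Qed.

End Existence.

(* Main.v *)
(* A basis of a nilpotent Lie algebra adapted to a flag of ideals is recorded by
   the table of its structure constants, polynomials in some parameters, and
   elementary changes of basis act on tables.

   Existence: extending a central extension one dimension at a time and following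
   a tree of changes of basis that kill structure constants, every 6-dimensional
   nilpotent Lie algebra has a nice basis or is N_{6,1,4}.

   Normal forms: the nonzero brackets of a nice basis form a diagram of arrows
   [e_i, e_j] -> e_k, and an exhaustive search leaves 32 diagrams up to
   relabelling. Rescaling the basis turns the structure constants into signs,
   which gives 36 normal tables, and two nice bases with the same normal table are
   equivalent.

   Separation: iterated products and transporters of ideals are characteristic;
   on a basis given by arrows they are coordinate subspaces, so their dimensions
   can be read off the diagram. They separate the normal tables and N_{6,1,4}
   except for a few pairs, separated by ad hoc invariants, and for three pairs of
   tables of the same algebra, which are those of part (2). For these the diagrams
   are not isomorphic, hence the two bases are not equivalent. *)

From HB Require Import structures.
From Stdlib Require Import ZArith Ring_theory Ring_polynom InitialRing.
Require Import Defs.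
From mathcomp Require Import all_boot all_order all_algebra reals.
From mathcomp Require Import ring lra.

Set Implicit Arguments.
Unset Strict Implicit.
Unset Printing Implicit Defensive.

Import GRing.Theory Num.Theory Order.TTheory.
Local Open Scope ring_scope.

(** * Polynomial expressions and coframes *)

(** Structure constants stay formal: identities between them are decided by the reflexive normalizer
    behind [ring], modulo relations such as a a^-1 = 1 known in a branch. What shapes the rest is
    the ground field. Dimensions of subspaces defined by brackets do not change under extension of
    scalars, so they cannot separate algebras that become isomorphic over the algebraic closure:
    tables 18 and 19, 21 and 22, 29 and 30, 32 and 33, each pair differing by one sign. The ad hoc
    invariants ask instead for the real zeros of a binary quadratic form; a definite one, a^2 + b^2,
    has none. The same forms explain part (2): an indefinite form has both an isotropic and an
    orthogonal basis, and each yields a nice basis; likewise R x R has a basis of idempotents and a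
    basis 1, t with t^2 = 1. In the defining basis of [N_6_1_4], counting from 0, [e_1, e_2] and
    [e_1, e_4] have the same head e_5; the only normal table compatible with it is 14, whose centre
    is larger than a line. *)

Notation pexpr := (PExpr Z).
(* An entry (i, j, k, c) stands for a term c e^{ij} of the 2-form (x, y) |-> e^k([x, y]), which
   is [- CE_diff]; indices start at 0. *)
Notation table A := (seq (nat * nat * nat * A)).

Declare Scope pexpr_scope.
Delimit Scope pexpr_scope with P.
Bind Scope pexpr_scope with PExpr.
Notation "a + b" := (PEadd a b) : pexpr_scope.
Notation "a - b" := (PEsub a b) : pexpr_scope.
Notation "a * b" := (PEmul a b) : pexpr_scope.
Notation "- a" := (PEopp a) : pexpr_scope.
Notation "1" := (@PEI Z) : pexpr_scope.
Notation "0" := (@PEO Z) : pexpr_scope.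
Notation "''v' n" := (PEX Z n) (at level 8, n at level 2, format "''v' n")
  : pexpr_scope.

Section PolynomialExpressions.

Variable R : comPzRingType.

(* ['v 1] is the first entry of [l]; variables beyond the end of [l] have value 0. *)
Definition peval : list R -> pexpr -> R :=
  PEeval (0 : R) 1 +%R *%R (fun x y => x - y) -%R
    (gen_phiZ (0 : R) 1 +%R *%R -%R) N.to_nat (@GRing.exp R).

(** A hypothesis whose left side is a monomial becomes a rewriting rule, applied a bounded number of
    times. The resulting test [pzero] is sound but incomplete: a weak normal form can only make a
    check fail. *)
Definition pnorm (hyps : list (pexpr * pexpr)) : pexpr -> Pol Z :=
  norm_subst Z0 (Zpos xH) Z.add Z.mul Z.sub Z.opp Zeq_bool Z.quotrem 20
    (mk_monpol_list Z0 (Zpos xH) Z.add Z.mul Z.sub Z.opp Zeq_bool Z.quotrem hyps).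

Definition pzero hyps p : bool := Peq Zeq_bool (pnorm hyps p) (pnorm hyps 0%P).

Fixpoint holds (l : list R) (hyps : list (pexpr * pexpr)) : Prop :=
  if hyps is h :: hyps' then peval l h.1 = peval l h.2 /\ holds l hyps'
  else True.

(** This is [ring_correct] for Leibniz equality and integer coefficients; the work is to supply the
    ring, power and division structures that it expects. *)
Lemma pzeroP l hyps p : holds l hyps -> pzero hyps p -> peval l p = 0.
Proof.
move=> hyp p0.
have EQ := RelationClasses.eq_equivalence (A := R).
have RT : ring_theory (0 : R) 1 +%R *%R (fun x y => x - y) -%R eq.
  split=> //; [exact: add0r|exact: addrC|exact: addrA|exact: mul1r|
    exact: mulrC|exact: mulrA|exact: mulrDl|exact: subrr].
have Req : ring_eq_ext +%R *%R -%R (@eq R).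
  by split=> [x _ <- y _ <-|x _ <- y _ <-|x _ <-].
have PT : power_theory (1 : R) *%R eq N.to_nat (@GRing.exp R).
  split=> x [|n] //=; elim/Pos.peano_ind: n => [|n IH] /=; first exact: expr1.
  by rewrite Pos2Nat.inj_succ exprS IH (pow_pos_succ EQ) //; apply: mulrA.
have ZM := gen_phiZ_morph EQ Req RT.
have DT : div_theory eq Z.add Z.mul
    (gen_phiZ (0 : R) 1 +%R *%R -%R) Z.quotrem.
  constructor=> a b; have := Z.quotrem_eq a b; case: (Z.quotrem a b) => q r ->.
  by rewrite Z.mul_comm.
have -> : 0 = peval l 0%P by [].
apply: (ring_correct EQ Req (Rth_ARth EQ Req RT) ZM PT DT 20 l hyps p 0%P _ p0).
elim: hyps hyp {p0} => // -[a b] [|h hs] IH; first by case.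
by move=> [? ?]; split=> //; apply: IH.
Qed.

End PolynomialExpressions.

Section Coframes.

Variables (R : rcfType) (g : lieAlgebra R).
Implicit Types (kap : nat -> g -> R) (e : nat -> g) (T : table R) (x y : g).

(** A basis and its dual basis, indexed by natural numbers so that tables can be computed with;
    values at indices above 5 are junk, except that [kap k] is always linear. *)
Definition coframe kap e : Prop :=
  [/\ forall k, scalar (kap k),
      forall k i, (k < 6)%N -> (i < 6)%N -> kap k (e i) = (k == i)%:R
    & forall x, x = \sum_(i < 6) kap i x *: e i].

(** The functional with value [phi k] on e_k, applied to the bracket. Allowing any [phi], not only
    e^k = [dlt k], makes the expression transform simply under changes of basis. *)
Definition form T kap (phi : nat -> R) x y : R :=
  \sum_(p <- T) p.2 * phi p.1.2 * wedge (kap p.1.1.1) (kap p.1.1.2) x y.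

Definition dlt (k : nat) : nat -> R := fun i => (k == i)%:R.

Definition bounded A n (T : table A) : bool :=
  all (fun p => [&& p.1.1.1 < n, p.1.1.2 < n & p.1.2 < n])%N T.

Definition structured n T kap : Prop :=
  forall k x y, (k < n)%N -> kap k (lie_bracket x y) = form T kap (dlt k) x y.

(* For k >= n, brackets with the span of e_k, ..., e_5 lie in the span of e_{k+1}, ..., e_5. *)
Definition flagged n kap : Prop :=
  forall k x y, (n <= k < 6)%N -> (forall a, (a < k)%N -> kap a x = 0) ->
    kap k (lie_bracket x y) = 0.

(** The span of e_n, ..., e_5 is an ideal and [T] is the table of the n-dimensional quotient; the
    flag condition says that [g] is reached from this quotient by successive central extensions by
    lines. *)
Definition presented n T : Prop :=
  exists kap e, [/\ coframe kap e, bounded n T, structured n T kap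
    & flagged n kap].

Lemma bracketZDl a x y z : lie_bracket (a *: x + y) z
  = a *: lie_bracket x z + lie_bracket y z.
Proof. exact: lie_bracket_linear_l. Qed.

Lemma bracketZDr a x y z : lie_bracket z (a *: x + y)
  = a *: lie_bracket z x + lie_bracket z y.
Proof. exact: lie_bracket_linear_r. Qed.

Lemma bracketDl x y z :
  lie_bracket (x + y) z = lie_bracket x z + lie_bracket y z.
Proof. by have := bracketZDl 1 x y z; rewrite !scale1r. Qed.

Lemma bracketDr x y z :
  lie_bracket z (x + y) = lie_bracket z x + lie_bracket z y.
Proof. by have := bracketZDr 1 x y z; rewrite !scale1r. Qed.

Lemma bracket0l x : lie_bracket 0 x = 0.
Proof.
by apply: (addrI (lie_bracket 0 x)); rewrite -bracketDl !addr0.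
Qed.

Lemma bracket0r x : lie_bracket x 0 = 0.
Proof.
by apply: (addrI (lie_bracket x 0)); rewrite -bracketDr !addr0.
Qed.

Lemma bracketZl a x y : lie_bracket (a *: x) y = a *: lie_bracket x y.
Proof. by rewrite -[a *: x]addr0 bracketZDl bracket0l addr0. Qed.

Lemma bracketZr a x y : lie_bracket x (a *: y) = a *: lie_bracket x y.
Proof. by rewrite -[a *: y]addr0 bracketZDr bracket0r addr0. Qed.

Lemma bracket_suml I (r : seq I) (f : I -> g) x :
  lie_bracket (\sum_(i <- r) f i) x = \sum_(i <- r) lie_bracket (f i) x.
Proof.
by elim/big_rec2: _ => [|i _ y _ <-]; rewrite ?bracket0l // bracketDl.
Qed.

Lemma bracket_sumr I (r : seq I) (f : I -> g) x :
  lie_bracket x (\sum_(i <- r) f i) = \sum_(i <- r) lie_bracket x (f i).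
Proof.
by elim/big_rec2: _ => [|i _ y _ <-]; rewrite ?bracket0r // bracketDr.
Qed.

Lemma bracketC x y : lie_bracket y x = - lie_bracket x y.
Proof.
apply/eqP; rewrite -addr_eq0 addrC; have := lie_bracketxx (x + y).
by rewrite bracketDl !bracketDr !lie_bracketxx add0r addr0 => ->.
Qed.

Section OneCoframe.

Variables (kap : nat -> g -> R) (e : nat -> g).
Hypothesis ke : coframe kap e.

Lemma coframeD k x y : kap k (x + y) = kap k x + kap k y.
Proof. by have [/(_ k 1 x y)] := ke; rewrite /= scale1r mul1r. Qed.

Lemma coframe0 k : kap k 0 = 0.
Proof. by apply: (addrI (kap k 0)); rewrite -coframeD !addr0. Qed.

Lemma coframeZ k a x : kap k (a *: x) = a * kap k x.
Proof.
by have [/(_ k a x 0)] := ke; rewrite /= addr0 coframe0 addr0.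
Qed.

Lemma coframe_sum k I (r : seq I) (f : I -> g) :
  kap k (\sum_(i <- r) f i) = \sum_(i <- r) kap k (f i).
Proof.
by elim/big_rec2: _ => [|i _ y _ <-]; rewrite ?coframe0 // coframeD.
Qed.

Lemma coframe_delta k i : (k < 6)%N -> (i < 6)%N -> kap k (e i) = (k == i)%:R.
Proof. by case: ke => _ + _; apply. Qed.

Lemma coframeE x : x = \sum_(i < 6) kap i x *: e i.
Proof. by case: ke. Qed.

Lemma coframe_inj x y :
  (forall k, (k < 6)%N -> kap k x = kap k y) -> x = y.
Proof.
move=> xy; rewrite (coframeE x) (coframeE y).
by apply: eq_bigr => i _; rewrite xy.
Qed.

Lemma coframe_bracket k x y : kap k (lie_bracket x y)
  = \sum_(a < 6) \sum_(b < 6) kap a x * kap b y * kap k (lie_bracket (e a) (e b)).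
Proof.
rewrite {1}(coframeE x) bracket_suml coframe_sum; apply: eq_bigr => a _.
rewrite {1}(coframeE y) bracket_sumr coframe_sum; apply: eq_bigr => b _.
by rewrite bracketZl bracketZr !coframeZ mulrA.
Qed.

Lemma form_expand T phi x y : bounded 6 T ->
  form T kap phi x y
  = \sum_(a < 6) \sum_(b < 6) kap a x * kap b y * form T kap phi (e a) (e b).
Proof.
move=> bT; rewrite /form.
under [RHS]eq_bigr => a _ do under eq_bigr => b _ do rewrite big_distrr /=.
under [RHS]eq_bigr => a _ do rewrite exchange_big /=.
rewrite exchange_big /= big_seq [RHS]big_seq; apply: eq_bigr => p pT.
have /and3P[p1 p2 _] := allP bT _ pT.
have eqw k z (k6 : (k < 6)%N) :
    kap k z = \sum_(a < 6) kap a z * kap k (e a).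
  rewrite {1}(coframeE z) coframe_sum; apply: eq_bigr => a _.
  by rewrite coframeZ.
rewrite /wedge (eqw p.1.1.1 x) // (eqw p.1.1.1 y) // (eqw p.1.1.2 x) //.
rewrite (eqw p.1.1.2 y) // !big_distrlr /=.
rewrite [X in _ * (_ - X)]exchange_big /=.
rewrite -sumrB big_distrr /=; apply: eq_bigr => a _.
rewrite -sumrB big_distrr /=; apply: eq_bigr => b _.
ring.
Qed.

End OneCoframe.

End Coframes.

(** * Changes of coframe *)

(* On the dual basis, [Shear i j p] replaces e^j by e^j - p e^i, and [Scale i p q], where p is the
   inverse of q, replaces e^i by q e^i. *)
Inductive move : Type :=
  | Shear of nat & nat & pexpr
  | Swap of nat & nat
  | Scale of nat & pexpr & pexpr.

Definition swapn (i j a : nat) : nat :=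
  if a == i then j else if a == j then i else a.

(** A structure constant has two covector indices and one vector index. [slot o a] writes the old
    covector e^a in the new coframe, and [target o k] writes the old vector e_k in the new basis. *)
Definition slot (o : move) (a : nat) : seq (nat * pexpr) :=
  match o with
  | Shear i j p => if a == j then [:: (j, 1%P); (i, p)] else [:: (a, 1%P)]
  | Swap i j => [:: (swapn i j a, 1%P)]
  | Scale i p q => [:: (a, if a == i then p else 1%P)]
  end.

Definition target (o : move) (k : nat) : seq (nat * pexpr) :=
  match o with
  | Shear i j p => if k == i then [:: (i, 1%P); (j, (- p)%P)] else [:: (k, 1%P)]
  | Swap i j => [:: (swapn i j k, 1%P)]
  | Scale i p q => [:: (k, if k == i then q else 1%P)]
  end.

Definition apply_move (o : move) (T : table pexpr) : table pexpr :=
  flatten [seq flatten [seq flatten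
    [seq [seq (a.1, b.1, k.1, (p.2 * (k.2 * (a.2 * b.2)))%P)
         | k <- target o p.1.2]
    | b <- slot o p.1.1.2]
    | a <- slot o p.1.1.1]
    | p <- T].

Definition move_ok n hyps (o : move) : bool :=
  match o with
  | Shear i j p => [&& i != j, i < n & j < n]%N
  | Swap i j => (i < n)%N && (j < n)%N
  | Scale i p q => (i < n)%N && pzero hyps (p * q - 1)%P
  end.

Definition coef_term (a b k : nat) (p : nat * nat * nat * pexpr) : pexpr :=
  if p.1.2 == k then
    if (p.1.1.1 == a) && (p.1.1.2 == b) then
      if (p.1.1.1 == b) && (p.1.1.2 == a) then 0%P else p.2
    else if (p.1.1.1 == b) && (p.1.1.2 == a) then (- p.2)%P else 0%P
  else 0%P.

Definition coef (T : table pexpr) (a b k : nat) : pexpr :=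
  foldr (fun p acc =>
    if coef_term a b k p is PEO then acc else (coef_term a b k p + acc)%P) 0%P T.

Definition jacobi n (T : table pexpr) (i j l m : nat) : pexpr :=
  foldr (fun b acc => (coef T i b m * coef T j l b + (coef T j b m * coef T l i b
    + (coef T l b m * coef T i j b + acc)))%P) 0%P (iota 0 n).

Definition same_table n hyps (T T' : table pexpr) : bool :=
  [&& bounded n T, bounded n T' &
  all (fun k => all (fun a => all (fun b =>
    pzero hyps (coef T a b k - coef T' a b k)%P)
    (iota 0 n)) (iota 0 n)) (iota 0 n)].

Lemma all_flatten (A : Type) (P : pred A) (ss : seq (seq A)) :
  all P (flatten ss) = all (all P) ss.
Proof. by elim: ss => //= s ss IH; rewrite all_cat IH. Qed.

Section Tables.

Variables (R : rcfType) (g : lieAlgebra R).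
Implicit Types (kap : nat -> g -> R) (e : nat -> g) (x y : g) (l : list R).

Definition evalT l (T : table pexpr) : table R :=
  [seq (p.1, peval l p.2) | p <- T].

Lemma bounded_evalT n l T : bounded n (evalT l T) = bounded n T.
Proof. by rewrite /bounded all_map. Qed.

Lemma form_coef l T kap e phi a b : coframe kap e -> bounded 6 T ->
  (a < 6)%N -> (b < 6)%N ->
  form (evalT l T) kap phi (e a) (e b)
  = \sum_(k < 6) phi k * peval l (coef T a b k).
Proof.
move=> ke + a6 b6; elim: T => [|p T IH] /=.
  by rewrite /form big_nil big1 // => k _; rewrite mulr0.
case/andP=> /and3P[p1 p2 p3] /IH {}IH.
rewrite /form big_cons -/(form _ _ _ _ _) IH.
have E k : peval l (coef (p :: T) a b k)
    = peval l (coef_term a b k p) + peval l (coef T a b k).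
  by rewrite /=; case: (coef_term _ _ _ _) => //=; rewrite add0r.
under [RHS]eq_bigr => k _ do rewrite E mulrDr.
rewrite big_split /=; congr (_ + _).
rewrite (bigD1 (Ordinal p3)) //= big1 ?addr0 => [|k].
  rewrite /wedge !(coframe_delta ke) // /coef_term eqxx.
  case: (p.1.1.1 == a); case: (p.1.1.1 == b); case: (p.1.1.2 == a);
  by case: (p.1.1.2 == b) => /=; ring.
rewrite /coef_term -val_eqE /= eq_sym => /negbTE ->; exact: mulr0.
Qed.

Lemma form_delta_coef l T kap e k a b : coframe kap e -> bounded 6 T ->
  (a < 6)%N -> (b < 6)%N -> (k < 6)%N ->
  form (evalT l T) kap (dlt R k) (e a) (e b) = peval l (coef T a b k).
Proof.
move=> ke bT a6 b6 k6; rewrite (form_coef l _ ke) // (bigD1 (Ordinal k6)) //=.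
rewrite /dlt eqxx mul1r big1 ?addr0 // => i.
by rewrite -val_eqE /= eq_sym => /negbTE ->; rewrite mul0r.
Qed.

Lemma bounded_leq A n m (T : table A) : (n <= m)%N -> bounded n T -> bounded m T.
Proof.
move=> nm; apply: sub_all => p /and3P[? ? ?].
by apply/and3P; split; apply: leq_trans nm.
Qed.

Lemma form_apply_move l o T kap kap' phi phi' x y :
  (forall a z, kap a z = \sum_(s <- slot o a) peval l s.2 * kap' s.1 z) ->
  (forall k, phi k = \sum_(s <- target o k) peval l s.2 * phi' s.1) ->
  form (evalT l (apply_move o T)) kap' phi' x y = form (evalT l T) kap phi x y.
Proof.
move=> Hs Ht; rewrite /form !big_map big_flatten big_map.
apply: eq_bigr => p _ /=.
rewrite big_flatten big_map /wedge !Hs Ht /= big_distrr /=.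
rewrite [X in _ - X]big_distrlr /= big_distrlr /= -sumrB big_distrr /=.
apply: eq_bigr => a _.
rewrite big_flatten big_map -sumrB big_distrr /=; apply: eq_bigr => b _.
rewrite big_map big_distrl /=; apply: eq_bigr => k _ /=; ring.
Qed.

(** By duality, the difference between x and its expansion is annihilated by every [kap' k], hence
    by every [kap k], hence vanishes. *)
Lemma coframe_change kap e kap' e' : coframe kap e ->
    (forall k, scalar (kap' k)) ->
    (forall k i, (k < 6)%N -> (i < 6)%N -> kap' k (e' i) = (k == i)%:R) ->
    (forall x : g, (forall k, (k < 6)%N -> kap' k x = 0) ->
      forall k, (k < 6)%N -> kap k x = 0) ->
  coframe kap' e'.
Proof.
move=> ke lin delta sep; split=> // x.
have lin0 k : kap' k 0 = 0.
  by have := lin k (-1) 0 0; rewrite /= scaler0 addr0 mulN1r addNr.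
have linZ k a z : kap' k (a *: z) = a * kap' k z.
  by have := lin k a z 0; rewrite /= addr0 lin0 addr0.
have linD k z t : kap' k (z + t) = kap' k z + kap' k t.
  by have := lin k 1 z t; rewrite /= scale1r mul1r.
apply/eqP; rewrite -subr_eq0; apply/eqP; apply: (coframe_inj ke) => k k6.
rewrite (coframe0 ke); apply: sep => // {k6}k k6.
rewrite linD -scaleN1r linZ mulN1r.
have -> : kap' k (\sum_(i < 6) kap' i x *: e' i)
    = \sum_(i < 6) kap' i x * kap' k (e' i).
  by elim/big_rec2: _ => [|i a b _ <-]; rewrite ?lin0 // linD linZ.
rewrite (bigD1 (Ordinal k6)) //= delta // eqxx mulr1 big1 ?addr0 ?subrr // => i.
by rewrite -val_eqE /= delta // eq_sym => /negbTE ->; rewrite mulr0.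
Qed.

Lemma form_suml T kap (phi : nat -> R) x y n : bounded n T ->
  form T kap phi x y = \sum_(k < n) phi k * form T kap (dlt R k) x y.
Proof.
move=> bT; rewrite /form.
under [RHS]eq_bigr => k _ do rewrite big_distrr /=.
rewrite exchange_big /= big_seq [RHS]big_seq; apply: eq_bigr => p pT.
have /and3P[_ _ p3] := allP bT _ pT.
rewrite (bigD1 (Ordinal p3)) //= big1 ?addr0 => [|k].
  by rewrite /dlt /= eqxx /=; ring.
by rewrite -val_eqE /= /dlt => /negbTE -> /=; ring.
Qed.

(** Common part of the three kinds of moves. A move must keep every initial segment of indices a < m
    with m >= n stable: this preserves both the bound on the table and the flag above n. *)
Lemma presented_change n l o T kap e kap' e' :
    (n <= 6)%N ->
    coframe kap e -> bounded n T -> structured n (evalT l T) kap ->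
    flagged n kap ->
    (forall k, scalar (kap' k)) ->
    (forall k i, (k < 6)%N -> (i < 6)%N -> kap' k (e' i) = (k == i)%:R) ->
    (forall a z, kap a z = \sum_(s <- slot o a) peval l s.2 * kap' s.1 z) ->
    (forall a m, (n <= m)%N -> (a < m)%N ->
      all (fun s => s.1 < m)%N (slot o a) && all (fun s => s.1 < m)%N (target o a)) ->
    (forall m (z : g), (m < n)%N -> kap' m z = \sum_(k < n)
       (\sum_(s <- target o k) peval l s.2 * dlt R m s.1) * kap k z) ->
    (forall k, (n <= k)%N -> kap' k =1 kap k) ->
  presented g n (evalT l (apply_move o T)).
Proof.
move=> n6 ke bT sT fl lin delta Hs lt Ht id_.
have kap0 m (z : g) : (n <= m)%N -> (forall k, (k < m)%N -> kap' k z = 0) ->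
    forall k, (k < m)%N -> kap k z = 0.
  move=> nm k0 k km; rewrite Hs.
  have /andP[+ _] := lt k m nm km; elim: (slot o k) => [|s r IH] /=.
    by rewrite big_nil.
  by case/andP=> sm /IH {}IH; rewrite big_cons IH k0 // mulr0 addr0.
exists kap', e'; split.
- apply: (coframe_change ke) => // x k0; exact: kap0.
- rewrite bounded_evalT /bounded /apply_move all_flatten all_map.
  apply: sub_all bT => p /and3P[p1 p2 p3] /=; rewrite all_flatten all_map.
  have /andP[l1 _] := lt _ n (leqnn n) p1.
  apply: sub_all l1 => a an /=; rewrite all_flatten all_map.
  have /andP[l2 _] := lt _ n (leqnn n) p2.
  apply: sub_all l2 => b bn /=; rewrite all_map.
  have /andP[_ l3] := lt _ n (leqnn n) p3.
  by apply: sub_all l3 => k kn /=; rewrite an bn.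
- move=> m x y mn; rewrite Ht // (@form_apply_move l o T kap kap' (fun k =>
    \sum_(s <- target o k) peval l s.2 * dlt R m s.1)) //.
  rewrite (@form_suml _ _ _ _ _ n) ?bounded_evalT //.
  by apply: eq_bigr => k _; rewrite sT.
- move=> k x y /andP[nk k6] k0; rewrite id_ // fl ?nk //; exact: kap0.
Qed.

Lemma move_sound n l hyps o T : holds l hyps -> (n <= 6)%N ->
  move_ok n hyps o ->
  presented g n (evalT l T) -> presented g n (evalT l (apply_move o T)).
Proof.
move=> hyp n6 ok [kap [e [ke]]]; rewrite bounded_evalT => bT sT fl.
have lin k : scalar (kap k) by case: ke.
have sumdlt m k (F : nat -> R) : (k < m)%N ->
    \sum_(i < m) (k == i)%:R * F i = F k.
  move=> km; rewrite (bigD1 (Ordinal km)) //= eqxx mul1r big1 ?addr0 // => i.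
  by rewrite -val_eqE /= eq_sym => /negbTE ->; rewrite mul0r.
case: o ok => [i j p|i j|i p q] /=.
- case/and3P=> ij ni nj; have i6 := leq_trans ni n6; have j6 := leq_trans nj n6.
  have ji : j == i = false by rewrite eq_sym; apply: negbTE.
  apply: (@presented_change n l _ T kap e
    (fun k z => if k == j then kap j z - peval l p * kap i z else kap k z)
    (fun a => if a == i then e i + peval l p *: e j else e a)) => //.
  + by move=> k a x y; case: ifP => _; rewrite !lin //=; ring.
  + move=> k a k6 a6; rewrite (fun_if (kap j)) (fun_if (kap i)) (fun_if (kap k)).
    rewrite !(coframeD ke) !(coframeZ ke) !(coframe_delta ke) // !eqxx.
    rewrite (negbTE ij) ji (eq_sym i a).
    case: (eqVneq k j) => [->|kj]; case: (eqVneq a i) => [->|ai] //=;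
      rewrite ?eqxx ?ji //=; ring.
  + move=> a z /=; case: (eqVneq a j) => [->|aj]; rewrite !big_cons big_nil /=.
      by rewrite eqxx (negbTE ij); ring.
    by rewrite (negbTE aj); ring.
  + move=> a m nm am /=; have im := leq_trans ni nm; have jm := leq_trans nj nm.
    by case: (a == j); case: (a == i); rewrite /= ?im ?jm ?am.
  + move=> m z mn; rewrite (eq_bigr (fun k : 'I_n => (m == k)%:R * kap k z
        + (i == k)%:R * (- (m == j)%:R * peval l p * kap k z))) => [|k _].
      rewrite big_split /= (sumdlt n m (fun k => kap k z)) //.
      rewrite (sumdlt n i (fun k => - (m == j)%:R * peval l p * kap k z)) //.
      by case: (eqVneq m j) => [->|_] /=; ring.
    rewrite /dlt /=; case: (eqVneq (k : nat) i) => [->|ki];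
      rewrite !big_cons big_nil /= ?eqxx; first by ring.
    by ring.
  + by move=> k nk z; rewrite gtn_eqF // (leq_trans nj).
- case/andP=> ni nj; have i6 := leq_trans ni n6; have j6 := leq_trans nj n6.
  have sK : involutive (swapn i j).
    move=> a; rewrite /swapn; case: (eqVneq a i) => [->|ai].
      by rewrite eqxx; case: (eqVneq j i).
    by case: (eqVneq a j) => [->|aj]; rewrite ?eqxx // (negbTE ai) (negbTE aj).
  have slt m a : (n <= m)%N -> (a < m)%N -> (swapn i j a < m)%N.
    move=> nm am; rewrite /swapn; have im := leq_trans ni nm.
    by have jm := leq_trans nj nm; do 2?case: ifP.
  apply: (@presented_change n l _ T kap e
    (fun k => kap (swapn i j k)) (fun a => e (swapn i j a))) => //.
  + by move=> k a k6 a6; rewrite (coframe_delta ke) ?slt // (inj_eq (inv_inj sK)).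
  + by move=> a z /=; rewrite big_seq1 /= sK mul1r.
  + by move=> a m nm am /=; rewrite slt.
  + move=> m z mn; rewrite -(sumdlt n (swapn i j m) (fun k => kap k z)) ?slt //.
    apply: eq_bigr => k _; rewrite big_seq1 /= mul1r /dlt.
    by rewrite -(inj_eq (inv_inj sK)) sK.
  + move=> k nk z; rewrite /swapn !gtn_eqF //; [exact: leq_trans nj _|].
    exact: leq_trans ni _.
- case/andP=> ni /(pzeroP hyp) /= /eqP; rewrite subr_eq0 => /eqP pq.
  have i6 := leq_trans ni n6.
  apply: (@presented_change n l _ T kap e
    (fun k z => (if k == i then peval l q else 1) * kap k z)
    (fun a => (if a == i then peval l p else 1) *: e a)) => //.
  + by move=> k a x y; rewrite lin /=; ring.
  + move=> k a k6 a6; rewrite (coframeZ ke) (coframe_delta ke) //.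
    case: (eqVneq k a) => [->|_]; last by rewrite !mulr0.
    by rewrite mulr1; case: ifP => _; rewrite ?mulr1 // mulrC.
  + move=> a z /=; rewrite big_seq1 /=; case: ifP => _ /=; rewrite ?mul1r //.
    by rewrite mulrA pq mul1r.
  + by move=> a m nm am /=; rewrite am.
  + move=> m z mn.
    rewrite -(sumdlt n m (fun k => (if k == i then peval l q else 1) * kap k z)) //.
    by apply: eq_bigr => k _; rewrite big_seq1 /= /dlt; case: ifP => _ /=; ring.
  + by move=> k nk z; rewrite gtn_eqF ?mul1r // (leq_trans ni).
Qed.

End Tables.

(** * Nice patterns and one-dimensional central extensions *)

Definition pairs n : seq (nat * nat) :=
  [seq (i, j) | j <- iota 0 n, i <- iota 0 j].

Definition triples n : seq (nat * nat * nat) :=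
  [seq (p.1, p.2, k) | p <- [seq (i, j) | i <- iota 0 n, j <- iota 0 n],
     k <- iota 0 n].

(** Both conditions of niceness at once: among the arrows (i, j) -> k with the same i, j determines
    k and k determines j. Triples whose constant is not certified to vanish count as arrows, which
    only makes the test stricter. *)
Definition nice_pattern (hyps : list (pexpr * pexpr)) (T : table pexpr) : bool :=
  let s := [seq t <- triples 6 | ~~ pzero hyps (coef T t.1.1 t.1.2 t.2)] in
  bounded 6 T &&
  all (fun t => all (fun u => (t.1.1 == u.1.1) ==>
    ((t.1.2 == u.1.2) == (t.2 == u.2))) s) s.

Definition moves_ok n hyps := all (move_ok n hyps).

Definition apply_moves (os : seq move) (T : table pexpr) : table pexpr :=
  foldl (fun T o => apply_move o T) T os.

(** Used with c = -1: the tuples prescribe de^k, whereas tables record e^k([x, y]) = - de^k(x,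
    y). *)
Definition structure_table (A : Type) (c : A) (theta : seq (seq (nat * nat))) : table A :=
  flatten [seq [seq (p.1.-1, p.2.-1, k, c) | p <- nth [::] theta k] | k <- iota 0 6].

Lemma mem_pairs n i j : ((i, j) \in pairs n) = (i < j < n)%N.
Proof.
apply/allpairsPdep/andP => [[a [b [+ + [-> ->]]]]|[ij jn]].
  by rewrite !mem_iota.
by exists j, i; rewrite !mem_iota.
Qed.

Lemma uniq_pairs n : uniq (pairs n).
Proof.
apply: allpairs_uniq_dep => [|i _|[a b] [c d] _ _ /= [-> ->] //];
exact: iota_uniq.
Qed.

Section Presentations.

Variables (R : rcfType) (g : lieAlgebra R).
Implicit Types (kap : nat -> g -> R) (e : nat -> g) (x y : g) (l : list R).

Lemma coef_eq0 l n T i j k : bounded n T -> (n <= i)%N || (n <= j)%N ->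
  peval (R := R) l (coef T i j k) = 0.
Proof.
move=> + ij; elim: T => //= p T IH /andP[/and3P[p1 p2 _] /IH {}IH].
suff -> : coef_term i j k p = 0%P by [].
rewrite /coef_term; case: ifP => // _; case/orP: ij => le.
  by rewrite (ltn_eqF (leq_trans p1 le)) (ltn_eqF (leq_trans p2 le)) andbF.
by rewrite (ltn_eqF (leq_trans p1 le)) (ltn_eqF (leq_trans p2 le)) andbF.
Qed.

Lemma coef_bracket n l T kap e k a b : coframe kap e -> (n <= 6)%N ->
  bounded n T -> structured n (evalT l T) kap ->
  (a < 6)%N -> (b < 6)%N -> (k < n)%N ->
  kap k (lie_bracket (e a) (e b)) = peval l (coef T a b k).
Proof.
move=> ke n6 bT sT a6 b6 kn; rewrite sT // (form_delta_coef _ ke) //.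
  exact: bounded_leq bT.
exact: leq_trans n6.
Qed.

Lemma sum_iota (F : nat -> R) n :
  \sum_(i <- iota 0 n) F i = \sum_(i < n) F i.
Proof. by rewrite -[n in LHS]subn0 big_mkord. Qed.

Lemma jacobiP n l T i j m k : (n <= 6)%N -> presented g n (evalT l T) ->
  [&& i < n, j < n, m < n & k < n]%N -> peval l (jacobi n T i j m k) = 0.
Proof.
move=> n6 [kap [e [ke]]]; rewrite bounded_evalT => bT sT _.
case/and4P=> iN jN mN kN.
have lt6 a : (a < n)%N -> (a < 6)%N by move=> an; apply: leq_trans n6.
have J a b c : (a < n)%N -> (b < n)%N -> (c < n)%N ->
    kap k (lie_bracket (e a) (lie_bracket (e b) (e c)))
    = \sum_(d < n) peval l (coef T a d k) * peval l (coef T b c d).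
  move=> an bn cn; rewrite {1}(coframeE ke (lie_bracket (e b) (e c))).
  rewrite bracket_sumr (coframe_sum ke).
  pose F d := kap d (lie_bracket (e b) (e c)) * peval l (coef T a d k).
  rewrite (eq_bigr (fun d : 'I_6 => F d)) => [|d _]; last first.
    by rewrite bracketZr (coframeZ ke) (coef_bracket ke n6 bT sT (lt6 _ an) (ltn_ord d) kN).
  rewrite -(big_mkord xpredT F) (big_cat_nat (leq0n n) n6) //= [X in _ + X]big1_seq.
    rewrite addr0 big_mkord; apply: eq_bigr => d _; rewrite /F mulrC.
    by rewrite (coef_bracket ke n6 bT sT) ?lt6.
  move=> d /=; rewrite mem_index_iota => /andP[nd _].
  by rewrite /F (coef_eq0 _ _ bT) ?nd ?orbT ?mulr0.
have := congr1 (kap k) (lie_jacobi (e i) (e j) (e m)).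
rewrite !(coframeD ke) (coframe0 ke) !J // -!big_split /= => <-.
rewrite /jacobi -(sum_iota (fun d => peval l (coef T i d k) * peval l (coef T j m d) +
  peval l (coef T j d k) * peval l (coef T m i d) +
  peval l (coef T m d k) * peval l (coef T i j d))).
elim: (iota 0 n) => [|d s IH]; first by rewrite big_nil.
by rewrite big_cons /= IH !addrA.
Qed.

Lemma same_tableP n l hyps T T' : holds l hyps -> (n <= 6)%N ->
  same_table n hyps T T' ->
  presented g n (evalT l T) -> presented g n (evalT l T').
Proof.
move=> hyp n6 /and3P[bT bT' /allP eqT] [kap [e [ke _ sT fl]]].
exists kap, e; split=> //; first by rewrite bounded_evalT.
move=> k x y kn; rewrite sT //.
have b6 T0 : bounded n T0 -> bounded 6 (evalT l T0).
  by move=> b0; rewrite bounded_evalT; apply: bounded_leq b0.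
rewrite !(form_expand ke) ?b6 //; apply: eq_bigr => a _; apply: eq_bigr => b _.
congr (_ * _); have k6 := leq_trans kn n6.
rewrite !(form_delta_coef _ ke) //; try exact: bounded_leq n6 _.
have [an|na] := ltnP a n; last first.
  by rewrite (coef_eq0 _ _ bT) ?(coef_eq0 _ _ bT') ?na.
have [bn|nb] := ltnP b n; last first.
  by rewrite (coef_eq0 _ _ bT) ?(coef_eq0 _ _ bT') ?nb ?orbT.
have := eqT k; rewrite mem_iota => /(_ kn)/allP/(_ a); rewrite mem_iota.
move=> /(_ an)/allP/(_ b); rewrite mem_iota => /(_ bn)/(pzeroP hyp)/= /eqP.
by rewrite subr_eq0 => /eqP.
Qed.

Lemma moves_sound n l hyps os T : holds l hyps -> (n <= 6)%N ->
  moves_ok n hyps os ->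
  presented g n (evalT l T) -> presented g n (evalT l (apply_moves os T)).
Proof.
move=> hyp n6; elim: os T => //= o os IH T /andP[ok oks] pT.
exact: IH oks (move_sound hyp n6 ok pT).
Qed.

(** By the flag condition, e^n([x, y]) vanishes as soon as x or y lies in the span of e_n, ..., e_5.
    It is therefore an alternating form on the quotient, given by one constant for each pair i < j <
    n. *)
Lemma presented_next n T : (n < 6)%N -> presented g n T ->
  exists w : nat -> nat -> R,
    presented g n.+1 (T ++ [seq (p.1, p.2, n, w p.1 p.2) | p <- pairs n]).
Proof.
move=> n6 [kap [e [ke bT sT fl]]].
pose w i j := kap n (lie_bracket (e i) (e j)).
have wC i j : w j i = - w i j.
  by rewrite /w bracketC -scaleN1r (coframeZ ke) mulN1r.
have w0l i j : (n <= i < 6)%N -> w i j = 0.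
  case/andP=> ni i6; apply: fl => [|a an]; first by rewrite leqnn.
  by rewrite (coframe_delta ke) ?(ltn_trans an) // ltn_eqF // (leq_trans an).
have w0r i j : (n <= j < 6)%N -> w i j = 0.
  by move=> nj; rewrite wC w0l ?oppr0.
exists w, kap, e; split=> //; first 1 last.
- move=> k x y; rewrite ltnS leq_eqVlt => /predU1P[->|kn]; last first.
    rewrite /form big_cat /= big_map [X in _ + X]big1 => [|p _ /=].
      by rewrite addr0 sT.
    by rewrite /dlt ltn_eqF // mulr0 mul0r.
  rewrite /form big_cat /= big_map [X in X + _]big_seq big1 => [|p pT]; last first.
    have /and3P[_ _ p3] := allP bT _ pT.
    by rewrite /dlt gtn_eqF // mulr0 mul0r.
  rewrite add0r (coframe_bracket ke).
  pose W := [seq (p.1, p.2, n, w p.1 p.2) | p <- pairs n].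
  have bW : bounded 6 W.
    rewrite /bounded all_map; apply/allP => -[i j] /=; rewrite mem_pairs => /andP[ij jn].
    by rewrite (ltn_trans ij) ?(ltn_trans jn) ?n6.
  transitivity (form W kap (dlt R n) x y); last by rewrite /form big_map.
  rewrite (form_expand ke) //; apply: eq_bigr => a _; apply: eq_bigr => b _.
  congr (_ * _); rewrite -/(w a b) /form big_map /= /dlt eqxx /wedge.
  have S i j : \sum_(p <- pairs n) w p.1 p.2 * ((p.1 == i)%:R * (p.2 == j)%:R)
      = (i < j < n)%:R * w i j.
    case: (boolP (i < j < n)%N) => ijn; last first.
      rewrite mul0r big_seq big1 // => -[i' j']; rewrite mem_pairs /= => h.
      case: eqP => [ii|_]; last by rewrite mul0r mulr0.
      case: eqP => [jj|_]; last by rewrite !mulr0.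
      by rewrite -ii -jj h in ijn.
    rewrite (bigD1_seq (i, j)) ?mem_pairs ?uniq_pairs //= !eqxx !mul1r mulr1.
    rewrite big1 ?addr0 // => -[i' j']; rewrite xpair_eqE /= => /negbTE.
    by case: eqP; case: eqP; rewrite ?mul0r ?mulr0.
  transitivity (\sum_(p <- pairs n) (w p.1 p.2 * ((p.1 == a)%:R * (p.2 == b)%:R)
     - w p.1 p.2 * ((p.1 == b)%:R * (p.2 == a)%:R))).
    rewrite sumrB !S; case: (ltngtP a b) => ab /=.
    - by rewrite mul0r subr0; case: ltnP => nb; rewrite ?mul1r // w0r ?nb ?mul0r /=.
    - rewrite mul0r sub0r; case: ltnP => na; first by rewrite mul1r -wC.
      by rewrite w0l ?na //= mul0r oppr0.
    - by rewrite ab subrr /w lie_bracketxx (coframe0 ke).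
  apply/esym; apply: eq_big_seq => -[i j]; rewrite mem_pairs /= => /andP[ij jn].
  by have j6 := ltn_trans jn n6; rewrite !(coframe_delta ke) ?(ltn_trans ij) //; ring.
- by move=> k x y /andP[nk k6] x0; apply: fl => //; rewrite (ltnW nk).
- rewrite /bounded all_cat; apply/andP; split.
    by apply: bounded_leq bT.
  rewrite all_map; apply/allP => -[i j] /=; rewrite mem_pairs => /andP[ij jn].
  by rewrite leqnn !ltnS (ltnW (ltn_trans ij jn)) (ltnW jn).
Qed.

End Presentations.

(** * Coframes and bases; existence of an adapted flag *)

Section Bases.

Variables (R : rcfType) (g : lieAlgebra R).
Implicit Types (kap : nat -> g -> R) (e : nat -> g) (x y : g) (l : list R).

Definition basis6 e : 6.-tuple g := [tuple e i | i < 6].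

Lemma nth_basis6 e (i : 'I_6) : (basis6 e)`_i = e i.
Proof. by rewrite -tnth_nth tnth_mktuple. Qed.

Lemma coframe_basis kap e : coframe kap e -> basis_of fullv (basis6 e).
Proof.
move=> ke; rewrite /basis_of; apply/andP; split.
  rewrite eqEsubv subvf /=; apply/subvP => x _.
  rewrite (coframeE ke x) rpred_sum // => i _.
  by rewrite rpredZ // -(nth_basis6 e i) memv_span // mem_nth ?size_tuple.
apply/freeP => a a0 i; have := congr1 (kap i) a0.
rewrite (coframe_sum ke) (coframe0 ke) (bigD1 i) //= big1 ?addr0 => [|j ji].
  by rewrite nth_basis6 (coframeZ ke) (coframe_delta ke) // eqxx mulr1.
rewrite nth_basis6 (coframeZ ke) (coframe_delta ke) //.
by rewrite -val_eqE /= eq_sym in ji; rewrite (negbTE ji) mulr0.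
Qed.

Lemma coframe_coord kap e (i : 'I_6) x : coframe kap e ->
  coord (basis6 e) i x = kap i x.
Proof.
move=> ke; rewrite {1}(coframeE ke x).
rewrite (eq_bigr (fun j : 'I_6 => kap j x *: (basis6 e)`_j)) => [|j _].
  by rewrite coord_sum_free // (basis_free (coframe_basis ke)).
by rewrite nth_basis6.
Qed.

Lemma coframe_of_basis (b : 6.-tuple g) : basis_of fullv b ->
  coframe (fun k => coord b (inord k)) (fun i => b`_i).
Proof.
move=> bb; have fb := basis_free bb; split=> [k a x y|k i k6 i6|x].
- exact: linearP.
- by rewrite -{1}(@inordK 5 i) // coord_free // -val_eqE /= !inordK // eq_sym.
- rewrite {1}(coord_basis bb (memvf x)); apply: eq_bigr => i _.
  by rewrite inord_val.
Qed.

Lemma nice_of_coframe kap e : coframe kap e ->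
    (forall i j k k', (i < 6)%N -> (j < 6)%N -> (k < 6)%N -> (k' < 6)%N ->
      kap k (lie_bracket (e i) (e j)) != 0 ->
      kap k' (lie_bracket (e i) (e j)) != 0 -> k = k') ->
    (forall i j j' k, (i < 6)%N -> (j < 6)%N -> (j' < 6)%N -> (k < 6)%N ->
      kap k (lie_bracket (e i) (e j)) != 0 ->
      kap k (lie_bracket (e i) (e j')) != 0 -> j = j') ->
  nice_basis (basis6 e).
Proof.
move=> ke H1 H2; split=> [|i j|i j]; first exact: coframe_basis ke.
- rewrite !nth_basis6; set z := lie_bracket _ _.
  case: (pickP (fun k : 'I_6 => kap k z != 0)) => [k kz|z0].
    exists k, (kap k z); rewrite nth_basis6; apply: (coframe_inj ke) => m m6.
    rewrite (coframeZ ke) (coframe_delta ke) //.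
    case: (eqVneq m k) => [->|mk]; first by rewrite mulr1.
    rewrite mulr0; apply/eqP; apply: contraNT mk => mz; apply/eqP.
    exact: (H1 i j).
  exists ord0, 0; rewrite scale0r; apply: (coframe_inj ke) => m m6.
  by rewrite (coframe0 ke); apply/eqP/negbFE/(z0 (Ordinal m6)).
- rewrite nth_basis6 /interior /CE_diff.
  have E y : coord (basis6 e) j (lie_bracket (e i) y)
      = \sum_(h < 6) kap h y * kap j (lie_bracket (e i) (e h)).
    rewrite (coframe_coord _ _ ke) {1}(coframeE ke y) bracket_sumr (coframe_sum ke).
    by apply: eq_bigr => h _; rewrite bracketZr (coframeZ ke).
  case: (pickP (fun h : 'I_6 => kap j (lie_bracket (e i) (e h)) != 0)) => [h hz|z0].
    exists h, (- kap j (lie_bracket (e i) (e h))) => y.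
    rewrite E (bigD1 h) //= big1 ?addr0 => [|h' h'h].
      by rewrite (coframe_coord _ _ ke) mulrC mulNr.
    case: (eqVneq (kap j (lie_bracket (e i) (e h'))) 0) => [->|nz].
      by rewrite mulr0.
    by move: h'h; rewrite (val_inj (H2 i h' h j _ _ _ _ nz hz)) ?eqxx.
  exists ord0, 0 => y; rewrite E mul0r big1 ?oppr0 // => h _.
  by have /negbFE/eqP-> := z0 h; rewrite mulr0.
Qed.

Lemma nice_pattern_basis l hyps T kap e : holds l hyps -> nice_pattern hyps T ->
  coframe kap e -> structured 6 (evalT l T) kap -> nice_basis (basis6 e).
Proof.
move=> hyp; rewrite /nice_pattern; set s := [seq _ <- _ | _].
move=> /andP[bT /allP nT] ke sT.
have inS i j k : (i < 6)%N -> (j < 6)%N -> (k < 6)%N ->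
    kap k (lie_bracket (e i) (e j)) != 0 -> (i, j, k) \in s.
  move=> i6 j6 k6; rewrite (coef_bracket ke _ bT sT) // => nz.
  rewrite mem_filter /=; apply/andP; split.
    by apply: contra nz => /(pzeroP hyp) ->.
  apply/allpairsP; exists ((i, j), k); rewrite mem_iota k6; split=> //.
  by apply/allpairsP; exists (i, j); rewrite !mem_iota i6 j6.
have inj i j k i' j' k' : (i, j, k) \in s -> (i', j', k') \in s -> i = i' ->
    (j == j') = (k == k').
  by move=> /nT/allP h /h /= + ii; rewrite ii eqxx => /eqP.
apply: (nice_of_coframe ke) => [i j k k' i6 j6 k6 k'6 z z'|i j j' k i6 j6 j'6 k6 z z'].
  by apply/eqP; rewrite -(inj _ _ _ _ _ _ (inS _ _ _ i6 j6 k6 z) (inS _ _ _ i6 j6 k'6 z')).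
by apply/eqP; rewrite (inj _ _ _ _ _ _ (inS _ _ _ i6 j6 k6 z) (inS _ _ _ i6 j'6 k6 z')).
Qed.

Lemma nice_patternP l hyps T : holds l hyps -> nice_pattern hyps T ->
  presented g 6 (evalT l T) -> exists e : 6.-tuple g, nice_basis e.
Proof.
move=> hyp np [kap [e [ke _ sT _]]]; exists (basis6 e).
exact: nice_pattern_basis np ke sT.
Qed.

Lemma form_structure theta kap (c : R) k x y : (k < 6)%N ->
  form (structure_table c theta) kap (dlt R k) x y
  = c * \sum_(p <- nth [::] theta k) wedge (kap p.1.-1) (kap p.2.-1) x y.
Proof.
move=> k6; rewrite /form /structure_table big_flatten big_map.
rewrite (bigD1_seq k) ?iota_uniq ?mem_iota //= [X in _ + X]big1 ?addr0 => [|k' k'k].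
  by rewrite /= big_map big_distrr /=; apply: eq_bigr => p _; rewrite /dlt /= eqxx /=; ring.
by rewrite /= big_map big1 // => p _; rewrite /dlt /= eq_sym (negbTE k'k) /=; ring.
Qed.

Lemma presented_of_structure theta : bounded 6 (structure_table (-1 : R) theta) ->
  has_structure g theta -> presented g 6 (structure_table (-1) theta).
Proof.
move=> bT [b [bb Hb]]; exists (fun k => coord b (inord k)), (fun i => b`_i).
split=> // [|k x y k6|k x y /andP[k6]].
- exact: coframe_of_basis.
- rewrite form_structure // mulN1r; have := Hb (inord k) x y.
  by rewrite inordK // /CE_diff => <-; rewrite opprK.
by rewrite ltnNge k6.
Qed.

Lemma structure_of_presented theta :
  presented g 6 (structure_table (-1) theta) -> has_structure g theta.
Proof.
case=> kap [e [ke bT sT _]]; exists (basis6 e).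
split=> [|k x y]; first exact: coframe_basis ke.
rewrite /CE_diff (coframe_coord _ _ ke) sT // form_structure // mulN1r opprK.
apply: eq_big_seq => p pT.
have : (p.1.-1, p.2.-1, k : nat, -1) \in structure_table (-1 : R) theta.
  apply/flattenP; exists [seq (q.1.-1, q.2.-1, k : nat, -1 : R) | q <- nth [::] theta k].
    by apply/mapP; exists (k : nat); rewrite ?mem_iota ?ltn_ord.
  by apply/mapP; exists p.
move=> /(allP bT) /and3P[/= p1 p2 _].
by rewrite /wedge !(coframe_coord _ _ ke) !inordK.
Qed.

(** The basis is built from its end: each new vector is put in front, and its brackets with [g] lie
    in the span of the vectors already chosen. *)
Lemma presented0 : \dim {:g} = 6%N -> lie_nilpotent g -> presented g 0 [::].
Proof.
move=> dimg [N LN].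
have flag m : (m <= 6)%N -> exists s : seq g, [/\ size s = m, free s &
    forall x i, (i < m)%N -> lie_bracket s`_i x \in <<drop i.+1 s>>%VS].
  elim: m => [|m IH] m6; first by exists [::]; rewrite nil_free.
  have [s [sm fs Hs]] := IH (ltnW m6).
  (* Take the first term of the lower central series contained in the span. A vector of the
     preceding term outside the span can be added: its brackets fall into the span. *)
  have [k Lk kmin] : {k | (lower_central g k <= <<s>>)%VS &
      forall j, (lower_central g j <= <<s>>)%VS -> (k <= j)%N}.
    have ex : exists k, (lower_central g k <= <<s>>)%VS.
      by exists N; rewrite LN sub0v.
    by case: (ex_minnP ex) => k; exists k.
  case: k Lk kmin => [|k] Lk kmin.
    have := dimvS Lk; rewrite /= dimg => d6.
    have := leq_trans d6 (dim_span s); rewrite sm => /leq_trans/(_ m6).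
    by rewrite ltnn.
  have /subvPn[v vL vs] : ~~ (lower_central g k <= <<s>>)%VS.
    by apply/negP => /kmin; rewrite ltnn.
  exists (v :: s); rewrite /= sm free_cons vs fs; split=> // x [|i] im /=.
    rewrite drop0 bracketC memvN; apply: (subvP Lk).
    by apply: (lie_prodv_subP _ _ _ (subvv _)); rewrite ?memvf.
  exact: Hs.
have [s [s6 fs Hs]] := flag 6 (leqnn 6).
have sz : size s == 6%N by rewrite s6.
pose b : 6.-tuple g := Tuple sz.
have bb : basis_of fullv b.
  by rewrite basisEfree fs subvf /= s6 dimg.
have ke := coframe_of_basis bb.
exists (fun k => coord b (inord k)), (fun i => b`_i); split=> // k x y /= k6 x0.
rewrite {1}(coframeE ke x) bracket_suml (coframe_sum ke) big1 // => a _.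
rewrite bracketZl (coframeZ ke).
case: (ltnP a k) => ak; first by rewrite x0 ?mul0r.
have := Hs y a (ltn_ord a); set z := lie_bracket _ _ => zs.
suff -> : coord b (inord k) z = 0 by rewrite mulr0.
rewrite (coord_span (X := in_tuple (drop a.+1 s)) zs) linear_sum big1 // => j _.
rewrite linearZ /= nth_drop.
have j6 : (a.+1 + j < 6)%N.
  by have := ltn_ord j; rewrite [X in (_ < X)%N]size_drop s6 ltn_subRL.
rewrite -/(b`_(a.+1 + j)) (coframe_delta ke) // ltn_eqF ?mulr0 //.
by rewrite addSn ltnS (leq_trans ak) // leq_addr.
Qed.

End Bases.

(** * Tables with symbolic parameters *)

Fixpoint psubst (s : seq pexpr) (p : pexpr) : pexpr :=
  match p with
  | PEO => PEO
  | PEI => PEI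
  | PEc c => PEc c
  | PEX j => BinList.nth 0%P j s
  | PEadd p q => PEadd (psubst s p) (psubst s q)
  | PEsub p q => PEsub (psubst s p) (psubst s q)
  | PEmul p q => PEmul (psubst s p) (psubst s q)
  | PEopp p => PEopp (psubst s p)
  | PEpow p n => PEpow (psubst s p) n
  end.

Definition substT s (T : table pexpr) : table pexpr :=
  [seq (p.1, psubst s p.2) | p <- T].

(** One unknown per pair i < j, ordered by j and then by i: in the case tree a1, a2, a3, a4, ... are
    the coefficients of e^{01}, e^{02}, e^{12}, e^{03}, ... *)
Definition generic n : table pexpr :=
  [seq (p.1.1, p.1.2, n, PEX Z (Pos.of_succ_nat p.2))
    | p <- zip (pairs n) (iota 0 (size (pairs n)))].

(* The inverse of a parameter is numbered right after it: the substitution of a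
   two-variable monomial done by [norm_subst] is complete only for adjacent
   variables. *)
Definition odd_vars : seq pexpr :=
  [seq PEX Z (Pos.of_succ_nat k.*2) | k <- iota 0 10].

Section Normalization.

Variables (R : rcfType) (g : lieAlgebra R).
Implicit Types (l : list R).

Lemma nth_map_peval l s j :
  BinList.nth 0 j [seq peval l p | p <- s] = peval l (BinList.nth 0%P j s).
Proof.
have tlE (r : seq pexpr) : List.tl [seq peval l p | p <- r] = [seq peval l p | p <- List.tl r].
  by case: r.
have jumpE i (r : seq pexpr) : BinList.jump i [seq peval l p | p <- r]
    = [seq peval l p | p <- BinList.jump i r].
  by elim: i r => [i IH|i IH|] r /=; rewrite ?tlE ?IH.
elim: j s => [j IH|j IH|] s /=; rewrite ?tlE ?jumpE ?IH //; by case: s.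
Qed.

Lemma peval_psubst l s p :
  peval l (psubst s p) = peval [seq peval l q | q <- s] p.
Proof.
elim: p => //=.
- by move=> j; rewrite -nth_map_peval.
- by move=> p IHp q IHq; rewrite /peval /= -!/(peval _ _) IHp IHq.
- by move=> p IHp q IHq; rewrite /peval /= -!/(peval _ _) IHp IHq.
- by move=> p IHp q IHq; rewrite /peval /= -!/(peval _ _) IHp IHq.
- by move=> p IHp; rewrite /peval /= -!/(peval _ _) IHp.
- by move=> p IHp n; rewrite /peval /= -!/(peval _ _) IHp.
Qed.

Lemma evalT_subst l s T :
  evalT l (substT s T) = evalT [seq peval l q | q <- s] T.
Proof.
by rewrite /evalT /substT -map_comp; apply: eq_map => p /=; rewrite peval_psubst.
Qed.

(** Tables number their parameters consecutively; [r], in practice [odd_vars], renumbers them for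
    the moves, where the variable 2k-1 is the k-th parameter and the variable 2k its inverse. [s]
    gives the parameters of the table [T'] reached, in terms of these variables. *)
Lemma presented_moves n l0 l r hyps os s T T' :
    presented g n (evalT l0 T) -> evalT l (substT r T) = evalT l0 T ->
    holds l hyps ->
    [&& n <= 6, moves_ok n hyps os
      & same_table n hyps (apply_moves os (substT r T)) (substT s T')]%N ->
  presented g n (evalT [seq peval l p | p <- s] T').
Proof.
move=> pT eT hyp /and3P[n6 ok st]; rewrite -evalT_subst.
by apply: (same_tableP hyp n6 st); apply: (moves_sound hyp n6 ok); rewrite eT.
Qed.

Lemma nice_moves l0 l r hyps os T :
    presented g 6 (evalT l0 T) -> evalT l (substT r T) = evalT l0 T ->
    holds l hyps ->
    moves_ok 6 hyps os && nice_pattern hyps (apply_moves os (substT r T)) ->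
  exists e : 6.-tuple g, nice_basis e.
Proof.
move=> pT eT hyp /andP[ok np].
by apply: (nice_patternP hyp np); apply: (moves_sound hyp _ ok); rewrite ?eT.
Qed.

Lemma jacobi_relation n l0 l r hyps i j m k p q T :
    presented g n (evalT l0 T) -> evalT l (substT r T) = evalT l0 T -> holds l hyps ->
    [&& n <= 6, i < n, j < n, m < n, k < n
      & let J := jacobi n (substT r T) i j m k in
        pzero hyps (J - (p - q))%P || pzero hyps (J + (p - q))%P]%N ->
  peval l p = peval l q.
Proof.
move=> pT eT hyp /and5P[n6 iN jN mN /andP[kN]]; rewrite -eT in pT.
have J0 : peval l (jacobi n (substT r T) i j m k) = 0.
  by apply: (jacobiP n6 pT); rewrite iN jN mN kN.
case/orP=> /(pzeroP hyp) /eqP; rewrite /peval /= -!/(peval _ _) J0.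
  by rewrite sub0r oppr_eq0 subr_eq0 => /eqP.
by rewrite add0r subr_eq0 => /eqP.
Qed.

Lemma presented_generic n T : (n < 6)%N ->
    (forall l, evalT l T = evalT [::] T) ->
    presented g n (evalT [::] T) ->
  exists w : nat -> nat -> R,
    presented g n.+1 (evalT [seq w p.1 p.2 | p <- pairs n] (T ++ generic n)).
Proof.
move=> n6 cT /(presented_next n6)[w pw]; exists w.
rewrite /evalT map_cat -!/(evalT _ _) cT.
by do 6?[case: n n6 pw => [|n] n6 pw //].
Qed.

End Normalization.

(** * Tactics for the tree of changes of basis *)

Ltac with_inverses l :=
  lazymatch l with
  | ?a :: ?r => let r' := with_inverses r in constr:(a :: a^-1 :: r')
  | _ => l
  end.

Ltac variable l t p :=
  lazymatch l with
  | t :: _ => constr:(PEX Z p)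
  | _ :: ?r => let q := eval compute in (Pos.succ p) in variable r t q
  end.

Ltac reify l t :=
  lazymatch t with
  | 0 => constr:(0%P)
  | - ?u => let p := reify l u in constr:((- p)%P)
  | ?u * ?v => let p := reify l u in let q := reify l v in constr:((p * q)%P)
  | ?u + ?v => let p := reify l u in let q := reify l v in constr:((p + q)%P)
  | _ => variable l t 1%positive
  end.

(* The facts [a = t] and [a != 0] of the context on the parameters [l0]. *)
Ltac facts l l0 :=
  lazymatch l0 with
  | ?a :: ?r =>
      let hs := facts l r in
      match goal with
      | _ : a = ?t |- _ =>
          let p := reify l a in let q := reify l t in constr:((p, q) :: hs)
      | _ : is_true (a != 0) |- _ =>
          let p := reify l a in let q := reify l (a^-1) in constr:(((p * q)%P, 1%P) :: hs)
      | _ => hs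
      end
  | _ => constr:([::] : list (pexpr * pexpr))
  end.

Ltac parameters H :=
  lazymatch type of H with presented _ _ (evalT ?l _) => l end.

Ltac holds_tac :=
  rewrite /=; repeat split; try assumption; try (apply: mulfV; assumption);
  try (rewrite /peval /=; lra).

(** End of a branch: after the moves [os] the table has a nice pattern. *)
Ltac leaf_in H l hyps os :=
  try left;
  apply: (nice_moves (l := l) (r := odd_vars) (hyps := hyps) (os := os) H);
  [reflexivity | holds_tac | vm_compute; reflexivity].

Tactic Notation "leaf" ident(H) uconstr(moves) :=
  let os := constr:(moves : seq move) in
  let l0 := parameters H in let l := with_inverses l0 in let hyps := facts l l0 in
  leaf_in H l hyps os.

Tactic Notation "leaf_with" ident(H) ident(h) uconstr(moves) :=
  let os := constr:(moves : seq move) in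
  let l0 := parameters H in let l1 := with_inverses l0 in
  let l := eval cbv [cat] in (l1 ++ [:: h]) in let hyps := facts l l0 in
  leaf_in H l hyps os.

Ltac nonzero_tac :=
  rewrite /peval /= ?oppr_eq0; first
    [ assumption
    | match goal with h : is_true (?a != 0) |- _ =>
        by apply: contra_neq h => ?; lra end ].

(** The moves [os] lead to the table of the lemma [lem], whose parameters take the values [s]; its
    conditions that some parameter is nonzero are left to [nonzero_tac]. *)
Ltac goto_in lem H l hyps os s :=
  eapply lem;
  [ eapply (presented_moves (l := l) (r := odd_vars) (hyps := hyps) (os := os) (s := s) H);
    [reflexivity | holds_tac | vm_compute; reflexivity]
  | nonzero_tac .. ].

Tactic Notation "goto" constr(lem) ident(H) uconstr(moves) uconstr(values) :=
  let os := constr:(moves : seq move) in let s := constr:(values : seq pexpr) in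
  let l0 := parameters H in let l := with_inverses l0 in let hyps := facts l l0 in
  goto_in lem H l hyps os s.

Tactic Notation "goto_with" constr(lem) ident(H) ident(h) uconstr(moves) uconstr(values) :=
  let os := constr:(moves : seq move) in let s := constr:(values : seq pexpr) in
  let l0 := parameters H in let l1 := with_inverses l0 in
  let l := eval cbv [cat] in (l1 ++ [:: h]) in let hyps := facts l l0 in
  goto_in lem H l hyps os s.

(** Here [idx] is (i, j, m, k): up to sign and the known relations, the goal is the e_k coordinate
    of the Jacobi identity for e_i, e_j, e_m. *)
Ltac relation H idx :=
  let l0 := parameters H in let l := with_inverses l0 in let hyps := facts l l0 in
  lazymatch goal with |- ?a = ?b =>
    let p := reify l a in let q := reify l b in
    exact: (jacobi_relation (l := l) (r := odd_vars) (hyps := hyps) (p := p) (q := q)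
      (i := idx.1.1.1) (j := idx.1.1.2) (m := idx.1.2) (k := idx.2) H erefl
      ltac:(holds_tac) ltac:(vm_compute; reflexivity))
  end.

Notation entry i j k p := (i%N, j%N, k%N, p%P).

(** * Existence of nice bases *)

Section Existence.

Variables (R : rcfType) (g : lieAlgebra R).

Definition classified : Prop :=
  (exists e : 6.-tuple g, nice_basis e) \/ has_structure g N_6_1_4.

Lemma classified_614 :
  presented g 6 (evalT [::] (structure_table (- (1))%P N_6_1_4)) -> classified.
Proof. by right; apply: structure_of_presented. Qed.

(** * Central extensions of the five-dimensional algebras *)

Lemma form5_line (a1 a2 a3 : R) :
  presented g 6 (evalT [:: a1; a2; a3] [:: entry 0 1 5 1; entry 2 3 5 'v1; entry 2 4 5 'v2;
    entry 3 4 5 'v3]) -> classified.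
Proof.
move=> H.
case: (eqVneq a1 0) => [z1|n1]; last by leaf H [:: Shear 4 3 (- ('v2 * 'v3));
  Shear 4 2 ('v2 * 'v5)].
case: (eqVneq a2 0) => [z2|n2]; last by leaf H [:: Swap 3 4; Shear 4 2 (- ('v4 * 'v5))].
leaf H [::].
Qed.

(** Symplectic elimination: with e^{01} as pivot, shears remove every other term in e^0 or e^1. The
    remaining coefficients, on e_2, e_3, e_4, are the 4 by 4 Pfaffians divided by the pivot. *)
Lemma form5_pivot (a1 a2 a3 a4 a5 a6 a7 a8 a9 a10 : R) :
  presented g 6 (evalT [:: a1; a2; a3; a4; a5; a6; a7; a8; a9; a10] (generic 5)) -> a1 != 0 ->
    classified.
Proof.
move=> H n1.
goto form5_line H [:: Scale 0 'v2 'v1; Shear 2 1 (- ('v2 * 'v3)); Shear 2 0 'v5;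
  Shear 3 1 (- ('v2 * 'v7)); Shear 3 0 'v9; Shear 4 1 (- ('v2 * 'v13)); Shear 4 0 'v15]
  [:: - ('v2 * 'v3 * 'v9) + 'v2 * 'v5 * 'v7 + 'v11;
  - ('v2 * 'v3 * 'v15) + 'v2 * 'v5 * 'v13 + 'v17;
  - ('v2 * 'v7 * 'v15) + 'v2 * 'v9 * 'v13 + 'v19]%P.
Qed.

Lemma form5 (a1 a2 a3 a4 a5 a6 a7 a8 a9 a10 : R) :
  presented g 6 (evalT [:: a1; a2; a3; a4; a5; a6; a7; a8; a9; a10] (generic 5)) -> classified.
Proof.
move=> H.
case: (eqVneq a1 0) => [z1|n1]; last by goto form5_pivot H [::] [:: 'v1; 'v3; 'v5; 'v7; 'v9;
  'v11; 'v13; 'v15; 'v17; 'v19]%P.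
case: (eqVneq a2 0) => [z2|n2]; last by goto form5_pivot H [:: Swap 1 2] [:: 'v3; 0; - 'v5; 'v7;
  'v11; 'v9; 'v13; 'v17; 'v15; 'v19]%P.
case: (eqVneq a3 0) => [z3|n3]; last by goto form5_pivot H [:: Swap 0 1; Swap 1 2] [:: 'v5; 0;
  0; 'v9; 'v11; 'v7; 'v15; 'v17; 'v13; 'v19]%P.
case: (eqVneq a4 0) => [z4|n4]; last by goto form5_pivot H [:: Swap 1 3] [:: 'v7; 0; - 'v11; 0;
  - 'v9; 0; 'v13; 'v19; 'v17; 'v15]%P.
case: (eqVneq a5 0) => [z5|n5]; last by goto form5_pivot H [:: Swap 0 1; Swap 1 3] [:: 'v9; 0;
  - 'v11; 0; 0; 0; 'v15; 'v19; 'v17; 'v13]%P.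
case: (eqVneq a6 0) => [z6|n6]; last by goto form5_pivot H [:: Swap 0 2; Swap 1 3] [:: 'v11; 0;
  0; 0; 0; 0; 'v17; 'v19; 'v13; 'v15]%P.
case: (eqVneq a7 0) => [z7|n7]; last by goto form5_pivot H [:: Swap 1 4] [:: 'v13; 0; - 'v17; 0;
  - 'v19; 0; 0; - 'v15; 0; 0]%P.
case: (eqVneq a8 0) => [z8|n8]; last by goto form5_pivot H [:: Swap 0 1; Swap 1 4] [:: 'v15; 0;
  - 'v17; 0; - 'v19; 0; 0; 0; 0; 0]%P.
case: (eqVneq a9 0) => [z9|n9]; last by goto form5_pivot H [:: Swap 0 2; Swap 1 4] [:: 'v17; 0;
  0; 0; - 'v19; 0; 0; 0; 0; 0]%P.
case: (eqVneq a10 0) => [z10|n10]; last by goto form5_pivot H [:: Swap 0 3; Swap 1 4] [:: 'v19;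
  0; 0; 0; 0; 0; 0; 0; 0; 0]%P.
leaf H [::].
Qed.

Lemma heis5_line (a1 a2 a3 : R) :
  presented g 6 (evalT [:: a1; a2; a3] [:: entry 0 1 4 1; entry 0 4 5 1; entry 1 2 5 'v1;
    entry 1 3 5 'v2; entry 2 3 5 'v3]) -> classified.
Proof.
move=> H.
case: (eqVneq a3 0) => [z3|n3]; last by leaf H [:: Shear 1 3 ('v1 * 'v6);
  Shear 1 2 (- ('v3 * 'v6))].
case: (eqVneq a1 0) => [z1|n1]; last by leaf H [:: Shear 3 2 (- ('v2 * 'v3))].
leaf H [::].
Qed.

Lemma heis5_pivot (a1 a2 a3 a4 a5 a6 a7 a8 : R) :
  presented g 6 (evalT [:: a1; a2; a3; a4; a5; a6; a7; a8] [:: entry 0 1 4 1; entry 0 1 5 'v1;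
    entry 0 2 5 'v2; entry 1 2 5 'v3; entry 0 3 5 'v4; entry 1 3 5 'v5; entry 2 3 5 'v6;
    entry 0 4 5 'v7; entry 1 4 5 'v8]) -> a7 != 0 -> classified.
Proof.
move=> H n7.
goto heis5_line H [:: Scale 5 'v13 'v14; Shear 4 5 ('v1 * 'v14); Shear 1 0 (- ('v14 * 'v15));
  Shear 2 4 (- ('v3 * 'v14)); Shear 3 4 (- ('v7 * 'v14))]
  [:: - ('v3 * 'v14 * 'v14 * 'v15) + 'v5 * 'v14; - ('v7 * 'v14 * 'v14 * 'v15) + 'v9 * 'v14;
  'v11 * 'v14]%P.
Qed.

(** Jacobi kills the terms e^{24} and e^{34}, and the coboundary of e^4 absorbs e^{01}. The main
    division is whether e_4 stays central (a7 = a8 = 0) or the nilpotency class grows. *)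
Lemma heis5 (a1 a2 a3 a4 a5 a6 a7 a8 a9 a10 : R) :
  presented g 6 (evalT [:: a1; a2; a3; a4; a5; a6; a7; a8; a9;
    a10] ([:: entry 0 1 4 1] ++ generic 5)) -> classified.
Proof.
move=> H.
have j0 : a9 = 0 by relation H (0, 1, 2, 5)%N.
have j1 : a10 = 0 by relation H (0, 1, 3, 5)%N.
case: (eqVneq a7 0) => [z7|n7]; last by goto heis5_pivot H [::] [:: 'v1; 'v3; 'v5; 'v7; 'v9;
  'v11; 'v13; 'v15]%P.
case: (eqVneq a8 0) => [z8|n8]; last by goto heis5_pivot H [:: Swap 0 1;
  Scale 4 (- (1)) (- (1))] [:: - 'v1; 'v5; 'v3; 'v9; 'v7; 'v11; - 'v15; 0]%P.
case: (eqVneq a6 0) => [z6|n6]; last by leaf H [:: Shear 0 2 (- ('v7 * 'v12));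
  Shear 0 3 ('v3 * 'v12); Shear 1 2 (- ('v9 * 'v12)); Shear 1 3 ('v5 * 'v12);
  Shear 4 5 ('v1 - 'v3 * 'v9 * 'v12 + 'v5 * 'v7 * 'v12)].
case: (eqVneq a2 0) => [z2|n2]; last by leaf H [:: Shear 4 5 'v1; Shear 3 2 (- ('v4 * 'v7));
  Shear 1 0 (- ('v4 * 'v5))].
case: (eqVneq a4 0) => [z4|n4]; last by leaf H [:: Shear 4 5 'v1; Swap 2 3;
  Shear 1 0 (- ('v8 * 'v9))].
case: (eqVneq a3 0) => [z3|n3]; last by leaf H [:: Shear 4 5 'v1; Shear 3 2 (- ('v6 * 'v9))].
leaf H [:: Shear 4 5 'v1].
Qed.

Lemma symp5_split (a1 : R) :
  presented g 6 (evalT [:: a1] [:: entry 0 1 4 1; entry 2 3 4 1; entry 0 1 5 'v1]) ->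
    classified.
Proof.
move=> H.
case: (eqVneq a1 0) => [z1|n1]; last by leaf H [:: Scale 5 'v1 'v2; Shear 5 4 1].
leaf H [::].
Qed.

Lemma symp5_pivot (a1 a2 a3 a4 a5 : R) :
  presented g 6 (evalT [:: a1; a2; a3; a4; a5] [:: entry 0 1 4 1; entry 2 3 4 1;
    entry 0 1 5 'v1; entry 2 3 5 (- 'v1); entry 0 2 5 'v2; entry 1 2 5 'v3; entry 0 3 5 'v4;
    entry 1 3 5 'v5]) -> a4 != 0 -> classified.
Proof.
move=> H n4.
leaf H [:: Shear 2 3 (- ('v3 * 'v8)); Shear 1 3 (- ('v1 * 'v8)); Shear 2 0 ('v1 * 'v8);
  Shear 1 0 (- ('v8 * 'v9))].
Qed.

Lemma symp5_traceless (a1 a2 a3 a4 a5 : R) :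
  presented g 6 (evalT [:: a1; a2; a3; a4; a5] [:: entry 0 1 4 1; entry 2 3 4 1;
    entry 0 1 5 'v1; entry 2 3 5 (- 'v1); entry 0 2 5 'v2; entry 1 2 5 'v3; entry 0 3 5 'v4;
    entry 1 3 5 'v5]) -> classified.
Proof.
move=> H.
case: (eqVneq a4 0) => [z4|n4]; last by goto symp5_pivot H [::] [:: 'v1; 'v3; 'v5; 'v7; 'v9]%P.
case: (eqVneq a2 0) => [z2|n2]; last by goto symp5_pivot H [:: Swap 2 3;
  Scale 3 (- (1)) (- (1))] [:: 'v1; 0; 'v9; - 'v3; - 'v5]%P.
case: (eqVneq a5 0) => [z5|n5]; last by goto symp5_pivot H [:: Swap 0 1;
  Scale 1 (- (1)) (- (1))] [:: 'v1; 'v5; 0; 'v9; 0]%P.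
case: (eqVneq a3 0) => [z3|n3]; last by goto symp5_pivot H [:: Swap 0 1;
  Scale 1 (- (1)) (- (1)); Swap 2 3; Scale 3 (- (1)) (- (1))] [:: 'v1; 0; 0; - 'v5; 0]%P.
goto symp5_split H [:: Shear 4 5 (- 'v1)] [:: (1 + 1) * 'v1]%P.
Qed.

(** Jacobi forces e_4 to stay central, so the cocycle is a form on the span of e_0, ..., e_3, taken
    modulo the symplectic form e^{01} + e^{23}. It is represented by a form with opposite
    coefficients on e^{01} and e^{23}. *)
Lemma symp5 (a1 a2 a3 a4 a5 a6 a7 a8 a9 a10 : R) :
  presented g 6 (evalT [:: a1; a2; a3; a4; a5; a6; a7; a8; a9; a10] ([:: entry 0 1 4 1;
    entry 2 3 4 1] ++ generic 5)) -> classified.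
Proof.
move=> H.
have j0 : a9 = 0 by relation H (0, 1, 2, 5)%N.
have j1 : a10 = 0 by relation H (0, 1, 3, 5)%N.
have j2 : a7 = 0 by relation H (0, 2, 3, 5)%N.
have j3 : a8 = 0 by relation H (1, 2, 3, 5)%N.
(* The normalizer has integer coefficients, so a half enters as an additional variable, numbered
   after all parameters and inverses. *)
have [h hE] : exists h, a1 = a6 + h + h by exists ((a1 - a6) / 2%:R); lra.
goto_with symp5_traceless H h [:: Shear 4 5 ('v11 + 'v21)] [:: 'v21; 'v3; 'v5; 'v7; 'v9]%P.
Qed.

Lemma two_heis_pivot2 (a1 a2 a3 a4 a5 : R) :
  presented g 6 (evalT [:: a1; a2; a3; a4; a5] [:: entry 0 1 3 1; entry 0 2 4 1;
    entry 1 2 5 'v1; entry 0 3 5 'v2; entry 0 4 5 'v3; entry 1 3 5 'v4; entry 2 4 5 'v5]) -> a4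
    != 0 -> classified.
Proof.
move=> H n4.
case: (eqVneq a5 0) => [z5|n5]; last by leaf H [:: Shear 0 1 (- ('v3 * 'v8));
  Shear 4 5 (- ('v1 * 'v3 * 'v8)); Shear 2 3 (- ('v1 * 'v8)); Shear 0 2 (- ('v5 * 'v10))].
leaf H [:: Shear 0 1 (- ('v3 * 'v8)); Shear 4 5 (- ('v1 * 'v3 * 'v8));
  Shear 2 3 (- ('v1 * 'v8))].
Qed.

Lemma two_heis_pivot (a1 a2 a3 a4 a5 a6 : R) :
  presented g 6 (evalT [:: a1; a2; a3; a4; a5; a6] [:: entry 0 1 3 1; entry 0 2 4 1;
    entry 1 2 5 'v1; entry 0 3 5 'v2; entry 0 4 5 'v3; entry 1 3 5 'v4; entry 1 4 5 'v5;
    entry 2 3 5 'v5; entry 2 4 5 'v6]) -> a4 != 0 -> classified.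
Proof.
move=> H n4.
goto two_heis_pivot2 H [:: Shear 2 1 (- ('v8 * 'v9)); Shear 4 3 (- ('v8 * 'v9))] [:: 'v1; 'v3;
  - ('v3 * 'v8 * 'v9) + 'v5; 'v7; - ('v8 * 'v9 * 'v9) + 'v11]%P.
Qed.

(** By Jacobi, e^5([x, [e_0, y]]) is symmetric in x and y on the span of e_1, e_2; its matrix has
    entries a4, a5, a6. It is diagonalized when a diagonal entry is nonzero; otherwise the basis is
    isotropic and already suitable. *)
Lemma two_heis_sym (a1 a2 a3 a4 a5 a6 : R) :
  presented g 6 (evalT [:: a1; a2; a3; a4; a5; a6] [:: entry 0 1 3 1; entry 0 2 4 1;
    entry 1 2 5 'v1; entry 0 3 5 'v2; entry 0 4 5 'v3; entry 1 3 5 'v4; entry 1 4 5 'v5;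
    entry 2 3 5 'v5; entry 2 4 5 'v6]) -> classified.
Proof.
move=> H.
case: (eqVneq a4 0) => [z4|n4]; last by goto two_heis_pivot H [::] [:: 'v1; 'v3; 'v5; 'v7; 'v9;
  'v11]%P.
case: (eqVneq a6 0) => [z6|n6]; last by goto two_heis_pivot H [:: Swap 1 2; Swap 3 4] [:: - 'v1;
  'v5; 'v3; 'v11; 'v9; 0]%P.
case: (eqVneq a5 0) => [z5|n5]; last by leaf H [:: Shear 0 2 (- ('v3 * 'v10));
  Shear 0 1 (- ('v5 * 'v10)); Shear 3 5 ('v1 * 'v3 * 'v10); Shear 4 5 (- ('v1 * 'v5 * 'v10));
  Shear 1 3 ('v1 * 'v10)].
case: (eqVneq a2 0) => [z2|n2]; last by leaf H [:: Shear 2 1 (- ('v4 * 'v5));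
  Shear 4 3 (- ('v4 * 'v5))].
leaf H [::].
Qed.

Lemma two_heis (a1 a2 a3 a4 a5 a6 a7 a8 a9 a10 : R) :
  presented g 6 (evalT [:: a1; a2; a3; a4; a5; a6; a7; a8; a9; a10] ([:: entry 0 1 3 1;
    entry 0 2 4 1] ++ generic 5)) -> classified.
Proof.
move=> H.
have j0 : a10 = 0 by relation H (0, 1, 4, 5)%N.
have j1 : a6 = a8 by relation H (0, 1, 2, 5)%N.
goto two_heis_sym H [:: Shear 3 5 'v1; Shear 4 5 'v3] [:: 'v5; 'v7; 'v13; 'v9; 'v15; 'v17]%P.
Qed.

Lemma gl2_pivot (a1 a2 a3 : R) :
  presented g 6 (evalT [:: a1; a2; a3] [:: entry 0 1 3 1; entry 0 3 4 1; entry 1 3 5 1;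
    entry 0 2 4 'v1; entry 0 2 5 'v2; entry 1 2 4 'v3; entry 1 2 5 (- 'v1)]) -> a2 != 0 ->
    classified.
Proof.
move=> H n2.
leaf H [:: Scale 1 'v3 'v4; Shear 1 0 'v1; Scale 3 'v3 'v4; Scale 4 'v3 'v4;
  Scale 5 ('v3 * 'v3) ('v4 * 'v4); Shear 5 4 'v1].
Qed.

Lemma gl2_traceless (a1 a2 a3 : R) :
  presented g 6 (evalT [:: a1; a2; a3] [:: entry 0 1 3 1; entry 0 3 4 1; entry 1 3 5 1;
    entry 0 2 4 'v1; entry 0 2 5 'v2; entry 1 2 4 'v3; entry 1 2 5 (- 'v1)]) -> classified.
Proof.
move=> H.
case: (eqVneq a2 0) => [z2|n2]; last by goto gl2_pivot H [::] [:: 'v1; 'v3; 'v5]%P.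
case: (eqVneq a3 0) => [z3|n3]; last by goto gl2_pivot H [:: Swap 0 1; Scale 3 (- (1)) (- (1));
  Swap 4 5; Scale 4 (- (1)) (- (1)); Scale 5 (- (1)) (- (1))] [:: 'v1; - 'v5; 0]%P.
(* A nonzero diagonal traceless matrix acquires an off-diagonal pivot under conjugation by a
   shear. *)
case: (eqVneq a1 0) => [z1|n1]; last by goto gl2_pivot H [:: Shear 0 1 1; Shear 4 5 1] [:: 'v1;
  - ((1 + 1) * 'v1); 0]%P.
leaf H [::].
Qed.

(** Bracketing with e_3 identifies the span of e_0, e_1 with that of e_4, e_5, so bracketing with
    e_2 becomes a 2 by 2 matrix up to conjugation. Adding a multiple of e_3 to e_2 makes it
    traceless, and a nonzero traceless matrix is conjugate to an antidiagonal one. *)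
Lemma gl2 (a1 a2 a3 a4 : R) :
  presented g 6 (evalT [:: a1; a2; a3; a4] [:: entry 0 1 3 1; entry 0 3 4 1; entry 1 3 5 1;
    entry 0 2 4 'v1; entry 0 2 5 'v2; entry 1 2 4 'v3; entry 1 2 5 'v4]) -> classified.
Proof.
move=> H.
have [h hE] : exists h, a1 = a4 + h + h by exists ((a1 - a4) / 2%:R); lra.
goto_with gl2_traceless H h [:: Shear 2 3 (- 'v7 - 'v9)] [:: 'v9; 'v3; 'v5]%P.
Qed.

Lemma filiform4_plus_kernel (a1 a2 a3 a4 : R) :
  presented g 6 (evalT [:: a1; a2; a3; a4] [:: entry 0 1 3 1; entry 0 3 4 1; entry 0 2 5 'v1;
    entry 1 2 5 'v2; entry 1 3 5 'v3; entry 0 4 5 'v4]) -> classified.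
Proof.
move=> H.
case: (eqVneq a4 0) => [z4|n4].
  case: (eqVneq a3 0) => [z3|n3]; last by goto gl2 H [:: Scale 5 'v5 'v6] [:: 0; 'v1 * 'v6; 0;
    'v3 * 'v6]%P.
  case: (eqVneq a2 0) => [z2|n2]; last by leaf H [:: Shear 0 1 (- ('v1 * 'v4))].
  leaf H [::].
case: (eqVneq a2 0) => [z2|n2]; first by leaf H [:: Shear 2 4 (- ('v1 * 'v8))].
(* With e^{04}, e^{12} and e^{13} all present, the brackets [e_1, e_2] and [e_1, e_3] share the head
   e_5. This is the only branch without a nice basis; the scalings, a global change of sign and a
   relabelling give [N_6_1_4]. *)
case: (eqVneq a3 0) => [z3|n3]; last by goto classified_614 H [:: Shear 2 4 (- ('v1 * 'v8));
  Scale 1 ('v6 * 'v7) ('v5 * 'v8); Scale 2 ('v4 * 'v7) ('v3 * 'v8);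
  Scale 3 ('v6 * 'v7) ('v5 * 'v8); Scale 4 ('v6 * 'v7) ('v5 * 'v8);
  Scale 5 ('v6 * 'v7 * 'v7) ('v5 * 'v8 * 'v8); Scale 0 (- (1)) (- (1)); Scale 1 (- (1)) (- (1));
  Scale 2 (- (1)) (- (1)); Scale 3 (- (1)) (- (1)); Scale 4 (- (1)) (- (1));
  Scale 5 (- (1)) (- (1)); Swap 2 3; Swap 3 4] [::].
leaf H [:: Shear 2 4 (- ('v1 * 'v8))].
Qed.

Lemma filiform4_plus (a1 a2 a3 a4 a5 a6 a7 a8 a9 a10 : R) :
  presented g 6 (evalT [:: a1; a2; a3; a4; a5; a6; a7; a8; a9; a10] ([:: entry 0 1 3 1;
    entry 0 3 4 1] ++ generic 5)) -> classified.
Proof.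
move=> H.
have j0 : a6 = 0 by relation H (0, 1, 2, 5)%N.
have j1 : a8 = 0 by relation H (0, 1, 3, 5)%N.
have j2 : a9 = 0 by relation H (0, 2, 3, 5)%N.
have j3 : a10 = 0 by relation H (0, 1, 4, 5)%N.
goto filiform4_plus_kernel H [:: Shear 3 5 'v1; Shear 4 5 'v7] [:: 'v3; 'v5; 'v9; 'v13]%P.
Qed.

Lemma depth3_last (a1 a2 : R) :
  presented g 6 (evalT [:: a1; a2] [:: entry 0 1 3 1; entry 0 3 4 1; entry 1 2 4 1;
    entry 0 4 5 'v2; entry 2 3 5 (- 'v2); entry 1 2 5 'v1]) -> a2 != 0 -> classified.
Proof.
move=> H n2.
have [h hE] : exists h, a1 = h + h by exists (a1 / 2%:R); lra.
leaf_with H h [:: Shear 0 2 (- ('v4 * 'v5)); Shear 3 4 ('v4 * 'v5);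
  Shear 3 5 ((1 + 1) * 'v4 * 'v5 * 'v5); Shear 4 5 ((1 + 1) * 'v5)].
Qed.

Lemma depth3_kernel (a1 a2 a3 a4 : R) :
  presented g 6 (evalT [:: a1; a2; a3; a4] [:: entry 0 1 3 1; entry 0 3 4 1; entry 1 2 4 1;
    entry 0 4 5 'v4; entry 2 3 5 (- 'v4); entry 0 2 5 'v1; entry 1 2 5 'v2; entry 1 3 5 'v3]) ->
    classified.
Proof.
move=> H.
case: (eqVneq a4 0) => [z4|n4]; last by goto depth3_last H [:: Shear 2 4 (- ('v1 * 'v8));
  Shear 1 2 ('v5 * 'v8)] [:: 'v3; 'v7]%P.
case: (eqVneq a3 0) => [z3|n3]; last by goto gl2 H [:: Scale 5 'v5 'v6] [:: 0; 'v1 * 'v6; 1;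
  'v3 * 'v6]%P.
case: (eqVneq a1 0) => [z1|n1].
  case: (eqVneq a2 0) => [z2|n2]; last by leaf H [:: Scale 5 'v3 'v4; Shear 5 4 1].
  leaf H [::].
case: (eqVneq a2 0) => [z2|n2]; last by leaf H [:: Scale 5 'v1 'v2; Shear 2 3 ('v1 * 'v4);
  Shear 5 4 ('v1 * 'v4); Shear 0 1 (- ('v1 * 'v4))].
leaf H [::].
Qed.

Lemma depth3 (a1 a2 a3 a4 a5 a6 a7 a8 a9 a10 : R) :
  presented g 6 (evalT [:: a1; a2; a3; a4; a5; a6; a7; a8; a9; a10] ([:: entry 0 1 3 1;
    entry 0 3 4 1; entry 1 2 4 1] ++ generic 5)) -> classified.
Proof.
move=> H.
have j0 : a8 = 0 by relation H (0, 1, 3, 5)%N.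
have j1 : a9 = 0 by relation H (0, 2, 3, 5)%N.
have j2 : a10 = 0 by relation H (1, 2, 3, 5)%N.
have j3 : a6 = - a7 by relation H (0, 1, 2, 5)%N.
goto depth3_kernel H [:: Shear 3 5 'v1; Shear 4 5 'v7] [:: 'v3; 'v5 - 'v7; 'v9; 'v13]%P.
Qed.

Lemma filiform5_kernel (a1 a2 a3 : R) :
  presented g 6 (evalT [:: a1; a2; a3] [:: entry 0 1 2 1; entry 0 2 3 1; entry 0 3 4 1;
    entry 1 2 5 'v1; entry 0 4 5 'v2; entry 1 4 5 'v3; entry 2 3 5 (- 'v3)]) -> classified.
Proof.
move=> H.
case: (eqVneq a3 0) => [z3|n3]; first by leaf H [::].
(* The term e^{12} is removed by shearing inside both e^{14} and e^{23}, each of which absorbs half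
   of its coefficient. *)
have [h hE] : exists h, a1 = h + h by exists (a1 / 2%:R); lra.
leaf_with H h [:: Shear 0 1 (- ('v3 * 'v6)); Shear 3 5 (- ((1 + 1) * 'v3 * 'v6 * 'v7));
  Shear 1 3 (- ('v6 * 'v7)); Shear 2 4 (- ('v6 * 'v7))].
Qed.

Lemma filiform5 (a1 a2 a3 a4 a5 a6 a7 a8 a9 a10 : R) :
  presented g 6 (evalT [:: a1; a2; a3; a4; a5; a6; a7; a8; a9; a10] ([:: entry 0 1 2 1;
    entry 0 2 3 1; entry 0 3 4 1] ++ generic 5)) -> classified.
Proof.
move=> H.
have j0 : a5 = 0 by relation H (0, 1, 2, 5)%N.
have j1 : a6 = - a8 by relation H (0, 1, 3, 5)%N.
have j2 : a9 = 0 by relation H (0, 2, 3, 5)%N.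
have j3 : a10 = 0 by relation H (0, 2, 4, 5)%N.
goto filiform5_kernel H [:: Shear 2 5 'v1; Shear 3 5 'v3; Shear 4 5 'v7] [:: 'v5; 'v13; 'v15]%P.
Qed.

Lemma twisted_filiform5_last (a1 a2 : R) :
  presented g 6 (evalT [:: a1; a2] [:: entry 0 1 2 1; entry 0 2 3 1; entry 0 3 4 1;
    entry 1 2 4 1; entry 1 2 5 'v1; entry 1 4 5 'v2; entry 2 3 5 (- 'v2)]) -> a2 != 0 ->
    classified.
Proof.
move=> H n2.
have [h hE] : exists h, a1 = h + h by exists (a1 / 2%:R); lra.
leaf_with H h [:: Shear 1 3 (- ('v4 * 'v5)); Shear 2 4 (- ('v4 * 'v5))].
Qed.

Lemma twisted_filiform5_kernel (a1 a2 a3 : R) :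
  presented g 6 (evalT [:: a1; a2; a3] [:: entry 0 1 2 1; entry 0 2 3 1; entry 0 3 4 1;
    entry 1 2 4 1; entry 1 2 5 'v1; entry 0 4 5 'v2; entry 1 3 5 'v2; entry 1 4 5 'v3;
    entry 2 3 5 (- 'v3)]) -> classified.
Proof.
move=> H.
case: (eqVneq a3 0) => [z3|n3]; last by goto twisted_filiform5_last H
  [:: Shear 0 1 (- ('v3 * 'v6)); Shear 3 4 (- ('v3 * 'v6)); Shear 3 5 (- ('v1 * 'v3 * 'v6));
  Shear 4 5 (- ('v3 * 'v3 * 'v6))] [:: 'v1 + 'v3 * 'v3 * 'v6; 'v5]%P.
case: (eqVneq a2 0) => [z2|n2].
  case: (eqVneq a1 0) => [z1|n1]; last by leaf H [:: Scale 5 'v1 'v2; Shear 5 4 1].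
  leaf H [::].
have [h hE] : exists h, a1 = h + h by exists (a1 / 2%:R); lra.
leaf_with H h [:: Shear 0 1 ('v4 * 'v7); Shear 3 4 ('v4 * 'v7);
  Shear 3 5 ((1 + 1) * 'v4 * 'v7 * 'v7); Shear 4 5 ((1 + 1) * 'v7)].
Qed.

Lemma twisted_filiform5 (a1 a2 a3 a4 a5 a6 a7 a8 a9 a10 : R) :
  presented g 6 (evalT [:: a1; a2; a3; a4; a5; a6; a7; a8; a9; a10] ([:: entry 0 1 2 1;
    entry 0 2 3 1; entry 0 3 4 1; entry 1 2 4 1] ++ generic 5)) -> classified.
Proof.
move=> H.
have j0 : a6 = - a8 by relation H (0, 1, 3, 5)%N.
have j1 : a9 = 0 by relation H (0, 2, 3, 5)%N.
have j2 : a10 = 0 by relation H (1, 2, 3, 5)%N.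
have j3 : a5 = a7 by relation H (0, 1, 2, 5)%N.
goto twisted_filiform5_kernel H [:: Shear 2 5 'v1; Shear 3 5 'v3; Shear 4 5 'v7] [:: 'v5 - 'v7;
  'v13; 'v15]%P.
Qed.

(** Over the free nilpotent algebra of class 3 on e_0, e_1, the cocycle is the symmetric form
    e^5([x, [y, e_2]]) on the span of e_0, e_1. It is diagonalized unless both diagonal entries
    vanish; the two shapes, isotropic and diagonal, are the source of the pair of tables 28 and
    30. *)
Lemma free3_kernel (a1 a2 a3 : R) :
  presented g 6 (evalT [:: a1; a2; a3] [:: entry 0 1 2 1; entry 0 2 3 1; entry 1 2 4 1;
    entry 0 3 5 'v1; entry 0 4 5 'v2; entry 1 3 5 'v2; entry 1 4 5 'v3]) -> classified.
Proof.
move=> H.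
case: (eqVneq a1 0) => [z1|n1]; last by leaf H [:: Shear 1 0 (- ('v2 * 'v3));
  Shear 4 3 (- ('v2 * 'v3))].
case: (eqVneq a3 0) => [z3|n3]; last by leaf H [:: Shear 0 1 (- ('v3 * 'v6));
  Shear 3 4 (- ('v3 * 'v6))].
leaf H [::].
Qed.

Lemma free3 (a1 a2 a3 a4 a5 a6 a7 a8 a9 a10 : R) :
  presented g 6 (evalT [:: a1; a2; a3; a4; a5; a6; a7; a8; a9; a10] ([:: entry 0 1 2 1;
    entry 0 2 3 1; entry 1 2 4 1] ++ generic 5)) -> classified.
Proof.
move=> H.
have j0 : a6 = 0 by relation H (0, 1, 3, 5)%N.
have j1 : a9 = 0 by relation H (0, 1, 4, 5)%N.
have j2 : a10 = 0 by relation H (0, 2, 4, 5)%N.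
have j3 : a5 = a7 by relation H (0, 1, 2, 5)%N.
goto free3_kernel H [:: Shear 2 5 'v1; Shear 3 5 'v3; Shear 4 5 'v5] [:: 'v7; 'v13; 'v15]%P.
Qed.

(** * Passage from the five-dimensional quotients to their extensions *)

Lemma node5_abelian :
  presented g 5 (evalT [::] [::]) -> classified.
Proof.
move=> H.
by case: (presented_generic (n := 5) (T := [::]) isT (fun=> erefl) H) => w /form5.
Qed.

Lemma node5_heis :
  presented g 5 (evalT [::] [:: entry 0 1 4 1]) -> classified.
Proof.
move=> H.
by case: (presented_generic (n := 5) (T := [:: entry 0 1 4 1]) isT (fun=> erefl) H) => w /heis5.
Qed.

Lemma node5_symp :
  presented g 5 (evalT [::] [:: entry 0 1 4 1; entry 2 3 4 1]) -> classified.
Proof.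
move=> H.
by case: (presented_generic (n := 5) (T := [:: entry 0 1 4 1;
  entry 2 3 4 1]) isT (fun=> erefl) H) => w /symp5.
Qed.

Lemma node5_two_heis :
  presented g 5 (evalT [::] [:: entry 0 1 3 1; entry 0 2 4 1]) -> classified.
Proof.
move=> H.
by case: (presented_generic (n := 5) (T := [:: entry 0 1 3 1;
  entry 0 2 4 1]) isT (fun=> erefl) H) => w /two_heis.
Qed.

Lemma node5_filiform4 :
  presented g 5 (evalT [::] [:: entry 0 1 3 1; entry 0 3 4 1]) -> classified.
Proof.
move=> H.
by case: (presented_generic (n := 5) (T := [:: entry 0 1 3 1;
  entry 0 3 4 1]) isT (fun=> erefl) H) => w /filiform4_plus.
Qed.

Lemma node5_depth3 :
  presented g 5 (evalT [::] [:: entry 0 1 3 1; entry 0 3 4 1; entry 1 2 4 1]) -> classified.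
Proof.
move=> H.
by case: (presented_generic (n := 5) (T := [:: entry 0 1 3 1; entry 0 3 4 1;
  entry 1 2 4 1]) isT (fun=> erefl) H) => w /depth3.
Qed.

Lemma node5_filiform5 :
  presented g 5 (evalT [::] [:: entry 0 1 2 1; entry 0 2 3 1; entry 0 3 4 1]) -> classified.
Proof.
move=> H.
by case: (presented_generic (n := 5) (T := [:: entry 0 1 2 1; entry 0 2 3 1;
  entry 0 3 4 1]) isT (fun=> erefl) H) => w /filiform5.
Qed.

Lemma node5_twisted :
  presented g 5 (evalT [::] [:: entry 0 1 2 1; entry 0 2 3 1; entry 0 3 4 1; entry 1 2 4 1]) ->
    classified.
Proof.
move=> H.
by case: (presented_generic (n := 5) (T := [:: entry 0 1 2 1; entry 0 2 3 1; entry 0 3 4 1;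
  entry 1 2 4 1]) isT (fun=> erefl) H) => w /twisted_filiform5.
Qed.

Lemma node5_free3 :
  presented g 5 (evalT [::] [:: entry 0 1 2 1; entry 0 2 3 1; entry 1 2 4 1]) -> classified.
Proof.
move=> H.
by case: (presented_generic (n := 5) (T := [:: entry 0 1 2 1; entry 0 2 3 1;
  entry 1 2 4 1]) isT (fun=> erefl) H) => w /free3.
Qed.

(** * Quotients of dimension at most four *)

Lemma form4_line (a1 : R) :
  presented g 5 (evalT [:: a1] [:: entry 0 1 4 1; entry 2 3 4 'v1]) -> classified.
Proof.
move=> H.
case: (eqVneq a1 0) => [z1|n1]; last by goto node5_symp H [:: Scale 2 'v2 'v1] [::].
goto node5_heis H [::] [::].
Qed.

Lemma form4_pivot (a1 a2 a3 a4 a5 a6 : R) :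
  presented g 5 (evalT [:: a1; a2; a3; a4; a5; a6] (generic 4)) -> a1 != 0 -> classified.
Proof.
move=> H n1.
goto form4_line H [:: Scale 0 'v2 'v1; Shear 2 1 (- ('v2 * 'v3)); Shear 2 0 'v5;
  Shear 3 1 (- ('v2 * 'v7)); Shear 3 0 'v9] [:: - ('v2 * 'v3 * 'v9) + 'v2 * 'v5 * 'v7 + 'v11]%P.
Qed.

Lemma form4 (a1 a2 a3 a4 a5 a6 : R) :
  presented g 5 (evalT [:: a1; a2; a3; a4; a5; a6] (generic 4)) -> classified.
Proof.
move=> H.
case: (eqVneq a1 0) => [z1|n1]; last by goto form4_pivot H [::] [:: 'v1; 'v3; 'v5; 'v7; 'v9;
  'v11]%P.
case: (eqVneq a2 0) => [z2|n2]; last by goto form4_pivot H [:: Swap 1 2] [:: 'v3; 0; - 'v5; 'v7;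
  'v11; 'v9]%P.
case: (eqVneq a3 0) => [z3|n3]; last by goto form4_pivot H [:: Swap 0 1; Swap 1 2] [:: 'v5; 0;
  0; 'v9; 'v11; 'v7]%P.
case: (eqVneq a4 0) => [z4|n4]; last by goto form4_pivot H [:: Swap 1 3] [:: 'v7; 0; - 'v11; 0;
  - 'v9; 0]%P.
case: (eqVneq a5 0) => [z5|n5]; last by goto form4_pivot H [:: Swap 0 1; Swap 1 3] [:: 'v9; 0;
  - 'v11; 0; 0; 0]%P.
case: (eqVneq a6 0) => [z6|n6]; last by goto form4_pivot H [:: Swap 0 2; Swap 1 3] [:: 'v11; 0;
  0; 0; 0; 0]%P.
goto node5_abelian H [::] [::].
Qed.

Lemma heis4_line (a1 : R) :
  presented g 5 (evalT [:: a1] [:: entry 0 1 3 1; entry 0 3 4 1; entry 1 2 4 'v1]) ->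
    classified.
Proof.
move=> H.
case: (eqVneq a1 0) => [z1|n1]; last by goto node5_depth3 H [:: Scale 2 'v2 'v1] [::].
goto node5_filiform4 H [::] [::].
Qed.

Lemma heis4_pivot (a1 a2 a3 a4 a5 : R) :
  presented g 5 (evalT [:: a1; a2; a3; a4; a5] [:: entry 0 1 3 1; entry 0 1 4 'v1;
    entry 0 2 4 'v2; entry 1 2 4 'v3; entry 0 3 4 'v4; entry 1 3 4 'v5]) -> a4 != 0 ->
    classified.
Proof.
move=> H n4.
goto heis4_line H [:: Scale 4 'v7 'v8; Shear 3 4 ('v1 * 'v8); Shear 1 0 (- ('v8 * 'v9));
  Shear 2 3 (- ('v3 * 'v8))] [:: - ('v3 * 'v8 * 'v8 * 'v9) + 'v5 * 'v8]%P.
Qed.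

Lemma heis4 (a1 a2 a3 a4 a5 a6 : R) :
  presented g 5 (evalT [:: a1; a2; a3; a4; a5; a6] ([:: entry 0 1 3 1] ++ generic 4)) ->
    classified.
Proof.
move=> H.
have j0 : a6 = 0 by relation H (0, 1, 2, 4)%N.
case: (eqVneq a4 0) => [z4|n4]; last by goto heis4_pivot H [::] [:: 'v1; 'v3; 'v5; 'v7; 'v9]%P.
case: (eqVneq a5 0) => [z5|n5]; last by goto heis4_pivot H [:: Swap 0 1;
  Scale 3 (- (1)) (- (1))] [:: - 'v1; 'v5; 'v3; - 'v9; 0]%P.
case: (eqVneq a2 0) => [z2|n2]; last by goto node5_two_heis H [:: Shear 3 4 'v1;
  Shear 1 0 (- ('v4 * 'v5)); Scale 4 'v3 'v4] [::].
case: (eqVneq a3 0) => [z3|n3]; last by goto node5_two_heis H [:: Shear 3 4 'v1; Swap 0 1;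
  Scale 3 (- (1)) (- (1)); Scale 4 'v5 'v6] [::].
goto node5_heis H [:: Shear 3 4 'v1; Swap 3 4] [::].
Qed.

(** Modulo coboundaries and Jacobi, a cocycle is a combination of e^{12} and e^{03}; the four
    patterns of vanishing of its coefficients a3, a4 give the four continuations. *)
Lemma filiform4 (a1 a2 a3 a4 a5 a6 : R) :
  presented g 5 (evalT [:: a1; a2; a3; a4; a5; a6] ([:: entry 0 1 2 1;
    entry 0 2 3 1] ++ generic 4)) -> classified.
Proof.
move=> H.
have j0 : a5 = 0 by relation H (0, 1, 2, 4)%N.
have j1 : a6 = 0 by relation H (0, 1, 3, 4)%N.
case: (eqVneq a4 0) => [z4|n4].
  case: (eqVneq a3 0) => [z3|n3]; last by goto node5_free3 H [:: Shear 2 4 'v1; Shear 3 4 'v3;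
    Scale 4 'v5 'v6] [::].
  goto node5_filiform4 H [:: Shear 2 4 'v1; Shear 3 4 'v3; Swap 2 3; Swap 2 4] [::].
case: (eqVneq a3 0) => [z3|n3]; last by goto node5_twisted H [:: Shear 2 4 'v1; Shear 3 4 'v3;
  Scale 4 'v7 'v8; Scale 1 ('v6 * 'v7) ('v5 * 'v8); Scale 2 ('v6 * 'v7) ('v5 * 'v8);
  Scale 3 ('v6 * 'v7) ('v5 * 'v8); Scale 4 ('v6 * 'v7) ('v5 * 'v8)] [::].
goto node5_filiform5 H [:: Shear 2 4 'v1; Shear 3 4 'v3; Scale 4 'v7 'v8] [::].
Qed.

Lemma node4_abelian :
  presented g 4 (evalT [::] [::]) -> classified.
Proof.
move=> H.
by case: (presented_generic (n := 4) (T := [::]) isT (fun=> erefl) H) => w /form4.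
Qed.

Lemma node4_heis :
  presented g 4 (evalT [::] [:: entry 0 1 3 1]) -> classified.
Proof.
move=> H.
by case: (presented_generic (n := 4) (T := [:: entry 0 1 3 1]) isT (fun=> erefl) H) => w /heis4.
Qed.

Lemma node4_filiform :
  presented g 4 (evalT [::] [:: entry 0 1 2 1; entry 0 2 3 1]) -> classified.
Proof.
move=> H.
by case: (presented_generic (n := 4) (T := [:: entry 0 1 2 1;
  entry 0 2 3 1]) isT (fun=> erefl) H) => w /filiform4.
Qed.

Lemma form3 (a1 a2 a3 : R) :
  presented g 4 (evalT [:: a1; a2; a3] (generic 3)) -> classified.
Proof.
move=> H.
case: (eqVneq a1 0) => [z1|n1]; last by goto node4_heis H [:: Shear 2 1 (- ('v2 * 'v3));
  Shear 2 0 ('v2 * 'v5); Scale 3 'v1 'v2] [::].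
case: (eqVneq a2 0) => [z2|n2]; last by goto node4_heis H [:: Swap 1 2;
  Shear 2 0 (- ('v4 * 'v5)); Scale 3 'v3 'v4] [::].
case: (eqVneq a3 0) => [z3|n3]; last by goto node4_heis H [:: Swap 0 2; Scale 3 (- 'v5) (- 'v6)]
  [::].
goto node4_abelian H [::] [::].
Qed.

Lemma heis3 (a1 a2 a3 : R) :
  presented g 4 (evalT [:: a1; a2; a3] ([:: entry 0 1 2 1] ++ generic 3)) -> classified.
Proof.
move=> H.
case: (eqVneq a2 0) => [z2|n2]; last by goto node4_filiform H [:: Shear 2 3 'v1;
  Shear 1 0 (- ('v4 * 'v5)); Scale 3 'v3 'v4] [::].
case: (eqVneq a3 0) => [z3|n3]; last by goto node4_filiform H [:: Shear 2 3 'v1; Swap 0 1;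
  Scale 2 (- (1)) (- (1)); Scale 3 (- 'v5) (- 'v6)] [::].
goto node4_heis H [:: Shear 2 3 'v1; Swap 2 3] [::].
Qed.

Lemma node3_abelian :
  presented g 3 (evalT [::] [::]) -> classified.
Proof.
move=> H.
by case: (presented_generic (n := 3) (T := [::]) isT (fun=> erefl) H) => w /form3.
Qed.

Lemma node3_heis :
  presented g 3 (evalT [::] [:: entry 0 1 2 1]) -> classified.
Proof.
move=> H.
by case: (presented_generic (n := 3) (T := [:: entry 0 1 2 1]) isT (fun=> erefl) H) => w /heis3.
Qed.

Lemma form2 (a1 : R) :
  presented g 3 (evalT [:: a1] (generic 2)) -> classified.
Proof.
move=> H.
case: (eqVneq a1 0) => [z1|n1]; last by goto node3_heis H [:: Scale 2 'v1 'v2] [::].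
goto node3_abelian H [::] [::].
Qed.

Lemma node2_abelian :
  presented g 2 (evalT [::] [::]) -> classified.
Proof.
move=> H.
by case: (presented_generic (n := 2) (T := [::]) isT (fun=> erefl) H) => w /form2.
Qed.

Lemma node1_abelian :
  presented g 1 (evalT [::] [::]) -> classified.
Proof.
move=> H.
by case: (presented_generic (n := 1) (T := [::]) isT (fun=> erefl) H) => w /node2_abelian.
Qed.

Lemma node0_abelian :
  presented g 0 (evalT [::] [::]) -> classified.
Proof.
move=> H.
by case: (presented_generic (n := 0) (T := [::]) isT (fun=> erefl) H) => w /node1_abelian.
Qed.

End Existence.

(** * Scaling the structure constants of a diagram *)

Definition normal_tables : seq (table pexpr) := [::
  [::];
  [:: entry 3 4 5 1];
  [:: entry 2 3 4 1; entry 3 4 5 1];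
  [:: entry 1 4 5 1; entry 2 3 5 1];
  [:: entry 1 3 4 1; entry 2 3 5 1];
  [:: entry 0 4 5 1; entry 1 2 3 1];
  [:: entry 1 3 4 1; entry 1 4 5 1; entry 2 3 5 1];
  [:: entry 1 2 3 1; entry 2 3 4 1; entry 2 4 5 1];
  [:: entry 0 4 5 1; entry 1 2 3 1; entry 2 3 5 1];
  [:: entry 1 2 3 1; entry 1 3 4 1; entry 2 3 5 1];
  [:: entry 0 3 4 1; entry 1 2 4 1; entry 2 3 5 1];
  [:: entry 0 2 3 1; entry 1 2 4 1; entry 2 4 5 1];
  [:: entry 0 2 3 1; entry 1 2 4 1; entry 1 4 5 1];
  [:: entry 0 1 2 1; entry 0 3 4 1; entry 1 3 5 1];
  [:: entry 1 2 3 1; entry 1 3 4 1; entry 1 4 5 1; entry 2 3 5 1];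
  [:: entry 0 2 3 1; entry 1 2 4 1; entry 1 4 5 1; entry 2 3 5 1];
  [:: entry 0 2 3 1; entry 0 4 5 1; entry 1 2 4 1; entry 1 3 5 1];
  [:: entry 0 2 3 1; entry 0 3 4 1; entry 1 2 4 1; entry 2 3 5 1];
  [:: entry 0 2 3 1; entry 0 3 5 1; entry 1 2 4 1; entry 1 4 5 1];
  [:: entry 0 2 3 1; entry 0 3 5 1; entry 1 2 4 1; entry 1 4 5 (- (1))];
  [:: entry 0 2 3 1; entry 0 3 4 1; entry 0 4 5 1; entry 1 2 5 1];
  [:: entry 0 2 4 1; entry 0 3 5 1; entry 1 2 5 1; entry 1 3 4 1];
  [:: entry 0 2 4 1; entry 0 3 5 1; entry 1 2 5 1; entry 1 3 4 (- (1))];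
  [:: entry 0 1 2 1; entry 0 3 4 1; entry 0 4 5 1; entry 1 3 5 1];
  [:: entry 0 1 2 1; entry 1 2 3 1; entry 1 3 4 1; entry 1 4 5 1];
  [:: entry 0 1 2 1; entry 0 2 3 1; entry 1 2 4 1; entry 1 4 5 1];
  [:: entry 0 2 3 1; entry 0 3 4 1; entry 0 4 5 1; entry 1 2 4 1; entry 1 3 5 1];
  [:: entry 0 1 2 1; entry 0 4 5 1; entry 1 2 3 1; entry 1 3 4 1; entry 2 3 5 1];
  [:: entry 0 1 2 1; entry 0 2 3 1; entry 0 4 5 1; entry 1 2 4 1; entry 1 3 5 1];
  [:: entry 0 1 2 1; entry 0 2 3 1; entry 0 3 5 1; entry 1 2 4 1; entry 1 4 5 1];
  [:: entry 0 1 2 1; entry 0 2 3 1; entry 0 3 5 1; entry 1 2 4 1; entry 1 4 5 (- (1))];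
  [:: entry 0 1 2 1; entry 0 2 3 1; entry 0 3 4 1; entry 0 4 5 1; entry 1 2 5 1];
  [:: entry 0 1 2 1; entry 0 2 4 1; entry 0 3 5 1; entry 1 2 5 1; entry 1 3 4 1];
  [:: entry 0 1 2 1; entry 0 2 4 1; entry 0 3 5 1; entry 1 2 5 1; entry 1 3 4 (- (1))];
  [:: entry 0 1 2 1; entry 0 2 3 1; entry 0 3 4 1; entry 1 2 4 1; entry 1 4 5 1;
    entry 2 3 5 (- (1))];
  [:: entry 0 1 2 1; entry 0 2 3 1; entry 0 3 4 1; entry 0 4 5 1; entry 1 2 4 1; entry 1 3 5 1]].

Definition arrows A (N : table A) : seq (nat * nat * nat) := [seq p.1 | p <- N].

Definition diagrams : seq (seq (nat * nat * nat)) :=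
  Eval cbv in undup [seq arrows N | N <- normal_tables].

Definition variables : seq pexpr := [seq PEX Z (Pos.of_succ_nat k) | k <- iota 0 6].

Section Scaling.

Variables (R : rcfType) (g : lieAlgebra R).

Definition scaled (t : seq R) (T : table R) : table R :=
  [seq (p.1, t`_p.1.1.1 * t`_p.1.1.2 / t`_p.1.2 * p.2) | p <- T].

Definition normalizable (T : table R) : Prop :=
  exists t idx, [/\ (idx < 36)%N, all (fun i => t`_i != 0) (iota 0 6)
    & scaled t T = evalT [::] (nth [::] normal_tables idx)].

(** The place where real closedness is used: up to sign, every constant is a square. *)
Lemma exists_sqrt (q : R) : q != 0 ->
  exists s, s != 0 /\ (s * s = q \/ s * s = - q).
Proof.
move=> q0; exists (Num.sqrt `|q|); split.
  by rewrite sqrtr_eq0 -ltNge normr_gt0.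
rewrite -expr2 sqr_sqrtr ?normr_ge0 //; case: (lerP 0 q) => hq.
  by left; rewrite ger0_norm.
by right; rewrite ltr0_norm.
Qed.

Ltac nonzero_field Cr :=
  field; rewrite ?oner_neq0; repeat (apply/andP; split); first [ by apply: Cr | assumption ].

Ltac scaling_with Cr E :=
  split;
  [ by []
  | rewrite /=; repeat (apply/andP; split);
    repeat first [ by apply: Cr | assumption | apply: oner_neq0 | apply: mulf_neq0
      | apply: invr_neq0 | done ]
  | rewrite /scaled /evalT /= /peval /=;
    repeat (congr (_ :: _); first (congr (_, _); rewrite ?E; nonzero_field Cr)); reflexivity ].

Ltac scaling Cr := scaling_with Cr (erefl 0%N).

Ltac jacobi_tac C H idx :=
  lazymatch type of H with presented _ _ (map _ ?D) =>
    let l := eval cbv [map] in (map C D) in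
    lazymatch goal with |- ?a = ?b =>
      let p := reify l a in let q := reify l b in
      exact: (jacobi_relation (l0 := l) (l := l) (r := variables) (hyps := [::])
        (T := zip D variables) (p := p) (q := q)
        (i := idx.1.1.1) (j := idx.1.1.2) (m := idx.1.2) (k := idx.2)
        H erefl I ltac:(vm_compute; reflexivity))
    end
  end.

Variable C : nat * nat * nat -> R.
Local Notation c i j k := (C (i%N, j%N, k%N)).

(* Rescaling by [t] divides the constants by a character of the torus. These characters are
   independent except in two situations: a Jacobi relation then determines the last constant,
   or only its sign is left. *)
Lemma normalizable_diagram r : r \in diagrams ->
  (forall q, q \in r -> C q != 0) ->
  presented g 6 [seq (q, C q) | q <- r] -> normalizable [seq (q, C q) | q <- r].
Proof.
rewrite /diagrams !in_cons.
case/predU1P=> [-> Cr H|].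
  by exists [:: 1; 1; 1; 1; 1; 1], 0%N; scaling Cr.
case/predU1P=> [-> Cr H|].
  by exists [:: 1; 1; 1; 1; 1; c 3 4 5], 1%N; scaling Cr.
case/predU1P=> [-> Cr H|].
  by exists [:: 1; 1; 1 / c 2 3 4; 1; 1; c 3 4 5], 2%N; scaling Cr.
case/predU1P=> [-> Cr H|].
  by exists [:: 1; 1; 1; 1 / c 2 3 5; 1 / c 1 4 5; 1], 3%N; scaling Cr.
case/predU1P=> [-> Cr H|].
  by exists [:: 1; 1; 1; 1; c 1 3 4; c 2 3 5], 4%N; scaling Cr.
case/predU1P=> [-> Cr H|].
  by exists [:: 1; 1; 1; c 1 2 3; 1; c 0 4 5], 5%N; scaling Cr.
case/predU1P=> [-> Cr H|].
  by exists [:: 1; 1; c 1 3 4 * c 1 4 5 / c 2 3 5; 1 / c 1 3 4; 1; c 1 4 5], 6%N; scaling Cr.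
case/predU1P=> [-> Cr H|].
  by exists [:: 1; 1 / c 1 2 3; 1; 1; c 2 3 4; c 2 3 4 * c 2 4 5], 7%N; scaling Cr.
case/predU1P=> [-> Cr H|].
  by exists [:: 1; 1 / c 1 2 3; 1; 1; c 2 3 5 / c 0 4 5; c 2 3 5], 8%N; scaling Cr.
case/predU1P=> [-> Cr H|].
  by exists [:: 1; 1; 1 / c 1 2 3; 1; c 1 3 4; c 2 3 5 / c 1 2 3], 9%N; scaling Cr.
case/predU1P=> [-> Cr H|].
  by exists [:: 1 / c 0 3 4; 1 / c 1 2 4; 1; 1; 1; c 2 3 5], 10%N; scaling Cr.
case/predU1P=> [-> Cr H|].
  by exists [:: 1; 1 / c 1 2 4; 1; c 0 2 3; 1; c 2 4 5], 11%N; scaling Cr.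
case/predU1P=> [-> Cr H|].
  by exists [:: 1; 1; 1; c 0 2 3; c 1 2 4; c 1 2 4 * c 1 4 5], 12%N; scaling Cr.
case/predU1P=> [-> Cr H|].
  by exists [:: 1; 1; c 0 1 2; 1; c 0 3 4; c 1 3 5], 13%N; scaling Cr.
case/predU1P=> [-> Cr H|].
  by exists [:: 1; 1; c 1 3 4 * c 1 4 5 / c 2 3 5; c 1 2 3 * c 1 3 4 * c 1 4 5 / c 2 3 5;
    c 1 2 3 * c 1 3 4 * c 1 3 4 * c 1 4 5 / c 2 3 5;
    c 1 2 3 * c 1 3 4 * c 1 3 4 * c 1 4 5 * c 1 4 5 / c 2 3 5], 14%N; scaling Cr.
case/predU1P=> [-> Cr H|].
  by exists [:: c 1 4 5 / (c 0 2 3 * c 1 2 4 * c 2 3 5); 1 / c 1 2 4; 1;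
    c 1 4 5 / (c 1 2 4 * c 2 3 5); 1; c 1 4 5 / c 1 2 4], 15%N; scaling Cr.
case/predU1P=> [-> Cr H|].
  have rel : c 1 3 5 * c 0 2 3 = c 0 4 5 * c 1 2 4 by jacobi_tac C H (0, 1, 2, 5)%N.
  have E : c 1 3 5 = c 0 4 5 * c 1 2 4 / c 0 2 3 by rewrite -rel mulfK ?Cr.
  exists [:: 1; 1 / c 1 2 4; 1; c 0 2 3; 1; c 0 4 5], 16%N; scaling_with Cr E.
case/predU1P=> [-> Cr H|].
  by exists [:: 1; c 0 2 3 * c 0 3 4 / c 1 2 4; 1 / c 0 2 3; 1; c 0 3 4; c 2 3 5 / c 0 2 3],
    17%N; scaling Cr.
case/predU1P=> [-> Cr H|].
  (* Rescaling multiplies this quotient by (t_0/t_1)^2, so only its absolute value can be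
     normalized, by t_0 = 1 and t_1 = s. In the three similar cases below the factor is likewise the
     square of a ratio of two t_i. *)
  have [|s [s0 [ss|ss]]] := @exists_sqrt (c 0 2 3 * c 0 3 5 / (c 1 2 4 * c 1 4 5)).
  - by rewrite ?mulf_neq0 ?invr_neq0 ?mulf_neq0 ?Cr.
  - have E : c 1 4 5 = c 0 2 3 * c 0 3 5 / (c 1 2 4 * (s * s)) by rewrite ss; nonzero_field Cr.
    exists [:: 1; s; 1; c 0 2 3; s * c 1 2 4; c 0 2 3 * c 0 3 5], 18%N; scaling_with Cr E.
  - have E : c 1 4 5 = - (c 0 2 3 * c 0 3 5 / (c 1 2 4 * (s * s))) by rewrite ss; nonzero_field
    Cr.
    exists [:: 1; s; 1; c 0 2 3; s * c 1 2 4; c 0 2 3 * c 0 3 5], 19%N; scaling_with Cr E.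
case/predU1P=> [-> Cr H|].
  by exists [:: 1; c 0 2 3 * c 0 3 4 * c 0 4 5 / c 1 2 5; 1 / c 0 2 3; 1; c 0 3 4;
    c 0 3 4 * c 0 4 5], 20%N; scaling Cr.
case/predU1P=> [-> Cr H|].
  have [|s [s0 [ss|ss]]] := @exists_sqrt (c 0 2 4 * c 1 2 5 / (c 0 3 5 * c 1 3 4)).
  - by rewrite ?mulf_neq0 ?invr_neq0 ?mulf_neq0 ?Cr.
  - have E : c 1 3 4 = c 0 2 4 * c 1 2 5 / (c 0 3 5 * (s * s)) by rewrite ss; nonzero_field Cr.
    exists [:: 1; s * c 0 3 5 / c 1 2 5; 1; s; c 0 2 4; s * c 0 3 5], 21%N; scaling_with Cr E.
  - have E : c 1 3 4 = - (c 0 2 4 * c 1 2 5 / (c 0 3 5 * (s * s))) by rewrite ss; nonzero_field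
    Cr.
    exists [:: 1; s * c 0 3 5 / c 1 2 5; 1; s; c 0 2 4; s * c 0 3 5], 22%N; scaling_with Cr E.
case/predU1P=> [-> Cr H|].
  by exists [:: 1; c 0 3 4 * c 0 4 5 / c 1 3 5; c 0 1 2 * c 0 3 4 * c 0 4 5 / c 1 3 5;
    1 / c 0 3 4; 1; c 0 4 5], 23%N; scaling Cr.
case/predU1P=> [-> Cr H|].
  by exists [:: 1 / (c 0 1 2 * c 1 2 3); 1; 1 / c 1 2 3; 1; c 1 3 4; c 1 3 4 * c 1 4 5], 24%N;
    scaling Cr.
case/predU1P=> [-> Cr H|].
  by exists [:: 1 / c 0 1 2; 1; 1; c 0 2 3 / c 0 1 2; c 1 2 4; c 1 2 4 * c 1 4 5], 25%N; scaling
    Cr.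
case/predU1P=> [-> Cr H|].
  have rel : c 1 3 5 * c 0 2 3 = c 0 4 5 * c 1 2 4 by jacobi_tac C H (0, 1, 2, 5)%N.
  have E : c 1 3 5 = c 0 4 5 * c 1 2 4 / c 0 2 3 by rewrite -rel mulfK ?Cr.
  exists [:: 1; c 0 2 3 * c 0 3 4 / c 1 2 4; 1 / c 0 2 3; 1; c 0 3 4; c 0 3 4 * c 0 4 5], 26%N;
    scaling_with Cr E.
case/predU1P=> [-> Cr H|].
  have rel : c 2 3 5 * c 0 1 2 = c 0 4 5 * c 1 3 4 by jacobi_tac C H (0, 1, 3, 5)%N.
  have E : c 2 3 5 = c 0 4 5 * c 1 3 4 / c 0 1 2 by rewrite -rel mulfK ?Cr.
  exists [:: 1 / c 0 1 2; 1; 1; c 1 2 3; c 1 2 3 * c 1 3 4;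
    c 0 4 5 * c 1 2 3 * c 1 3 4 / c 0 1 2], 27%N; scaling_with Cr E.
case/predU1P=> [-> Cr H|].
  have rel : c 1 3 5 * c 0 2 3 = c 0 4 5 * c 1 2 4 by jacobi_tac C H (0, 1, 2, 5)%N.
  have E : c 1 3 5 = c 0 4 5 * c 1 2 4 / c 0 2 3 by rewrite -rel mulfK ?Cr.
  exists [:: 1; 1 / c 0 1 2; 1; c 0 2 3; c 1 2 4 / c 0 1 2; c 0 4 5 * c 1 2 4 / c 0 1 2], 28%N;
    scaling_with Cr E.
case/predU1P=> [-> Cr H|].
  have [|s [s0 [ss|ss]]] := @exists_sqrt (c 0 2 3 * c 0 3 5 / (c 1 2 4 * c 1 4 5)).
  - by rewrite ?mulf_neq0 ?invr_neq0 ?mulf_neq0 ?Cr.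
  - have E : c 1 4 5 = c 0 2 3 * c 0 3 5 / (c 1 2 4 * (s * s)) by rewrite ss; nonzero_field Cr.
    exists [:: 1; s; s * c 0 1 2; s * c 0 1 2 * c 0 2 3; s * s * c 0 1 2 * c 1 2 4;
      s * c 0 1 2 * c 0 2 3 * c 0 3 5], 29%N; scaling_with Cr E.
  - have E : c 1 4 5 = - (c 0 2 3 * c 0 3 5 / (c 1 2 4 * (s * s))) by rewrite ss; nonzero_field
    Cr.
    exists [:: 1; s; s * c 0 1 2; s * c 0 1 2 * c 0 2 3; s * s * c 0 1 2 * c 1 2 4;
      s * c 0 1 2 * c 0 2 3 * c 0 3 5], 30%N; scaling_with Cr E.
case/predU1P=> [-> Cr H|].
  by exists [:: 1; c 0 2 3 * c 0 3 4 * c 0 4 5 / c 1 2 5;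
    c 0 1 2 * c 0 2 3 * c 0 3 4 * c 0 4 5 / c 1 2 5;
    c 0 1 2 * c 0 2 3 * c 0 2 3 * c 0 3 4 * c 0 4 5 / c 1 2 5;
    c 0 1 2 * c 0 2 3 * c 0 2 3 * c 0 3 4 * c 0 3 4 * c 0 4 5 / c 1 2 5;
    c 0 1 2 * c 0 2 3 * c 0 2 3 * c 0 3 4 * c 0 3 4 * c 0 4 5 * c 0 4 5 / c 1 2 5], 31%N;
    scaling Cr.
case/predU1P=> [-> Cr H|].
  have [|s [s0 [ss|ss]]] := @exists_sqrt (c 0 2 4 * c 0 3 5 / (c 1 2 5 * c 1 3 4)).
  - by rewrite ?mulf_neq0 ?invr_neq0 ?mulf_neq0 ?Cr.
  - have E : c 1 3 4 = c 0 2 4 * c 0 3 5 / (c 1 2 5 * (s * s)) by rewrite ss; nonzero_field Cr.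
    exists [:: 1; s; s * c 0 1 2; s * s * c 0 1 2 * c 1 2 5 / c 0 3 5; s * c 0 1 2 * c 0 2 4;
      s * s * c 0 1 2 * c 1 2 5], 32%N; scaling_with Cr E.
  - have E : c 1 3 4 = - (c 0 2 4 * c 0 3 5 / (c 1 2 5 * (s * s))) by rewrite ss; nonzero_field
    Cr.
    exists [:: 1; s; s * c 0 1 2; s * s * c 0 1 2 * c 1 2 5 / c 0 3 5; s * c 0 1 2 * c 0 2 4;
      s * s * c 0 1 2 * c 1 2 5], 33%N; scaling_with Cr E.
case/predU1P=> [-> Cr H|].
  have rel : c 2 3 5 * c 0 1 2 = - (c 0 3 4 * c 1 4 5) by jacobi_tac C H (0, 1, 3, 5)%N.
  have E : c 2 3 5 = - (c 0 3 4 * c 1 4 5 / c 0 1 2) by rewrite -mulNr -rel mulfK ?Cr.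
  exists [:: 1; c 0 2 3 * c 0 3 4 / c 1 2 4; c 0 1 2 * c 0 2 3 * c 0 3 4 / c 1 2 4;
    c 0 1 2 * c 0 2 3 * c 0 2 3 * c 0 3 4 / c 1 2 4;
    c 0 1 2 * c 0 2 3 * c 0 2 3 * c 0 3 4 * c 0 3 4 / c 1 2 4;
    c 0 1 2 * c 0 2 3 * c 0 2 3 * c 0 2 3 * c 0 3 4 * c 0 3 4 * c 0 3 4 * c 1 4 5
      / (c 1 2 4 * c 1 2 4)],
    34%N; scaling_with Cr E.
case/predU1P=> [-> Cr H|].
  have rel : c 1 3 5 * c 0 2 3 = c 0 4 5 * c 1 2 4 by jacobi_tac C H (0, 1, 2, 5)%N.
  have E : c 1 3 5 = c 0 4 5 * c 1 2 4 / c 0 2 3 by rewrite -rel mulfK ?Cr.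
  exists [:: 1; c 0 2 3 * c 0 3 4 / c 1 2 4; c 0 1 2 * c 0 2 3 * c 0 3 4 / c 1 2 4;
    c 0 1 2 * c 0 2 3 * c 0 2 3 * c 0 3 4 / c 1 2 4;
    c 0 1 2 * c 0 2 3 * c 0 2 3 * c 0 3 4 * c 0 3 4 / c 1 2 4;
    c 0 1 2 * c 0 2 3 * c 0 2 3 * c 0 3 4 * c 0 3 4 * c 0 4 5 / c 1 2 4], 35%N; scaling_with Cr
    E.
by [].
Qed.

End Scaling.

(** * Diagrams of nice bases *)

Section OrientedDiagrams.

Local Open Scope nat_scope.

(* [vm_compute] evaluates both arguments of [&&], [||] and [==>]; the searches
   below are feasible only with conditionals. *)
Fixpoint lazy_has (A : Type) (p : pred A) (s : seq A) : bool :=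
  if s is x :: s' then if p x then true else lazy_has p s' else false.

Fixpoint lazy_all (A : Type) (p : pred A) (s : seq A) : bool :=
  if s is x :: s' then if p x then lazy_all p s' else false else true.

Lemma lazy_hasE A (p : pred A) s : lazy_has p s = has p s.
Proof. by elim: s => //= x s ->; case: (p x). Qed.

Lemma lazy_allE A (p : pred A) s : lazy_all p s = all p s.
Proof. by elim: s => //= x s ->; case: (p x). Qed.

(* Heads of arrows are positive, so 0 codes a vanishing bracket. *)
Fixpoint head_of (acc : seq (nat * nat * nat)) i j : nat :=
  if acc is q :: acc' then
    if (if q.1.1 == i then q.1.2 == j else false) then q.2 else
    if (if q.1.1 == j then q.1.2 == i else false) then q.2 else head_of acc' i j
  else 0.

Definition nested_head acc i j l : nat :=
  if head_of acc j l is k.+1 then head_of acc i k.+1 else 0.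

(** What the Jacobi identity imposes on the arrows alone: the head of a nonzero double bracket must
    also be the head of another term of the cyclic sum, since a lone term cannot cancel. *)
Definition jacobi_feasible acc : bool :=
  lazy_all (fun t =>
    let a := nested_head acc t.1.1 t.1.2 t.2 in
    let b := nested_head acc t.1.2 t.2 t.1.1 in
    let c := nested_head acc t.2 t.1.1 t.1.2 in
    [&& [|| a == 0, a == b | a == c], [|| b == 0, b == a | b == c]
      & [|| c == 0, c == a | c == b]])
    [seq t <- triples 6 | (t.1.1 < t.1.2) && (t.1.2 < t.2)].

(** The second condition of niceness: two arrows with the same head have disjoint sources. *)
Definition arrow_ok (acc : seq (nat * nat * nat)) i j k : bool :=
  lazy_all (fun q => ~~ ((q.2 == k) &&
    [|| q.1.1 == i, q.1.2 == i, q.1.1 == j | q.1.2 == j])) acc.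

(** [s] relabels the diagram [r] as [acc]. The first pass, over the arrows of [r] only, is a cheap
    filter; the second one also excludes additional arrows of [acc]. *)
Definition matches (acc r : seq (nat * nat * nat)) (s : seq nat) : bool :=
  if lazy_all (fun q => head_of acc (nth 0 s q.1.1) (nth 0 s q.1.2) == nth 0 s q.2) r
  then lazy_all (fun p => let h := head_of acc (nth 0 s p.1) (nth 0 s p.2) in
    if head_of r p.1 p.2 is k.+1 then
      if nth 0 s k.+1 is k'.+1 then h == k'.+1 else false
    else h == 0) (pairs 6)
  else false.

Definition perms6 := Eval vm_compute in permutations (iota 0 6).

Lemma perms6E : perms6 = permutations (iota 0 6).
Proof. by vm_compute. Qed.

Definition matched acc : bool :=
  lazy_has (fun r => if size r == size acc then lazy_has (matches acc r) perms6 else false)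
    diagrams.

(** Each pair i < j receives no arrow or one arrow to some k > j, the basis being sorted along the
    lower central series. The Jacobi test is made only at the leaves. *)
Fixpoint all_matched (ps : seq (nat * nat)) acc : bool :=
  match ps with
  | [::] => if jacobi_feasible acc then matched acc else true
  | p :: ps' => all_matched ps' acc && all (fun k =>
      if arrow_ok acc p.1 p.2 k then all_matched ps' ((p.1, p.2, k) :: acc) else true)
      (iota p.2.+1 (5 - p.2))
  end.

Lemma all_matched_nil : all_matched (pairs 6) [::].
Proof. by vm_compute. Qed.

Lemma mem_triples n i j k : ((i, j, k) \in triples n) = [&& i < n, j < n & k < n].
Proof.
apply/allpairsP/and3P => [[[[a b] c] /= [/allpairsP[[a' b'] /=] + + [-> -> ->]]]|[i6 j6 k6]].
  by rewrite !mem_iota => -[? ? [-> ->]].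
exists ((i, j), k); rewrite mem_iota k6; split=> //.
by apply/allpairsP; exists (i, j); rewrite !mem_iota.
Qed.

Lemma head_ofP acc i j :
  (exists k, head_of acc i j = k /\ ((i, j, k) \in acc \/ (j, i, k) \in acc)) \/
  head_of acc i j = 0 /\ forall k, (i, j, k) \notin acc /\ (j, i, k) \notin acc.
Proof.
elim: acc => [|[[a b] c] acc IH] /=; first by right.
case: (eqVneq (a, b) (i, j)) => [[-> ->]|ab].
  by rewrite !eqxx; left; exists c; split=> //; left; apply: mem_head.
have -> : (if a == i then b == j else false) = false.
  by apply: negbTE; move: ab; rewrite xpair_eqE; case: (a == i).
case: (eqVneq (a, b) (j, i)) => [[-> ->]|ba].
  by rewrite !eqxx; left; exists c; split=> //; right; apply: mem_head.
have -> : (if a == j then b == i else false) = false.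
  by apply: negbTE; move: ba; rewrite xpair_eqE; case: (a == j).
case: IH => [[k [-> kacc]]|[-> H]].
  by left; exists k; rewrite !inE; split=> //; case: kacc => ->; rewrite orbT; [left|right].
right; split=> // k; have [h1 h2] := H k.
by rewrite !inE !(xpair_eqE (_, _)) ![(_, _) == (a, b)]eq_sym (negbTE ab) (negbTE ba) /= h1 h2.
Qed.

Lemma diagrams_oriented : all (fun r => all (fun q =>
  [&& q.1.1 < q.1.2, 0 < q.2 < 6 & head_of r q.1.1 q.1.2 == q.2]) r) diagrams.
Proof. by vm_compute. Qed.

Lemma mem_diagram r i j k : r \in diagrams -> i < j ->
  ((i, j, k) \in r) = (0 < k) && (head_of r i j == k).
Proof.
move=> /(allP diagrams_oriented)/allP or ij; apply/idP/andP => [/or /and3P[_ /andP[? _] ?] //|].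
case=> k0 /eqP h; case: (head_ofP r i j) => [[k' [+ []]]|[h0 _]].
- by rewrite h => ->.
- by move=> _ /or /and3P[/=]; rewrite ltnNge (ltnW ij).
- by rewrite -h h0 in k0.
Qed.

(** * Soundness of the search *)

Section Matching.

Variable nz : nat -> nat -> nat -> bool.
Hypothesis nzC : forall i j k, nz i j k -> nz j i k.
Hypothesis nz_lt : forall i j k, i < 6 -> j < 6 -> k < 6 -> nz i j k -> (i < k) && (j < k).
Hypothesis nz_target : forall i j k k', i < 6 -> j < 6 -> k < 6 -> k' < 6 ->
  nz i j k -> nz i j k' -> k = k'.
Hypothesis nz_source : forall i j j' k, i < 6 -> j < 6 -> j' < 6 -> k < 6 ->
  nz i j k -> nz i j' k -> j = j'.
Hypothesis nzxx : forall i k, ~~ nz i i k.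

Hypothesis nz_jacobi : forall i j l k m, i < 6 -> j < 6 -> l < 6 -> k < 6 -> m < 6 ->
  nz j l k -> nz i k m ->
  exists2 k', k' < 6 & (nz l i k' && nz j k' m) || (nz i j k' && nz l k' m).

(** Follows the branch of the search dictated by [nz]; the hypotheses on [nz] make each of its
    arrows pass [arrow_ok]. *)
Lemma all_matchedP ps acc : uniq ps -> {subset ps <= pairs 6} ->
    (forall i j k, ((i, j, k) \in acc)
       = [&& (i, j) \in pairs 6, (i, j) \notin ps, k < 6 & nz i j k]) ->
    all_matched ps acc ->
  exists2 acc', (forall i j k, ((i, j, k) \in acc')
       = [&& (i, j) \in pairs 6, k < 6 & nz i j k])
    & (jacobi_feasible acc' -> matched acc').
Proof.
elim: ps acc => [|[i j] ps IH] acc /=.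
  by move=> _ _ Hacc Hm; exists acc => // feas; rewrite feas in Hm.
case/andP=> ijps ups sub Hacc /andP[Hnone Hsome].
have ijp : (i, j) \in pairs 6 by apply: sub; rewrite mem_head.
have sub' : {subset ps <= pairs 6} by move=> p pp; apply: sub; rewrite inE pp orbT.
have [ij j6] : i < j /\ j < 6 by move: ijp; rewrite mem_pairs => /andP.
have i6 := ltn_trans ij j6.
case: (boolP (has (nz i j) (iota 0 6))) => [/hasP[k]|none].
  rewrite mem_iota /= => k6 nzk.
  have ok : arrow_ok acc i j k.
    rewrite /arrow_ok lazy_allE; apply/allP => -[[a b] c].
    rewrite Hacc mem_pairs => /and4P[/andP[ab b6] abps c6 nzc] /=.
    apply/negP => /andP[/eqP ck]; rewrite ck in nzc.
    have a6 := ltn_trans ab b6.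
    have nzk' := nzC nzk; have nzc' := nzC nzc.
    case/or4P=> /eqP h; move: abps; rewrite inE negb_or => /andP[/negP + _]; apply.
    - rewrite h in nzc; by rewrite (nz_source i6 b6 j6 k6 nzc nzk) h.
    - rewrite h in nzc' ab; move: ab.
      by rewrite (nz_source i6 a6 j6 k6 nzc' nzk) ltnNge (ltnW ij).
    - rewrite h in nzc ab; move: ab.
      by rewrite (nz_source j6 b6 i6 k6 nzc nzk') ltnNge (ltnW ij).
    - rewrite h in nzc'; by rewrite (nz_source j6 a6 i6 k6 nzc' nzk') h.
  have /andP[_ jk] := nz_lt i6 j6 k6 nzk.
  have := allP Hsome k; rewrite mem_iota /= -(subSS j 5) subnKC // jk => /(_ k6).
  rewrite ok.
  apply: IH => // a b c; rewrite [_ \in _ :: acc]in_cons Hacc [_ \in _ :: ps]in_cons.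
  case: (eqVneq (a, b) (i, j)) => [[-> ->]|abij] /=.
    rewrite ijp ijps /= !xpair_eqE !eqxx /= orbF.
    apply/eqP/andP => [->|[c6 nzc]] //; exact: nz_target nzc nzk.
  by rewrite !xpair_eqE in abij *; rewrite (negbTE abij).
apply: IH Hnone => // a b c; rewrite Hacc [_ \in _ :: ps]in_cons.
case: (eqVneq (a, b) (i, j)) => [[-> ->]|abij] //=.
rewrite ijp ijps /=; apply/esym/negP => /andP[c6 nzc].
by case/negP: none; apply/hasP; exists c; rewrite ?mem_iota.
Qed.

(** The hypothesis [nz_jacobi] makes the leaf reached feasible, and the exhaustive computation
    [all_matched_nil] then supplies a listed diagram that matches it. *)
Lemma diagram_exists : exists r s, [/\ r \in diagrams, perm_eq s (iota 0 6) &
  forall i j k, i < j -> j < 6 -> k < 6 ->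
    nz (nth 0 s i) (nth 0 s j) (nth 0 s k) = ((i, j, k) \in r)].
Proof.
have [||acc Hacc] := @all_matchedP (pairs 6) [::] (uniq_pairs 6) _ _ all_matched_nil.
- by [].
- by move=> i j k; rewrite in_nil; case: (_ \in _).
have nz_gt0 i j k : i < 6 -> j < 6 -> k < 6 -> nz i j k -> 0 < k.
  by move=> i6 j6 k6 /(nz_lt i6 j6 k6)/andP[ik _]; apply: leq_trans ik.
have headE i j k : i < 6 -> j < 6 -> k < 6 ->
    (0 < k) && (head_of acc i j == k) = nz i j k.
  move=> i6 j6 k6; apply/andP/idP => [[k0 /eqP hk]|nzk].
    case: (head_ofP acc i j) => [[k' [+ kacc]]|[h0 _]]; last by rewrite -hk h0 in k0.
    rewrite hk => kk'; move: kacc; rewrite -kk' !Hacc => -[] /and3P[_ _] //.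
    exact: nzC.
  rewrite (nz_gt0 _ _ _ i6 j6 k6 nzk); split=> //.
  case: (head_ofP acc i j) => [[k' [-> kacc]]|[_ H]].
    apply/eqP; have [k'6 nzk'] : k' < 6 /\ nz i j k'.
      by case: kacc; rewrite Hacc => /and3P[_ k'6 nzk']; split=> //; apply: nzC.
    exact: nz_target nzk' nzk.
  have [] := H k; rewrite !Hacc !mem_pairs k6 i6 j6 !andbT nzk (nzC nzk) !andbT.
  by case: (ltngtP i j) => // ij; move: nzk; rewrite ij (negbTE (nzxx _ _)).
have head6 i j : i < 6 -> j < 6 -> head_of acc i j < 6.
  move=> i6 j6; case: (head_ofP acc i j) => [[k [-> kacc]]|[-> //]].
  by case: kacc; rewrite Hacc => /and3P[].
have nest i j l : i < 6 -> j < 6 -> l < 6 ->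
    forall m, 0 < m -> m < 6 -> nested_head acc i j l = m <->
      exists2 k, k < 6 & nz j l k && nz i k m.
  move=> i6 j6 l6 m m0 m6; rewrite /nested_head; have := head6 j l j6 l6.
  case E: (head_of acc j l) => [|k] k6.
    split=> [m00|[k k6' /andP[+ _]]]; first by rewrite -m00 in m0.
    by rewrite -headE // E => /andP[k0 /eqP k00]; rewrite -k00 in k0.
  have nzk : nz j l k.+1 by rewrite -headE // E eqxx.
  split=> [hm|[k' k'6 /andP[nzk' nzm]]].
    by exists k.+1 => //; rewrite nzk -headE // m0 hm eqxx.
  have kk' : k' = k.+1 by exact: nz_target nzk' nzk.
  by move: nzm; rewrite kk' -headE // => /andP[_ /eqP].
have nest6 i j l : i < 6 -> j < 6 -> l < 6 -> nested_head acc i j l < 6.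
  move=> i6 j6 l6; rewrite /nested_head; have := head6 j l j6 l6.
  by case: (head_of acc j l) => // k k6; apply: head6.
have feas1 i j l : i < 6 -> j < 6 -> l < 6 ->
    let a := nested_head acc i j l in
    [|| a == 0, a == nested_head acc j l i | a == nested_head acc l i j].
  move=> i6 j6 l6 /=; have m6 := nest6 i j l i6 j6 l6.
  case: posnP => //= m0.
  have [k k6 /andP[nzk nzm]] := (nest i j l i6 j6 l6 _ m0 m6).1 erefl.
  have [k' k'6 /orP[h|h]] := nz_jacobi i6 j6 l6 k6 m6 nzk nzm.
    by rewrite ((nest j l i j6 l6 i6 _ m0 m6).2 _) ?eqxx //; exists k'.
  by rewrite ((nest l i j l6 i6 j6 _ m0 m6).2 _) ?eqxx ?orbT //; exists k'.
have feas : jacobi_feasible acc.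
  rewrite /jacobi_feasible lazy_allE; apply/allP => -[[i j] l].
  rewrite mem_filter mem_triples => /andP[_ /and3P[i6 j6 l6]] /=.
  apply/and3P; split; first exact: feas1.
    by have := feas1 j l i j6 l6 i6; rewrite /= [(_ == nested_head acc l i j) || _]orbC.
  exact: feas1.
move/(_ feas); rewrite /matched lazy_hasE => /hasP[r rD].
case: eqP => // _; rewrite lazy_hasE => /hasP[s].
rewrite perms6E mem_permutations /matches => ps; case: ifP => // _.
rewrite lazy_allE => /allP Hm.
exists r, s; split=> // i j k ij j6 k6; have i6 := ltn_trans ij j6.
have s6 m : m < 6 -> nth 0 s m < 6.
  move=> m6; have : nth 0 s m \in s by rewrite mem_nth ?(perm_size ps).
  by rewrite (perm_mem ps) mem_iota.
rewrite (mem_diagram _ rD) //.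
have := Hm (i, j); rewrite mem_pairs ij j6 => /(_ isT) /=.
have z m : (0 < m) && (0 == m) = false by case: m.
have h6 : head_of r i j < 6.
  have /allP or := allP diagrams_oriented _ rD.
  by case: (head_ofP r i j) => [[k' [-> []]]|[-> _] //] /or /and3P[_ /andP[]].
rewrite -headE ?s6 //; move: h6; case: (head_of r i j) => [|h] h6.
  by move/eqP->; rewrite !z.
case E: (nth 0 s h.+1) => [//|h'] /eqP ->; rewrite -E.
rewrite (nth_uniq 0) ?(perm_size ps) // ?(perm_uniq ps) //.
by case: (eqVneq h.+1 k) => [<-|]; rewrite ?andbF // E.
Qed.

End Matching.

End OrientedDiagrams.

(** * Normal form of a nice basis *)

Lemma diagrams_wf : all (fun r => uniq r && all (fun q =>
  [&& q.1.1 < q.1.2, q.1.2 < 6 & q.2 < 6]%N) r) diagrams.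
Proof. by vm_compute. Qed.

Section NormalForm.

Variables (R : rcfType) (g : lieAlgebra R).
Implicit Types (kap : nat -> g -> R) (e : nat -> g) (x y : g).

(** The content of [presented] for n = 6, with the basis kept visible: equivalences of bases are
    about this basis. *)
Definition adapted (T : table R) e : Prop :=
  exists kap, [/\ coframe kap e, bounded 6 T & structured 6 T kap].

Lemma adapted_presented T e : adapted T e -> presented g 6 T.
Proof.
case=> kap [ke bT sT]; exists kap, e; split=> // k x y.
by move/andP=> [k6]; rewrite ltnNge k6.
Qed.

Lemma presented_adapted T : presented g 6 T -> exists e, adapted T e.
Proof. by case=> kap [e [ke bT sT _]]; exists e, kap. Qed.

Lemma coframe_perm kap e s : coframe kap e -> perm_eq s (iota 0 6) ->
  coframe (fun k => kap (nth 0%N s k)) (fun i => e (nth 0%N s i)).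
Proof.
move=> ke ps; have sz := perm_size ps; rewrite size_iota in sz.
have s6 m : (m < 6)%N -> (nth 0%N s m < 6)%N.
  move=> m6; have : nth 0%N s m \in s by rewrite mem_nth ?sz.
  by rewrite (perm_mem ps) mem_iota.
apply: (coframe_change ke) => [k|k i k6 i6|x x0 k k6].
- by case: ke.
- by rewrite (coframe_delta ke) ?s6 // nth_uniq ?sz // (perm_uniq ps).
have ks : k \in s by rewrite (perm_mem ps) mem_iota.
by rewrite -(nth_index 0%N ks) x0 // -sz index_mem.
Qed.

Lemma coframe_scale kap e (t : nat -> R) : coframe kap e ->
  (forall i, (i < 6)%N -> t i != 0) ->
  coframe (fun k x => (t k)^-1 * kap k x) (fun i => t i *: e i).
Proof.
move=> ke t0; apply: (coframe_change ke) => [k a x y|k i k6 i6|x x0 k k6].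
- by case: ke => lin _ _; rewrite lin /=; ring.
- rewrite (coframeZ ke) (coframe_delta ke) //; case: eqP => [->|_].
    by rewrite mulr1 mulVf ?t0.
  by rewrite !mulr0.
- by apply: (mulfI (invr_neq0 (t0 k k6))); rewrite mulr0 x0.
Qed.

Lemma structured_diagram kap e r : coframe kap e -> r \in diagrams ->
  (forall i j k, (i < j)%N -> (j < 6)%N -> (k < 6)%N ->
    (kap k (lie_bracket (e i) (e j)) != 0) = ((i, j, k) \in r)) ->
  adapted [seq (q, kap q.2 (lie_bracket (e q.1.1) (e q.1.2))) | q <- r] e.
Proof.
move=> ke rD Hr; have /andP[ur /allP wf] := allP diagrams_wf r rD.
pose C i j k := kap k (lie_bracket (e i) (e j)).
have bT : bounded 6 [seq (q, C q.1.1 q.1.2 q.2) | q <- r].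
  rewrite /bounded all_map; apply/allP => q /wf /and3P[ij j6 k6] /=.
  by rewrite (ltn_trans ij j6) j6.
exists kap; split=> // k x y k6; rewrite (coframe_bracket ke) (form_expand ke) //.
apply: eq_bigr => a _; apply: eq_bigr => b _; congr (_ * _); rewrite -/(C a b k).
have S i j : \sum_(q <- r) C q.1.1 q.1.2 q.2 * ((k == q.2)%:R
      * ((q.1.1 == i)%:R * (q.1.2 == j)%:R)) = ((i, j, k) \in r)%:R * C i j k.
  case: (boolP ((i, j, k) \in r)) => ijr; last first.
    rewrite mul0r big_seq big1 // => -[[i' j'] k'] /= h.
    case: (eqVneq k k') => [kk|_]; last by rewrite !(mul0r, mulr0).
    case: (eqVneq i' i) => [ii|_]; last by rewrite !(mul0r, mulr0).
    case: (eqVneq j' j) => [jj|_]; last by rewrite !(mul0r, mulr0).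
    by rewrite kk -ii -jj h in ijr.
  rewrite (bigD1_seq (i, j, k)) //= !eqxx !mul1r mulr1.
  rewrite big1 ?addr0 // => -[[i' j'] k'] /=; rewrite !xpair_eqE eq_sym (eq_sym k').
  by case: eqP; case: eqP; case: eqP; rewrite /= ?(mul0r, mulr0).
transitivity (((a : nat, b : nat, k) \in r)%:R * C a b k
    - ((b : nat, a : nat, k) \in r)%:R * C b a k); last first.
  rewrite -!S -sumrB /form big_map; apply: eq_big_seq => q /wf /and3P[ij j6 _].
  rewrite /= /dlt /wedge !(coframe_delta ke) ?(ltn_trans ij) //; rewrite -/(C _ _ _); ring.
have Ck i j : C j i k = - C i j k.
  by rewrite /C bracketC -scaleN1r (coframeZ ke) mulN1r.
have nor i j : (i <= j)%N -> ((j, i, k) \in r) = false.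
  by move=> ij; apply/negP => /wf /and3P[/=]; rewrite ltnNge ij.
have S1 i j : (i < j)%N -> (j < 6)%N -> ((i, j, k) \in r)%:R * C i j k = C i j k.
  move=> ij j6; rewrite -Hr //; case: eqP => [/= h|_]; last by rewrite mul1r.
  by rewrite mul0r /C h.
case: (ltngtP a b) => ab.
- by rewrite (nor a b (ltnW ab)) mul0r subr0 S1.
- by rewrite (nor b a (ltnW ab)) mul0r sub0r S1 // Ck opprK.
- by rewrite ab subrr /C lie_bracketxx (coframe0 ke).
Qed.

Lemma adapted_scale T e (t : seq R) : adapted T e ->
  all (fun i => t`_i != 0) (iota 0 6) ->
  adapted (scaled t T) (fun i => t`_i *: e i).
Proof.
case=> kap [ke bT sT] /allP t0.
have t0' i : (i < 6)%N -> t`_i != 0 by move=> i6; apply: t0; rewrite mem_iota.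
exists (fun k x => (t`_k)^-1 * kap k x); split.
- exact: coframe_scale ke t0'.
- by rewrite /bounded all_map.
- move=> k x y k6; rewrite sT // /form big_map big_distrr /=.
  apply: eq_big_seq => p /(allP bT) /and3P[p1 p2 _].
  have q1 := t0' _ p1; have q2 := t0' _ p2; have q3 := t0' _ k6.
  rewrite /dlt; case: eqP => [<-|_]; last by rewrite !(mulr0, mul0r).
  by rewrite /wedge; field; rewrite q1 q2 q3.
Qed.

(** The depth of a basis vector is the number of terms of the lower central series that contain it.
    As the bracket of e_i and e_j is a multiple of a single e_k, a nonzero one puts e_k itself one
    term deeper than e_i; sorting by depth orients all arrows. *)
Lemma nice_sorted (b : 6.-tuple g) : lie_nilpotent g -> nice_basis b ->
  exists2 s, perm_eq s (iota 0 6) & forall i j k, (i < 6)%N -> (j < 6)%N -> (k < 6)%N ->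
    coord b (inord (nth 0%N s k)) (lie_bracket b`_(nth 0%N s i) b`_(nth 0%N s j)) != 0 ->
    (i < k)%N && (j < k)%N.
Proof.
case=> N LN [bb H2 _]; have ke := coframe_of_basis bb.
pose e i := b`_i.
pose d i := (\sum_(m < N) (e i \in lower_central g m))%N.
have e0 i : (i < 6)%N -> e i != 0.
  move=> i6; apply/eqP => ei; have := coframe_delta ke i6 i6.
  by rewrite /= -/(e i) ei (coframe0 ke) eqxx => /eqP; rewrite eq_sym oner_eq0.
have dlt_ i j k : (i < 6)%N -> (j < 6)%N -> (k < 6)%N ->
    coord b (inord k) (lie_bracket (e i) (e j)) != 0 -> (d i < d k)%N.
  move=> i6 j6 k6 nz; have [k' [c Hc]] := H2 (Ordinal i6) (Ordinal j6).
  move: nz; rewrite /e Hc (coframeZ ke) (coframe_delta ke) //.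
  case: (eqVneq k k') => [kk|]; last by rewrite mulr0 eqxx.
  rewrite mulr1 => c0; have up m : e i \in lower_central g m -> e k \in lower_central g m.+1.
    move=> im; have : lie_bracket (e i) (e j) \in lower_central g m.+1.
      rewrite bracketC memvN; apply: (lie_prodv_subP _ _ _ (subvv _)) => //.
      exact: memvf.
    by rewrite /e Hc -kk rpredZeq (negbTE c0).
  rewrite /d; case: N LN {d} => [L0|N LN].
    by have := e0 _ i6; have := memvf (e i); rewrite -[fullv]/(lower_central g 0) L0 memv0 => ->.
  rewrite big_ord_recr big_ord_recl /= [e i \in _](negbTE _) ?addn0.
    rewrite memvf add1n ltnS; apply: leq_sum => m _.
    by case: (boolP (e i \in _)) => // /up ->.
  by apply/negP => /up; rewrite LN memv0 (negbTE (e0 k k6)).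
pose s := sort (relpre d leq) (iota 0 6).
have ps : perm_eq s (iota 0 6) by rewrite perm_sort.
have sz : size s = 6%N by rewrite (perm_size ps) size_iota.
have s6 m : (m < 6)%N -> (nth 0%N s m < 6)%N.
  move=> m6; have : nth 0%N s m \in s by rewrite mem_nth ?sz.
  by rewrite (perm_mem ps) mem_iota.
have srt : sorted (relpre d leq) s.
  by apply: sort_sorted => x y; apply: leq_total.
have mono i k : (i < 6)%N -> (k < 6)%N -> (d (nth 0%N s i) < d (nth 0%N s k))%N -> (i < k)%N.
  move=> i6 k6; apply: contraTltn; rewrite -leqNgt => ki.
  have tr : transitive (relpre d leq) by move=> x y z; apply: leq_trans.
  by apply: (sorted_leq_nth tr _ 0%N srt); rewrite ?inE ?sz // => x; apply: leqnn.
exists s => // i j k i6 j6 k6 nz; apply/andP; split; apply: mono => //.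
  by apply: dlt_ nz; apply: s6.
apply: (dlt_ _ (nth 0%N s i)); rewrite ?s6 //.
by rewrite bracketC -scaleN1r (coframeZ ke) mulf_neq0 // oppr_eq0 oner_eq0.
Qed.

Lemma nice_normal_form (b : 6.-tuple g) : lie_nilpotent g -> nice_basis b ->
  exists idx s t, [/\ (idx < 36)%N, perm_eq s (iota 0 6),
    all (fun i => t`_i != 0) (iota 0 6)
    & adapted (evalT [::] (nth [::] normal_tables idx))
        (fun i => t`_i *: b`_(nth 0%N s i))].
Proof.
move=> nilg nb; have [s0 ps0 sorted0] := nice_sorted nilg nb.
have [bb H2 H3] := nb; have ke0 := coframe_of_basis bb.
have ke := coframe_perm ke0 ps0.
pose kap k := coord b (inord (nth 0%N s0 k)); pose e i := b`_(nth 0%N s0 i).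
rewrite -/kap -/e /= in ke.
have sz0 := perm_size ps0; rewrite size_iota in sz0.
have s06 m : (m < 6)%N -> (nth 0%N s0 m < 6)%N.
  move=> m6; have : nth 0%N s0 m \in s0 by rewrite mem_nth ?sz0.
  by rewrite (perm_mem ps0) mem_iota.
have s0inj i j : (i < 6)%N -> (j < 6)%N -> nth 0%N s0 i = nth 0%N s0 j -> i = j.
  by move=> i6 j6 /eqP; rewrite nth_uniq ?sz0 ?(perm_uniq ps0) // => /eqP.
pose nz i j k := kap k (lie_bracket (e i) (e j)) != 0.
have nzC i j k : nz i j k -> nz j i k.
  move=> h; rewrite /nz bracketC -scaleN1r (coframeZ ke) mulf_neq0 //.
  by rewrite oppr_eq0 oner_eq0.
have Hlt i j k : (i < 6)%N -> (j < 6)%N -> (k < 6)%N -> nz i j k -> (i < k)%N && (j < k)%N.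
  exact: sorted0.
have Ht i j k k' : (i < 6)%N -> (j < 6)%N -> (k < 6)%N -> (k' < 6)%N ->
    nz i j k -> nz i j k' -> k = k'.
  move=> i6 j6 k6 k'6; have [h [c Hc]] := H2 (Ordinal (s06 _ i6)) (Ordinal (s06 _ j6)).
  have E m : (m < 6)%N -> nz i j m -> nth 0%N s0 m = h.
    rewrite /nz /e Hc /kap => m6; rewrite (coframeZ ke0) (coframe_delta ke0) ?s06 //.
    by case: (eqVneq (nth 0%N s0 m) h) => // _; rewrite mulr0 eqxx.
  by move=> /(E _ k6) Ek /(E _ k'6) Ek'; apply: s0inj; rewrite // Ek Ek'.
have Hs i j j' k : (i < 6)%N -> (j < 6)%N -> (j' < 6)%N -> (k < 6)%N ->
    nz i j k -> nz i j' k -> j = j'.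
  move=> i6 j6 j'6 k6.
  have [h [c Hc]] := H3 (Ordinal (s06 _ i6)) (inord (nth 0%N s0 k)).
  have E m : (m < 6)%N -> nz i m k -> nth 0%N s0 m = h.
    move=> m6; rewrite /nz -oppr_eq0.
    have := Hc (e m); rewrite /interior /CE_diff /= /kap /e => ->.
    have := coframe_delta ke0 (ltn_ord h) (s06 _ m6); rewrite inord_val /= => ->.
    by case: (eqVneq (nth 0%N s0 m) h) => // _; rewrite mulr0 eqxx.
  by move=> /(E _ j6) Ej /(E _ j'6) Ej'; apply: s0inj; rewrite // Ej Ej'.
have nzxx i k : ~~ nz i i k by rewrite /nz lie_bracketxx (coframe0 ke) eqxx.
have [r [s [rD ps Hr]]] : exists r s, [/\ r \in diagrams, perm_eq s (iota 0 6) &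
  forall i j k, (i < j)%N -> (j < 6)%N -> (k < 6)%N ->
    nz (nth 0%N s i) (nth 0%N s j) (nth 0%N s k) = ((i, j, k) \in r)].
  apply: (diagram_exists nzC Hlt Ht Hs nzxx) => i j l k m i6 j6 l6 k6 m6 nz1 nz2.
  pose t a c d := kap m (lie_bracket (e a) (lie_bracket (e c) (e d))).
  have tE a c d : t a c d = \sum_(p < 6)
      kap p (lie_bracket (e c) (e d)) * kap m (lie_bracket (e a) (e p)).
    rewrite /t {1}(coframeE ke (lie_bracket (e c) (e d))) bracket_sumr (coframe_sum ke).
    by apply: eq_bigr => p _; rewrite bracketZr (coframeZ ke).
  have J : t i j l + t j l i + t l i j = 0.
    by rewrite /t -!(coframeD ke) lie_jacobi (coframe0 ke).
  (* A single basis vector supports [e_j, e_l], so no cancellation occurs inside this term of the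
     Jacobi sum; one of the other two terms must then be nonzero at m. *)
  have t1 : t i j l != 0.
    rewrite tE (bigD1 (Ordinal k6)) //= big1 ?addr0 ?mulf_neq0 // => p pk.
    case: (eqVneq (kap p (lie_bracket (e j) (e l))) 0) => [->|nz3].
      by rewrite mul0r.
    by move: pk; rewrite -val_eqE /= (Ht j l p k) ?eqxx.
  have tN a c d : t a c d != 0 -> exists2 k', (k' < 6)%N & nz c d k' && nz a k' m.
    rewrite tE => sn; case: (pickP (fun p : 'I_6 => nz c d p && nz a p m)) => [p pp|none].
      by exists (p : nat).
    case/eqP: sn; apply: big1 => p _; have := none p; rewrite /nz.
    by case: eqP => [->|_]; rewrite ?mul0r //=; case: eqP => [->|]; rewrite ?mulr0.
  case: (eqVneq (t j l i) 0) => [z1|/tN[k' k'6 h]]; last by exists k'; rewrite ?h.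
  case: (eqVneq (t l i j) 0) => [z2|/tN[k' k'6 h]]; last by exists k'; rewrite ?h ?orbT.
  by move: t1; rewrite -J z1 z2 !addr0 eqxx.
have ke2 := coframe_perm ke ps.
have ad := structured_diagram ke2 rD Hr.
have Cr q : q \in r -> kap (nth 0%N s q.2)
    (lie_bracket (e (nth 0%N s q.1.1)) (e (nth 0%N s q.1.2))) != 0.
  case: q => [[i j] k] qr /=; have /andP[_ /allP wf] := allP diagrams_wf r rD.
  by have /and3P[/= ij j6 k6] := wf _ qr; have := Hr i j k ij j6 k6; rewrite qr.
have [t [idx [idx36 t0 Et]]] := normalizable_diagram rD Cr (adapted_presented ad).
have sz := perm_size ps; rewrite size_iota in sz.
exists idx, (map (nth 0%N s0) s), t; split=> //.
  apply: perm_trans (perm_map _ ps) _.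
  by have := mkseq_nth 0%N s0; rewrite sz0 /mkseq => ->.
rewrite -Et; case: (adapted_scale ad t0) => kap' [ke' bT sT].
exists kap'; split=> //; case: ke' => lin delta full; split=> // [k i k6 i6|x].
  by rewrite (nth_map 0%N) ?sz // delta.
rewrite {1}(full x); apply: eq_bigr => i _.
by rewrite (nth_map 0%N) ?sz.
Qed.

End NormalForm.

(** * Characteristic subspaces *)

(* [Transport A B] stands for the subspace of all x with [x, A] in B. *)
Inductive characteristic : Type :=
  | Whole
  | Zero
  | Product of characteristic & characteristic
  | Transport of characteristic & characteristic.

(** Every bracket of basis vectors is 0 or plus or minus one basis vector. Distinct brackets may
    share a head, so the condition also covers the table of [N_6_1_4]. *)
Definition has_single_arrows (N : table pexpr) : bool :=
  bounded 6 N && all (fun t =>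
    if (0 < t.2)%N && (head_of (arrows N) t.1.1 t.1.2 == t.2)
    then let c := coef N t.1.1 t.1.2 t.2 in pzero [::] (c * c - 1)%P
    else pzero [::] (coef N t.1.1 t.1.2 t.2)) (triples 6).

(** In the [Transport] case, if two vectors e_i had brackets with the same e_j on a common head
    outside B, a combination of them could enter the transporter. The answer [None] is given then,
    although the subspace might still be a coordinate one. *)
Fixpoint coordinates (h : nat -> nat -> nat) (c : characteristic) : option (seq nat) :=
  match c with
  | Whole => Some (iota 0 6)
  | Zero => Some [::]
  | Product a b =>
      if (coordinates h a, coordinates h b) is (Some A, Some B)
      then Some [seq k <- iota 0 6 |
        (0 < k)%N && has (fun i => has (fun j => h i j == k) B) A]
      else None
  | Transport a b =>
      if (coordinates h a, coordinates h b) is (Some A, Some B) then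
        if all (fun j => all (fun k => (k \in B) || (count (fun i => h i j == k) (iota 0 6) <= 1)%N)
             (iota 1 5)) A
        then Some [seq i <- iota 0 6 | all (fun j => (h i j == 0%N) || (h i j \in B)) A]
        else None
      else None
  end.

Section Characteristic.

Variables (R : rcfType) (g : lieAlgebra R).
Implicit Types (kap : nat -> g -> R) (e : nat -> g) (x y : g) (U V : {vspace g}).

Definition transporter U V : {vspace g} :=
  (\bigcap_(i < \dim U) (linfun (fun x : g => lie_bracket (vbasis U)`_i x) @^-1: V))%VS.

Lemma transporterP U V x :
  reflect (forall y, y \in U -> lie_bracket x y \in V) (x \in transporter U V).
Proof.
have lin y : linear (fun x : g => lie_bracket y x) by move=> a u v; apply: bracketZDr.
have E y z : linfun (fun x : g => lie_bracket y x) z = lie_bracket y z.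
  pose L := GRing.isLinear.Build R g g _ (fun x : g => lie_bracket y x) (lin y).
  pose f : {linear g -> g} := HB.pack (fun x : g => lie_bracket y x) L.
  exact: (lfunE f z).
have inE i : (x \in linfun (fun x : g => lie_bracket (vbasis U)`_i x) @^-1: V)%VS
    = (lie_bracket x (vbasis U)`_i \in V).
  by rewrite -memv_preim E bracketC memvN.
apply: (iffP idP) => [xT y yU|H].
  rewrite (coord_vbasis yU) bracket_sumr rpred_sum // => i _.
  rewrite bracketZr rpredZ // -inE.
  by apply: subvP xT; apply: (bigcapv_inf i).
rewrite memvE; apply/subv_bigcapP => i _.
by rewrite -memvE inE H // vbasis_mem // mem_nth // size_tuple.
Qed.

Fixpoint denote (c : characteristic) : {vspace g} :=
  match c with
  | Whole => fullv
  | Zero => 0%VS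
  | Product a b => lie_prodv (denote a) (denote b)
  | Transport a b => transporter (denote a) (denote b)
  end.

Section Coordinates.

Variables (kap : nat -> g -> R) (e : nat -> g) (h : nat -> nat -> nat).
Hypothesis ke : coframe kap e.
Hypothesis khE : forall i j k, (i < 6)%N -> (j < 6)%N -> (k < 6)%N ->
  (kap k (lie_bracket (e i) (e j)) != 0) = (0 < k)%N && (h i j == k).

Hypothesis h6 : forall i j, (i < 6)%N -> (j < 6)%N -> (h i j < 6)%N.

Definition coordinate_space (S : seq nat) : {vspace g} := <<[seq e i | i <- S]>>%VS.

Lemma coordinate_spaceP S x : all (fun i => i < 6)%N S ->
  reflect (forall k, (k < 6)%N -> k \notin S -> kap k x = 0) (x \in coordinate_space S).
Proof.
move=> S6; apply: (iffP idP) => [xS k k6 kS|H].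
  rewrite (coord_span (X := in_tuple [seq e i | i <- S]) xS) (coframe_sum ke) big1 // => j _.
  have jS : (j < size S)%N by have := ltn_ord j; rewrite [X in (_ < X)%N]size_map.
  rewrite (coframeZ ke) /= (nth_map 0%N) // (coframe_delta ke) //.
    by rewrite (_ : (k == _) = false) ?mulr0 //; apply: contraNF kS => /eqP->; rewrite mem_nth.
  by apply: (allP S6); rewrite mem_nth.
rewrite (coframeE ke x) rpred_sum // => i _.
case: (boolP ((i : nat) \in S)) => iS; last by rewrite H // scale0r mem0v.
by rewrite rpredZ // memv_span // map_f.
Qed.

Lemma dim_coordinate_space S : uniq S -> all (fun i => i < 6)%N S ->
  \dim (coordinate_space S) = size S.
Proof.
move=> uS S6; have : free (in_tuple [seq e i | i <- S]).
  apply/freeP => a a0 j.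
  have jS : (j < size S)%N by have := ltn_ord j; rewrite [X in (_ < X)%N]size_map.
  have nS m : (m < size S)%N -> (nth 0%N S m < 6)%N by move=> mS; apply: (allP S6); rewrite mem_nth.
  have := congr1 (kap (nth 0%N S j)) a0; rewrite (coframe_sum ke) (coframe0 ke).
  rewrite (bigD1 j) //= big1 ?addr0 => [|i ij].
    rewrite (coframeZ ke) (nth_map 0%N) // (coframe_delta ke) ?nS // eqxx mulr1 //.
  have iS : (i < size S)%N by have := ltn_ord i; rewrite [X in (_ < X)%N]size_map.
  rewrite (coframeZ ke) (nth_map 0%N) // (coframe_delta ke) ?nS // nth_uniq //.
  rewrite (_ : ((j : nat) == i) = false) ?mulr0 //.
  by apply: contraNF ij => /eqP ji; apply/eqP/val_inj.
by move/eqP => /= ->; rewrite size_map.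
Qed.

Lemma bracket_basis i j k : (i < 6)%N -> (j < 6)%N -> (k < 6)%N -> (0 < k)%N -> h i j = k ->
  exists2 c, c != 0 & lie_bracket (e i) (e j) = c *: e k.
Proof.
move=> i6 j6 k6 k0 hk; exists (kap k (lie_bracket (e i) (e j))).
  by rewrite khE // hk k0 eqxx.
apply: (coframe_inj ke) => m m6; rewrite (coframeZ ke) (coframe_delta ke) //.
case: (eqVneq m k) => [->|mk]; first by rewrite mulr1.
rewrite mulr0; apply/eqP; apply: contraNT mk; rewrite khE // hk.
by case/andP=> _ /eqP->.
Qed.

Lemma denote_coordinates c S : coordinates h c = Some S ->
  [/\ uniq S, all (fun i => i < 6)%N S & denote c = coordinate_space S].
Proof.
elim: c S => [||a IHa b IHb|a IHa b IHb] S; cbn [coordinates denote].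
- case=> <-; split=> //; apply/vspaceP => x; rewrite memvf; apply/esym.
  apply/coordinate_spaceP => [//|k k6]; by do 6?[case: k k6 => [|k] k6 //].
- by case=> <-; split=> //; rewrite /coordinate_space span_nil.
- case: coordinates IHa => // A /(_ A erefl)[uA A6 ->].
  case: coordinates IHb => // B /(_ B erefl)[uB B6 ->].
  set K := filter _ _ => -[<-]; have K6 : all (fun i => i < 6)%N K.
    by apply/allP => k; rewrite /K mem_filter mem_iota => /andP[].
  split=> //; first by rewrite filter_uniq ?iota_uniq.
  apply/eqP; rewrite eqEsubv; apply/andP; split.
    apply/lie_prodv_subP => u v /coordinate_spaceP uA' /coordinate_spaceP vB'.
    apply/coordinate_spaceP => // k k6 kK; rewrite (coframe_bracket ke).
    rewrite big1 // => i _; rewrite big1 // => j _.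
    case: (boolP ((i : nat) \in A)) => iA; last by rewrite uA' ?mul0r.
    case: (boolP ((j : nat) \in B)) => jB; last by rewrite vB' ?mulr0 ?mul0r.
    have -> : kap k (lie_bracket (e i) (e j)) = 0; last by rewrite mulr0.
    apply/eqP; apply: contraNT kK; rewrite khE // => /andP[k0 hk].
    rewrite mem_filter mem_iota k0 k6 !andbT /=.
    by apply/hasP; exists (i : nat) => //; apply/hasP; exists (j : nat).
  apply/span_subvP => _ /mapP[k kK ->]; move: kK; rewrite mem_filter mem_iota.
  case/andP=> /andP[k0 /hasP[i iA /hasP[j jB /eqP hk]]] /= k6.
  have i6 := allP A6 i iA; have j6 := allP B6 j jB.
  have [c c0 Ec] := bracket_basis i6 j6 k6 k0 hk.
  have : lie_bracket (e i) (e j) \in lie_prodv (coordinate_space A) (coordinate_space B).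
    by apply: (lie_prodv_subP _ _ _ (subvv _)); rewrite memv_span ?map_f.
  by rewrite Ec rpredZeq (negbTE c0).
- case: coordinates IHa => // A /(_ A erefl)[uA A6 ->].
  case: coordinates IHb => // B /(_ B erefl)[uB B6 ->].
  case: ifP => // /allP chk; set K := filter _ _ => -[<-]; have K6 : all (fun i => i < 6)%N K.
    by apply/allP => k; rewrite /K mem_filter mem_iota => /andP[].
  split=> //; first by rewrite filter_uniq ?iota_uniq.
  apply/vspaceP => x.
  apply/transporterP/coordinate_spaceP => // [Hx i i6 iK|Hx y /(coordinate_spaceP _ A6) yA].
    have /allPn[j jA] : ~~ all (fun j => (h i j == 0%N) || (h i j \in B)) A.
      by move: iK; rewrite mem_filter mem_iota i6 /= andbT.
    rewrite negb_or => /andP[h0 hB]; have j6 := allP A6 j jA.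
    set k := h i j in h0 hB.
    have eA : e j \in coordinate_space A by rewrite memv_span ?map_f.
    have := chk j jA => /allP chk'.
    have k6 : (k < 6)%N by apply: h6.
    have /(coordinate_spaceP _ B6)/(_ k k6 hB) := Hx _ eA.
    rewrite {1}(coframeE ke x) bracket_suml (coframe_sum ke) (bigD1 (Ordinal i6)) //= big1 ?addr0.
      have nz : kap k (lie_bracket (e i) (e j)) != 0 by rewrite khE // lt0n h0 eqxx.
      by rewrite bracketZl (coframeZ ke) => z0; apply: (mulIf nz); rewrite z0 mul0r.
    move=> i' i'i; rewrite bracketZl (coframeZ ke).
    have -> : kap k (lie_bracket (e i') (e j)) = 0; last by rewrite mulr0.
    apply/eqP; apply: contraNT i'i; rewrite khE // => /andP[k0 hk].
    have := chk' k; rewrite mem_iota k0 k6 (negbTE hB) => /(_ isT).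
    rewrite orFb -size_filter; case E: (filter _ _) => [|z [|//]] _.
      by have : i \in [::]; rewrite // -E mem_filter mem_iota i6 eqxx.
    have := mem_filter (fun a => h a j == k) (i' : nat) (iota 0 6).
    have := mem_filter (fun a => h a j == k) i (iota 0 6).
    rewrite E !mem_seq1 !mem_iota i6 ltn_ord hk eqxx => /eqP<- /eqP ii.
    by rewrite -val_eqE /= ii eqxx.
  apply/coordinate_spaceP => // k k6 kB.
  rewrite {1}(coframeE ke x) bracket_suml (coframe_sum ke) big1 // => i _.
  rewrite {1}(coframeE ke y) bracket_sumr (coframe_sum ke) big1 // => j _.
  rewrite bracketZl bracketZr !(coframeZ ke).
  case: (boolP ((j : nat) \in A)) => jA; last by rewrite (yA j) // mul0r mulr0.
  case: (boolP ((i : nat) \in K)) => iK; last by rewrite Hx ?mul0r.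
  have -> : kap k (lie_bracket (e i) (e j)) = 0; last by rewrite !mulr0.
  apply/eqP; apply/negPn; rewrite khE //; apply/negP => /andP[k0 /eqP hk].
  move: iK; rewrite mem_filter => /andP[/allP/(_ _ jA) + _]; rewrite hk.
  by rewrite (negbTE kB) orbF => /eqP k00; rewrite k00 in k0.
Qed.

End Coordinates.

End Characteristic.

Definition table_614 : table pexpr := structure_table (- (1))%P N_6_1_4.

Definition derived := Product Whole Whole.
Definition center := Transport Whole Zero.

(** [Transport A Zero] is the centralizer of A, and [Transport Whole B], for an ideal B, the
    preimage of the centre of the quotient by B. *)
Definition invariants : seq characteristic :=
  [:: derived; center; Product Whole derived; Product Whole (Product Whole derived);
      Transport derived Zero; Transport derived center;
      Transport (Transport derived center) (Product Whole derived);
      Transport (Transport derived center) Zero;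
      Transport (Transport Whole center) Zero;
      Transport (Transport derived Zero) (Product Whole derived);
      Transport Whole (Product Whole derived);
      Transport (Transport derived Zero) Zero;
      Transport (Product Whole derived) Zero;
      Product Whole (Transport derived Zero);
      Transport Whole (Transport derived Zero)].

Definition signature (N : table pexpr) : seq nat :=
  let h := head_of (arrows N) in
  [seq if coordinates h c is Some D then (size D).+1 else 0%N | c <- invariants].

(* An invariant that is not a coordinate subspace has value 0 and is ignored. *)
Fixpoint compatible (s s' : seq nat) : bool :=
  match s, s' with
  | i.+1 :: r, j.+1 :: r' => if (i == j)%N then compatible r r' else false
  | _ :: r, _ :: r' => compatible r r'
  | _, _ => true
  end.

Definition same_group (i j : nat) : bool :=
  (i == j) || has (fun r => (i \in r) && (j \in r))
    [:: [:: 5; 10; 21; 22]; [:: 16; 18; 19]; [:: 28; 29; 30]; [:: 17; 32; 33]]%N.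

Lemma single_arrows_614 : has_single_arrows table_614.
Proof. by vm_compute. Qed.

Lemma normal_tables_single_arrows : all has_single_arrows normal_tables.
Proof. by vm_compute. Qed.

Lemma nth_normal_tables k : (k < 36)%N -> has_single_arrows (nth [::] normal_tables k).
Proof.
have: all has_single_arrows normal_tables -> forall k, (k < size normal_tables)%N ->
    has_single_arrows (nth [::] normal_tables k) by move/(all_nthP [::]).
by apply; apply: normal_tables_single_arrows.
Qed.

Definition indexed_signatures : seq (seq nat * nat) :=
  zip [seq signature N | N <- normal_tables] (iota 0 36).

Definition separated (p q : seq nat * nat) : bool :=
  if compatible p.1 q.1 then same_group p.2 q.2 else true.

Lemma signatures_separate :
  all (fun p => all (separated p) indexed_signatures) indexed_signatures.
Proof. by vm_compute. Qed.

Definition is_14 (s : seq nat) (p : seq nat * nat) : bool :=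
  if compatible s p.1 then p.2 == 14%N else true.

Lemma signature_614 : all (is_14 (signature table_614)) indexed_signatures.
Proof. by vm_compute. Qed.

Section Invariance.

Implicit Types N : table pexpr.

Variables (R : rcfType) (g : lieAlgebra R).

Lemma single_arrows N kap e : coframe kap e -> has_single_arrows N ->
    structured (g := g) 6 (evalT [::] N) kap ->
  forall i j k, (i < 6)%N -> (j < 6)%N -> (k < 6)%N ->
    (kap k (lie_bracket (e i) (e j)) != 0)
    = (0 < k)%N && (head_of (arrows N) i j == k).
Proof.
move=> ke /andP[bN /allP H] sT i j k i6 j6 k6.
rewrite (coef_bracket ke _ bN sT) //.
have := H (i, j, k); rewrite mem_triples i6 j6 k6 => /(_ isT) /=.
case: ifP => _ /(pzeroP (R := R) (l := [::]) (hyps := [::]) I).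
  rewrite /peval /= -!/(peval _ _) => h; apply/eqP => c0.
  by move: h; rewrite c0 mul0r sub0r => /eqP; rewrite oppr_eq0 oner_eq0.
by move=> ->; rewrite eqxx.
Qed.

Lemma head_of_bounded N i j : bounded 6 N -> (head_of (arrows N) i j < 6)%N.
Proof.
move=> bN; have /allP bA : all (fun q => [&& q.1.1 < 6, q.1.2 < 6 & q.2 < 6])%N (arrows N).
  by rewrite all_map.
by case: (head_ofP (arrows N) i j) => [[k [-> []]]|[-> _] //] /bA /and3P[].
Qed.

Lemma coordinates_dim N e c D : adapted (g := g) (evalT [::] N) e ->
  has_single_arrows N -> coordinates (head_of (arrows N)) c = Some D ->
  \dim (denote g c) = size D.
Proof.
case=> kap [ke _ sT] aN cD; have bN : bounded 6 N by case/andP: aN.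
have [uD D6 ->] := denote_coordinates ke (single_arrows ke aN sT)
  (fun i j _ _ => head_of_bounded i j bN) cD.
exact: dim_coordinate_space ke _ uD D6.
Qed.

Lemma compatible_signatures N N' : has_single_arrows N -> has_single_arrows N' ->
  presented g 6 (evalT [::] N) -> presented g 6 (evalT [::] N') ->
  compatible (signature N) (signature N').
Proof.
move=> aN aN' /presented_adapted[e ad] /presented_adapted[e' ad'].
rewrite /signature; elim: invariants => //= c cs IH.
case E: (coordinates (head_of (arrows N)) c) => [D|];
  case E': (coordinates (head_of (arrows N')) c) => [D'|] //=.
by rewrite -(coordinates_dim ad aN E) -(coordinates_dim ad' aN' E') eqxx.
Qed.

Lemma mem_indexed_signatures k : (k < 36)%N ->
  (signature (nth [::] normal_tables k), k) \in indexed_signatures.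
Proof.
move=> k36; rewrite /indexed_signatures -(nth_map [::] [::] signature) //.
by rewrite -{2}[k](nth_iota 0 0 k36) -nth_zip // mem_nth // size_zip.
Qed.

Lemma presented_same_group i j : (i < 36)%N -> (j < 36)%N ->
  presented g 6 (evalT [::] (nth [::] normal_tables i)) ->
  presented g 6 (evalT [::] (nth [::] normal_tables j)) -> same_group i j.
Proof.
move=> i36 j36 pi pj.
have all2P (s : seq (seq nat * nat)) x y :
    all (fun p => all (separated p) s) s -> x \in s -> y \in s -> separated x y.
  by move=> /allP H /H /allP; apply.
have := all2P _ _ _ signatures_separate (mem_indexed_signatures i36)
  (mem_indexed_signatures j36).
rewrite /separated [_.1]/= [(_, j).1]/= [(_, i).2]/= [(_, j).2]/=.
by rewrite compatible_signatures ?nth_normal_tables.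
Qed.

Lemma presented_614_index i : (i < 36)%N -> presented g 6 (evalT [::] table_614) ->
  presented g 6 (evalT [::] (nth [::] normal_tables i)) -> i = 14%N.
Proof.
move=> i36 p6 pi.
have allP1 (s : seq (seq nat * nat)) t x : all (is_14 t) s -> x \in s -> is_14 t x.
  by move=> /allP; apply.
have := allP1 _ _ _ signature_614 (mem_indexed_signatures i36).
rewrite /is_14 [(_, i).1]/= [(_, i).2]/=.
by rewrite compatible_signatures ?nth_normal_tables ?single_arrows_614 // => /eqP.
Qed.

End Invariance.

(** * Finer invariants *)

Notation table_index R i := (evalT (R := R) [::] (nth [::] normal_tables i)).
Notation structure_of theta := (structure_table (- (1))%P theta).

Section RealForms.

Variables (R : rcfType) (g : lieAlgebra R).
Implicit Types x y z u v w : g.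

Let centralizes_derived x := forall u v, lie_bracket x (lie_bracket u v) = 0.

(** Then x, y and [x, y] span an ideal, as they do in a Heisenberg direct summand of table 5. *)
Definition spanned_images := exists x y, [/\ lie_bracket x y != 0,
  forall z, exists c, lie_bracket x z = c *: lie_bracket x y
  & forall z, exists c, lie_bracket y z = c *: lie_bracket x y].

Definition rank1_noncentral := exists x z,
  (exists y, lie_bracket x y != 0) /\ forall y, exists c, lie_bracket x y = c *: z.

(** An isotropic vector of the quadratic form e^5([x, [x, e_2]]) of tables 16 and 18. *)
Definition square_zero := exists x,
  ~ centralizes_derived x /\ forall y, lie_bracket x (lie_bracket x y) = 0.

(** The analogue of [square_zero] for tables 28 and 29, where e_2 = [e_0, e_1] adds one bracket. *)
Definition cube_zero := exists x, (exists y, lie_bracket x (lie_bracket x y) != 0) /\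
  forall y, lie_bracket x (lie_bracket x (lie_bracket x y)) = 0.

(** In tables 17, 32 and 33 the centralizer of the derived algebra is an abelian ideal of
    codimension 2. The quotient acts on it modulo the centre by a pencil of 2 by 2 matrices; x is a
    singular member and y a kernel vector, so the determinant has a real zero. *)
Definition eigenpair x y := [/\ ~ centralizes_derived x, centralizes_derived y,
  exists w, lie_bracket y w != 0 & lie_bracket x y = 0].

Definition has_eigenpair := exists x y, eigenpair x y.

(** All values of the pencil on the kernel vector y lie in the image of the singular member x: this
    marks a double zero of the determinant. *)
Definition has_nilpotent_eigenpair := exists x y, eigenpair x y /\
  forall w, exists v, centralizes_derived v /\ lie_bracket w y = lie_bracket x v.

Definition center_not_line := exists x y, [/\ x != 0, forall c, y <> c *: x,
  forall z, lie_bracket x z = 0 & forall z, lie_bracket y z = 0].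

Lemma sum_sqr_eq0 (a b : R) : a * a + b * b = 0 -> a = 0 /\ b = 0.
Proof.
move=> /eqP; rewrite paddr_eq0 -?expr2 ?sqr_ge0 // !sqrf_eq0.
by case/andP=> /eqP-> /eqP->.
Qed.

Let zero_terms := (mulr0n, mulr1n, mulr0, mul0r, mulr1, mul1r, addr0, add0r, subr0,
  sub0r, oppr0).

Ltac expand sT ke :=
  rewrite ?(coframeD ke, coframeZ ke, coframe0 ke);
  do 3? (rewrite ?sT //; rewrite ?/form /evalT /= ?(big_cons, big_nil) /wedge /dlt /peval /=;
    rewrite ?zero_terms);
  rewrite ?(coframeD ke, coframeZ ke, coframe0 ke) ?(coframe_delta ke) //=;
  rewrite ?zero_terms.

Ltac coordwise sT ke :=
  apply: (coframe_inj ke); do 6? (case=> [_|]); last by []; expand sT ke.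

Lemma spanned_images5 : presented g 6 (table_index R 5) -> spanned_images.
Proof.
case=> kap [e [ke _ sT _]]; exists (e 0%N), (e 4%N); split.
- by apply/eqP => /(congr1 (kap 5%N)); expand sT ke; lra.
- by move=> z; exists (kap 4%N z); coordwise sT ke; ring.
- by move=> z; exists (- kap 0%N z); coordwise sT ke; ring.
Qed.

Lemma not_spanned_images10 : presented g 6 (table_index R 10) -> ~ spanned_images.
Proof.
case=> kap [e [ke _ sT _]] [x [y [nz Hx Hy]]].
have cr u w : (exists c, u = c *: w) -> kap 4%N u * kap 5%N w = kap 5%N u * kap 4%N w.
  by case=> c ->; rewrite !(coframeZ ke); ring.
have := cr _ _ (Hx (e 0%N)); have := cr _ _ (Hx (e 1%N)).
have := cr _ _ (Hx (e 2%N)); have := cr _ _ (Hx (e 3%N)).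
have := cr _ _ (Hy (e 2%N)); have := cr _ _ (Hy (e 3%N)).
have pq : kap 4%N (lie_bracket x y) = 0 -> kap 5%N (lie_bracket x y) = 0 -> False.
  move=> p0 q0; case/eqP: nz; apply: (coframe_inj ke).
  do 6? (case=> [_|]); last by []; rewrite ?p0 ?q0; expand sT ke; ring.
have : kap 4%N (lie_bracket x y) = kap 0%N x * kap 3%N y - kap 0%N y * kap 3%N x
    + (kap 1%N x * kap 2%N y - kap 1%N y * kap 2%N x) by expand sT ke; ring.
have : kap 5%N (lie_bracket x y) = kap 2%N x * kap 3%N y - kap 2%N y * kap 3%N x.
  by expand sT ke; ring.
move: pq; set p := kap 4%N (lie_bracket x y); set q := kap 5%N (lie_bracket x y).
expand sT ke => pq qE pE y3 y2 x3 x2 x1 x0.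
(* Both [x, e_0] and [x, e_1] are multiples of e_4. If q is nonzero they must vanish, whence x_2 =
   x_3 = 0, and then q = 0. *)
have [q0|q0] := eqVneq q 0; last first.
  have X3 : kap 3%N x = 0 by apply: (mulIf q0); lra.
  have X2 : kap 2%N x = 0 by apply: (mulIf q0); lra.
  by move: q0; rewrite qE X2 X3 !(mul0r, mulr0) subrr eqxx.
have [p0|p0] := eqVneq p 0; first exact: pq.
have X3 : kap 3%N x = 0 by apply: (mulIf p0); move: x2; rewrite q0; lra.
have X2 : kap 2%N x = 0 by apply: (mulIf p0); move: x3; rewrite q0; lra.
have Y3 : kap 3%N y = 0 by apply: (mulIf p0); move: y2; rewrite q0; lra.
have Y2 : kap 2%N y = 0 by apply: (mulIf p0); move: y3; rewrite q0; lra.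
by move: p0; rewrite pE X2 X3 Y2 Y3 !(mul0r, mulr0) !subrr addr0 eqxx.
Qed.

Lemma not_spanned_images22 : presented g 6 (table_index R 22) -> ~ spanned_images.
Proof.
case=> kap [e [ke _ sT _]] [x [y [nz Hx Hy]]].
have cr u w : (exists c, u = c *: w) -> kap 4%N u * kap 5%N w = kap 5%N u * kap 4%N w.
  by case=> c ->; rewrite !(coframeZ ke); ring.
have := cr _ _ (Hx (e 0%N)); have := cr _ _ (Hx (e 1%N)).
have := cr _ _ (Hx (e 2%N)); have := cr _ _ (Hx (e 3%N)).
have pq : kap 4%N (lie_bracket x y) = 0 -> kap 5%N (lie_bracket x y) = 0 -> False.
  move=> p0 q0; case/eqP: nz; apply: (coframe_inj ke).
  do 6? (case=> [_|]); last by []; rewrite ?p0 ?q0; expand sT ke; ring.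
have : kap 4%N (lie_bracket x y) = kap 0%N x * kap 2%N y - kap 0%N y * kap 2%N x
    - (kap 1%N x * kap 3%N y - kap 1%N y * kap 3%N x) by expand sT ke; ring.
have : kap 5%N (lie_bracket x y) = kap 0%N x * kap 3%N y - kap 0%N y * kap 3%N x
    + (kap 1%N x * kap 2%N y - kap 1%N y * kap 2%N x) by expand sT ke; ring.
move: pq; set p := kap 4%N (lie_bracket x y); set q := kap 5%N (lie_bracket x y).
expand sT ke => pq qE pE x3 x2 x1 x0.
(* In complex notation the relations read (x_0 + i x_1)(p - i q) = 0 and (x_2 + i x_3)(p - i q) = 0,
   so x vanishes modulo the centre. *)
have n0 : p * p + q * q != 0.
  by apply/eqP => /sum_sqr_eq0[p0 q0]; apply: pq.
have K0 : kap 0%N x = 0.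
  apply: (mulIf n0); rewrite mul0r.
  have -> : kap 0%N x * (p * p + q * q)
    = q * (kap 0%N x * q - kap 1%N x * p) + p * (kap 0%N x * p + kap 1%N x * q) by ring.
  have -> : kap 0%N x * q - kap 1%N x * p = 0 by lra.
  have -> : kap 0%N x * p + kap 1%N x * q = 0 by lra.
  by rewrite !mulr0 addr0.
have K1 : kap 1%N x = 0.
  apply: (mulIf n0); rewrite mul0r.
  have -> : kap 1%N x * (p * p + q * q)
    = q * (kap 0%N x * p + kap 1%N x * q) - p * (kap 0%N x * q - kap 1%N x * p) by ring.
  have -> : kap 0%N x * q - kap 1%N x * p = 0 by lra.
  have -> : kap 0%N x * p + kap 1%N x * q = 0 by lra.
  by rewrite !mulr0 subrr.
have K2 : kap 2%N x = 0.
  apply: (mulIf n0); rewrite mul0r.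
  have -> : kap 2%N x * (p * p + q * q)
    = q * (kap 2%N x * q - kap 3%N x * p) + p * (kap 2%N x * p + kap 3%N x * q) by ring.
  have -> : kap 2%N x * q - kap 3%N x * p = 0 by lra.
  have -> : kap 2%N x * p + kap 3%N x * q = 0 by lra.
  by rewrite !mulr0 addr0.
have K3 : kap 3%N x = 0.
  apply: (mulIf n0); rewrite mul0r.
  have -> : kap 3%N x * (p * p + q * q)
    = q * (kap 2%N x * p + kap 3%N x * q) - p * (kap 2%N x * q - kap 3%N x * p) by ring.
  have -> : kap 2%N x * q - kap 3%N x * p = 0 by lra.
  have -> : kap 2%N x * p + kap 3%N x * q = 0 by lra.
  by rewrite !mulr0 subrr.
by apply: pq; rewrite ?pE ?qE K0 K1 K2 K3; ring.
Qed.

Lemma rank1_noncentral10 : presented g 6 (table_index R 10) -> rank1_noncentral.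
Proof.
case=> kap [e [ke _ sT _]]; exists (e 0%N), (e 4%N); split.
  by exists (e 3%N); apply/eqP => /(congr1 (kap 4%N)); expand sT ke; lra.
by move=> y; exists (kap 3%N y); coordwise sT ke; ring.
Qed.

Lemma not_rank1_noncentral22 : presented g 6 (table_index R 22) -> ~ rank1_noncentral.
Proof.
case=> kap [e [ke _ sT _]] [x [z [[y nz] Hx]]].
have cr u v : (exists c, u = c *: z) -> (exists c, v = c *: z) ->
    kap 4%N u * kap 5%N v = kap 5%N u * kap 4%N v.
  by move=> [c ->] [c' ->]; rewrite !(coframeZ ke); ring.
have := cr _ _ (Hx (e 0%N)) (Hx (e 1%N)); have := cr _ _ (Hx (e 2%N)) (Hx (e 3%N)).
expand sT ke => h1 h2; case/eqP: nz.
have [K0 K1] : kap 0%N x = 0 /\ kap 1%N x = 0 by apply: sum_sqr_eq0; lra.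
have [K2 K3] : kap 2%N x = 0 /\ kap 3%N x = 0 by apply: sum_sqr_eq0; lra.
by coordwise sT ke; rewrite ?K0 ?K1 ?K2 ?K3; ring.
Qed.

Lemma square_zero16 : presented g 6 (table_index R 16) -> square_zero.
Proof.
case=> kap [e [ke _ sT _]]; exists (e 0%N); split=> [/(_ (e 1%N) (e 2%N))|y].
  by move/(congr1 (kap 5%N)); expand sT ke; lra.
by coordwise sT ke; ring.
Qed.

Lemma not_square_zero18 : presented g 6 (table_index R 18) -> ~ square_zero.
Proof.
case=> kap [e [ke _ sT _]] [x [nc /(_ (e 2%N))/(congr1 (kap 5%N))]].
expand sT ke => h; have [K0 K1] : kap 0%N x = 0 /\ kap 1%N x = 0.
  by apply: sum_sqr_eq0; lra.
by apply: nc => u v; coordwise sT ke; rewrite ?K0 ?K1; ring.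
Qed.

Lemma cube_zero28 : presented g 6 (table_index R 28) -> cube_zero.
Proof.
case=> kap [e [ke _ sT _]]; exists (e 0%N); split.
  by exists (e 1%N); apply/eqP => /(congr1 (kap 3%N)); expand sT ke; lra.
by move=> y; coordwise sT ke; ring.
Qed.

Lemma not_cube_zero29 : presented g 6 (table_index R 29) -> ~ cube_zero.
Proof.
case=> kap [e [ke _ sT _]] [x [[u nz] H]].
have := congr1 (kap 5%N) (H (e 0%N)); have := congr1 (kap 5%N) (H (e 1%N)).
expand sT ke; set a := kap 0%N x; set b := kap 1%N x => h1 h0.
have [K0 K1] : a = 0 /\ b = 0.
  apply: sum_sqr_eq0; apply/eqP; rewrite -[_ == 0]orbb -mulf_eq0; apply/eqP.
  have -> : (a * a + b * b) * (a * a + b * b)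
    = a * (a * (a * a + b * b)) + b * (b * (a * a + b * b)) by ring.
  have -> : a * (a * a + b * b) = 0 by lra.
  have -> : b * (a * a + b * b) = 0 by lra.
  by rewrite !mulr0 addr0.
case/eqP: nz; coordwise sT ke; rewrite -?/a -?/b ?K0 ?K1; ring.
Qed.

Lemma eigenpair17 : presented g 6 (table_index R 17) -> has_nilpotent_eigenpair.
Proof.
case=> kap [e [ke _ sT _]]; exists (e 0%N), (e 1%N); split; first split.
- move=> /(_ (e 0%N) (e 2%N))/(congr1 (kap 4%N)); expand sT ke; lra.
- by move=> u v; coordwise sT ke; ring.
- by exists (e 2%N); apply/eqP => /(congr1 (kap 4%N)); expand sT ke; lra.
- by coordwise sT ke; ring.
move=> w; exists (- kap 2%N w *: e 3%N); split=> [u v|]; coordwise sT ke; ring.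
Qed.

Lemma eigenpair32 : presented g 6 (table_index R 32) -> has_eigenpair.
Proof.
case=> kap [e [ke _ sT _]]; exists (e 0%N + e 1%N), (e 2%N + (-1) *: e 3%N); split.
- move=> /(_ (e 0%N) (e 1%N))/(congr1 (kap 4%N)); expand sT ke; lra.
- by move=> u v; coordwise sT ke; ring.
- by exists (e 0%N); apply/eqP => /(congr1 (kap 4%N)); expand sT ke; lra.
- by coordwise sT ke; ring.
Qed.

Lemma not_eigenpair33 : presented g 6 (table_index R 33) -> ~ has_eigenpair.
Proof.
case=> kap [e [ke _ sT _]] [x [y [ncx cy [w nz] xy]]].
have := congr1 (kap 4%N) (cy (e 0%N) (e 1%N)).
have := congr1 (kap 5%N) (cy (e 0%N) (e 1%N)).
have := congr1 (kap 4%N) xy; have := congr1 (kap 5%N) xy.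
expand sT ke => h5 h4 h1 h0.
have Y0 : kap 0%N y = 0 by lra.
have Y1 : kap 1%N y = 0 by lra.
have {h5} h5 : kap 0%N x * kap 3%N y + kap 1%N x * kap 2%N y = 0.
  by move: h5; rewrite ?Y0 ?Y1; lra.
have {h4} h4 : kap 0%N x * kap 2%N y - kap 1%N x * kap 3%N y = 0.
  by move: h4; rewrite ?Y0 ?Y1; lra.
have [n0|n0] := eqVneq (kap 0%N x * kap 0%N x + kap 1%N x * kap 1%N x) 0.
  have [K0 K1] := sum_sqr_eq0 n0.
  by apply: ncx => u v; coordwise sT ke; rewrite ?K0 ?K1; ring.
have Y2 : kap 2%N y = 0.
  apply: (mulIf n0); rewrite mul0r -(mulr0 (kap 0%N x)) -h4.
  have -> : kap 2%N y * (kap 0%N x * kap 0%N x + kap 1%N x * kap 1%N x)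
    = kap 0%N x * (kap 0%N x * kap 2%N y - kap 1%N x * kap 3%N y)
      + kap 1%N x * (kap 0%N x * kap 3%N y + kap 1%N x * kap 2%N y) by ring.
  by rewrite h5 mulr0 addr0.
have Y3 : kap 3%N y = 0.
  apply: (mulIf n0); rewrite mul0r -(mulr0 (kap 0%N x)) -h5.
  have -> : kap 3%N y * (kap 0%N x * kap 0%N x + kap 1%N x * kap 1%N x)
    = kap 0%N x * (kap 0%N x * kap 3%N y + kap 1%N x * kap 2%N y)
      - kap 1%N x * (kap 0%N x * kap 2%N y - kap 1%N x * kap 3%N y) by ring.
  by rewrite h4 mulr0 subr0.
by case/eqP: nz; coordwise sT ke; rewrite ?Y0 ?Y1 ?Y2 ?Y3; ring.
Qed.

Lemma not_nilpotent_eigenpair32 : presented g 6 (table_index R 32) ->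
  ~ has_nilpotent_eigenpair.
Proof.
case=> kap [e [ke _ sT _]] [x [y [[ncx cy [w nz] xy] H]]].
(* Bracketing with e_0 identifies the span of e_2, e_3 with that of e_4, e_5 and turns x into an
   operator. Modulo the centre, y lies in its kernel and its image, which meet only in 0 because the
   eigenvalues x_0 + x_1 and x_0 - x_1 do not both vanish. *)
have [v [cv hv]] := H (e 0%N).
have := congr1 (kap 4%N) (cy (e 0%N) (e 1%N)).
have := congr1 (kap 5%N) (cy (e 0%N) (e 1%N)).
have := congr1 (kap 4%N) (cv (e 0%N) (e 1%N)).
have := congr1 (kap 5%N) (cv (e 0%N) (e 1%N)).
have := congr1 (kap 4%N) xy; have := congr1 (kap 5%N) xy.
have := congr1 (kap 4%N) hv; have := congr1 (kap 5%N) hv.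
expand sT ke => g5 g4 h5 h4 v1 v0 h1 h0.
have Y0 : kap 0%N y = 0 by lra.
have Y1 : kap 1%N y = 0 by lra.
have V0 : kap 0%N v = 0 by lra.
have V1 : kap 1%N v = 0 by lra.
have {h5} h5 : kap 0%N x * kap 3%N y + kap 1%N x * kap 2%N y = 0.
  by move: h5; rewrite ?Y0 ?Y1; lra.
have {h4} h4 : kap 0%N x * kap 2%N y + kap 1%N x * kap 3%N y = 0.
  by move: h4; rewrite ?Y0 ?Y1; lra.
have {g5} g5 : kap 3%N y = kap 0%N x * kap 3%N v + kap 1%N x * kap 2%N v.
  by move: g5; rewrite ?Y0 ?Y1 ?V0 ?V1; lra.
have {g4} g4 : kap 2%N y = kap 0%N x * kap 2%N v + kap 1%N x * kap 3%N v.
  by move: g4; rewrite ?Y0 ?Y1 ?V0 ?V1; lra.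
suff [Y2 Y3] : kap 2%N y = 0 /\ kap 3%N y = 0.
  by case/eqP: nz; coordwise sT ke; rewrite ?Y0 ?Y1 ?Y2 ?Y3; ring.
have [/eqP|n0] := eqVneq (kap 0%N x ^+ 2) (kap 1%N x ^+ 2); last first.
  have n1 : kap 0%N x ^+ 2 - kap 1%N x ^+ 2 != 0 by rewrite subr_eq0.
  split; apply: (mulIf n1); rewrite mul0r.
    have -> : kap 2%N y * (kap 0%N x ^+ 2 - kap 1%N x ^+ 2)
      = kap 0%N x * (kap 0%N x * kap 2%N y + kap 1%N x * kap 3%N y)
        - kap 1%N x * (kap 0%N x * kap 3%N y + kap 1%N x * kap 2%N y) by ring.
    by rewrite h4 h5 !mulr0 subr0.
  have -> : kap 3%N y * (kap 0%N x ^+ 2 - kap 1%N x ^+ 2)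
    = kap 0%N x * (kap 0%N x * kap 3%N y + kap 1%N x * kap 2%N y)
      - kap 1%N x * (kap 0%N x * kap 2%N y + kap 1%N x * kap 3%N y) by ring.
  by rewrite h4 h5 !mulr0 subr0.
have [K0|K0] := eqVneq (kap 0%N x) 0.
  rewrite K0 expr0n /= eq_sym sqrf_eq0 => /eqP K1; case: ncx => u u'.
  by coordwise sT ke; rewrite ?K0 ?K1; ring.
rewrite eqf_sqr => /orP[]/eqP x01.
  have yy : kap 2%N y + kap 3%N y = 0.
    by apply: (mulfI K0); move: h4; rewrite -x01; lra.
  by move: g4 g5; rewrite -x01; split; lra.
have x10 : kap 1%N x = - kap 0%N x by rewrite x01 opprK.
have yy : kap 2%N y - kap 3%N y = 0.
  by apply: (mulfI K0); move: h4; rewrite x10; lra.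
by move: g4 g5; rewrite x10; split; lra.
Qed.

Lemma center_not_line14 : presented g 6 (table_index R 14) -> center_not_line.
Proof.
case=> kap [e [ke _ sT _]]; exists (e 0%N), (e 5%N); split.
- by apply/eqP => /(congr1 (kap 0%N)); expand sT ke; lra.
- by move=> c /(congr1 (kap 5%N)); expand sT ke; lra.
- by move=> z; coordwise sT ke; ring.
- by move=> z; coordwise sT ke; ring.
Qed.

Lemma not_center_not_line614 : presented g 6 (evalT [::] table_614) -> ~ center_not_line.
Proof.
case=> kap [e [ke _ sT _]] [x [y [x0 nxy cx cy]]].
have line z : (forall w, lie_bracket z w = 0) -> z = kap 5%N z *: e 5%N.
  move=> cz; have := congr1 (kap 2%N) (cz (e 0%N)); have := congr1 (kap 2%N) (cz (e 1%N)).
  have := congr1 (kap 3%N) (cz (e 0%N)); have := congr1 (kap 5%N) (cz (e 0%N)).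
  have := congr1 (kap 5%N) (cz (e 1%N)).
  expand sT ke => z1 z2 z3 z4 z5; coordwise sT ke; lra.
have k5 : kap 5%N x != 0.
  by apply: contraNneq x0 => k0; rewrite (line x cx) k0 scale0r.
apply: (nxy (kap 5%N y / kap 5%N x)).
by rewrite {1}(line y cy) (line x cx) scalerA (coframeZ ke) (coframe_delta ke) // mulr1 divfK.
Qed.

End RealForms.

(** * Coincidences between normal forms *)

Section Conversions.

Variables (R : rcfType) (g : lieAlgebra R).

(** Replacing every e_i by its opposite changes the sign of all structure constants; this reconciles
    the tables, whose entries are mostly +1, with the -1 of [structure_table]. *)
Definition negate : seq move := [seq Scale i (- (1))%P (- (1))%P | i <- iota 0 6].

(** The single variable stands for 1/2, which occurs in passing between a pair of vectors and their
    sum and difference. *)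
Lemma convert os T T' :
  moves_ok 6 [:: ('v1 + 'v1, 1)%P] os &&
    same_table 6 [:: ('v1 + 'v1, 1)%P] (apply_moves os (substT [::] T)) (substT [::] T') ->
  evalT [:: 2%:R^-1] (substT [::] T) = evalT (R := R) [::] T ->
  presented g 6 (evalT [::] T) -> presented g 6 (evalT [::] T').
Proof.
move=> chk eT pT.
apply: (presented_moves (l := [:: 2%:R^-1]) (r := [::]) (hyps := [:: ('v1 + 'v1, 1)%P])
  (os := os) (s := [::]) pT eT) => //=.
by split=> //; rewrite /peval /=; lra.
Qed.

Ltac convert_with os :=
  apply: (convert (os := os)); [vm_compute; reflexivity | reflexivity].

Lemma convert_5_structure : presented g 6 (table_index R 5) ->
  presented g 6 (evalT [::] (structure_of N_3_2_plus_N_3_2)).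
Proof. convert_with ([:: Swap 1 2; Swap 0 2; Swap 3 4] ++ negate). Qed.

Lemma convert_structure_5 : presented g 6 (evalT [::] (structure_of N_3_2_plus_N_3_2)) ->
  presented g 6 (table_index R 5).
Proof. convert_with (negate ++ [:: Swap 3 4; Swap 0 2; Swap 1 2]). Qed.

(** R x R is isomorphic to R[t]/(t^2 - 1): in each of the three planes, two idempotent directions
    are exchanged for the basis 1, t. *)
Lemma convert_5_21 : presented g 6 (table_index R 5) -> presented g 6 (table_index R 21).
Proof.
convert_with [:: Swap 2 4; Swap 3 4; Swap 4 5;
  Shear 0 1 1; Scale 1 (- (1 + 1)) (- 'v1); Shear 1 0 1;
  Shear 2 3 1; Scale 3 (- (1 + 1)) (- 'v1); Shear 3 2 1;
  Shear 4 5 1; Scale 5 (- (1 + 1)) (- 'v1); Shear 5 4 1]%P.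
Qed.

Lemma convert_21_5 : presented g 6 (table_index R 21) -> presented g 6 (table_index R 5).
Proof.
convert_with [::
  Shear 1 0 (- (1)); Scale 1 (- 'v1) (- (1 + 1)); Shear 0 1 (- (1));
  Shear 3 2 (- (1)); Scale 3 (- 'v1) (- (1 + 1)); Shear 2 3 (- (1));
  Shear 5 4 (- (1)); Scale 5 (- 'v1) (- (1 + 1)); Shear 4 5 (- (1));
  Swap 4 5; Swap 3 4; Swap 2 4]%P.
Qed.

Lemma convert_16_structure : presented g 6 (table_index R 16) ->
  presented g 6 (evalT [::] (structure_of N_6_3_1)).
Proof.
convert_with ([:: Scale 2 (- (1)) (- (1)); Swap 0 1; Swap 0 2]%P ++ negate).
Qed.

Lemma convert_structure_16 : presented g 6 (evalT [::] (structure_of N_6_3_1)) ->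
  presented g 6 (table_index R 16).
Proof.
convert_with (negate ++ [:: Swap 0 2; Swap 0 1; Scale 2 (- (1)) (- (1))]%P).
Qed.

(** From an isotropic to an orthogonal basis of the hyperbolic plane spanned by e_0, e_1, with the
    corresponding change of e_3, e_4. *)
Lemma convert_16_19 : presented g 6 (table_index R 16) -> presented g 6 (table_index R 19).
Proof.
convert_with [:: Shear 0 1 'v1; Scale 1 (- (1)) (- (1)); Shear 1 0 1;
  Shear 3 4 'v1; Scale 4 (- (1)) (- (1)); Shear 4 3 1]%P.
Qed.

Lemma convert_19_16 : presented g 6 (table_index R 19) -> presented g 6 (table_index R 16).
Proof.
convert_with [:: Shear 1 0 (- (1)); Scale 1 (- (1)) (- (1)); Shear 0 1 (- 'v1);
  Shear 4 3 (- (1)); Scale 4 (- (1)) (- (1)); Shear 3 4 (- 'v1)]%P.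
Qed.

Lemma convert_28_structure : presented g 6 (table_index R 28) ->
  presented g 6 (evalT [::] (structure_of N_6_2_5)).
Proof. convert_with negate. Qed.

Lemma convert_structure_28 : presented g 6 (evalT [::] (structure_of N_6_2_5)) ->
  presented g 6 (table_index R 28).
Proof. convert_with negate. Qed.

(** The change of hyperbolic basis has determinant -1, hence reverses [e_0, e_1]; negating e_2, ...,
    e_5 restores the signs. *)
Lemma convert_28_30 : presented g 6 (table_index R 28) -> presented g 6 (table_index R 30).
Proof.
convert_with ([:: Shear 0 1 'v1; Scale 1 (- (1)) (- (1)); Shear 1 0 1;
  Shear 3 4 'v1; Scale 4 (- (1)) (- (1)); Shear 4 3 1]%P
  ++ [seq Scale i (- (1))%P (- (1))%P | i <- iota 2 4]).
Qed.

Lemma convert_30_28 : presented g 6 (table_index R 30) -> presented g 6 (table_index R 28).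
Proof.
convert_with ([seq Scale i (- (1))%P (- (1))%P | i <- iota 2 4] ++
  [:: Shear 1 0 (- (1)); Scale 1 (- (1)) (- (1)); Shear 0 1 (- 'v1);
  Shear 4 3 (- (1)); Scale 4 (- (1)) (- (1)); Shear 3 4 (- 'v1)]%P).
Qed.

End Conversions.

(** * Equivalence of nice bases *)

Lemma normal_tables_nice i : (i < 36)%N -> nice_pattern [::] (nth [::] normal_tables i).
Proof.
have /(all_nthP [::]) H : all (nice_pattern [::]) normal_tables by vm_compute.
exact: H.
Qed.

Lemma normal_tables_oriented i : (i < 36)%N ->
  let A := arrows (nth [::] normal_tables i) in
  all (fun q => [&& q.1.1 < 6, q.1.2 < 6, 0 < q.2 & head_of A q.1.1 q.1.2 == q.2]%N) A.
Proof.
pose P (N : table pexpr) := all (fun q =>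
  [&& q.1.1 < 6, q.1.2 < 6, 0 < q.2 & head_of (arrows N) q.1.1 q.1.2 == q.2]%N) (arrows N).
have /(all_nthP [::]) H : all P normal_tables by vm_compute.
exact: H.
Qed.

Definition isomorphic_diagrams (i j : nat) : bool :=
  lazy_has (matches (arrows (nth [::] normal_tables j)) (arrows (nth [::] normal_tables i)))
    perms6.

(* The pairs of normal tables of the three algebras of part (2). *)
Definition special_pairs : seq (nat * nat) :=
  [:: (5, 21); (21, 5); (16, 19); (19, 16); (28, 30); (30, 28)]%N.

Lemma special_diagrams : all (fun p => ~~ isomorphic_diagrams p.1 p.2) special_pairs.
Proof. by vm_compute. Qed.

Section Equivalence.

Variables (R : rcfType) (g : lieAlgebra R).
Implicit Types (kap : nat -> g -> R) (e : nat -> g) (x y : g).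

Lemma adapted_nice i e : (i < 36)%N -> adapted (table_index R i) e -> nice_basis (basis6 e).
Proof.
move=> i36 [kap [ke _ sT]].
exact: (nice_pattern_basis (l := [::]) (hyps := [::]) I (normal_tables_nice i36) ke sT).
Qed.

Lemma adapted_automorphism T e e' : adapted (g := g) T e -> adapted T e' ->
  exists f : 'End(g), lie_automorphism f /\ forall i, (i < 6)%N -> f (e i) = e' i.
Proof.
case=> kap [ke bT sT] [kap' [ke' _ sT']].
pose F (kp : nat -> g -> R) (b : nat -> g) x := \sum_(i < 6) kp i x *: b i.
have linF kp b b0 : coframe kp b0 -> linear (F kp b).
  move=> kb a u v; rewrite /F scaler_sumr -big_split /=; apply: eq_bigr => i _.
  by rewrite (coframeD kb) (coframeZ kb) scalerDl scalerA.
have kF kp b kp' b' x k : coframe kp b -> coframe kp' b' -> (k < 6)%N ->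
    kp' k (F kp b' x) = kp k x.
  move=> kb kb' k6; rewrite /F (coframe_sum kb') (bigD1 (Ordinal k6)) //=.
  rewrite (coframeZ kb') (coframe_delta kb') // eqxx mulr1 big1 ?addr0 // => i ik.
  rewrite (coframeZ kb') (coframe_delta kb') // (_ : (k == i) = false) ?mulr0 //.
  by apply: contraNF ik => /eqP ki; apply/eqP/val_inj.
pose L := GRing.isLinear.Build R g g _ (F kap e') (linF kap e' e ke).
pose f : {linear g -> g} := HB.pack (F kap e') L.
have fE x : linfun f x = F kap e' x by rewrite lfunE.
exists (linfun f); split; last first.
  move=> i i6; rewrite fE; apply: (coframe_inj ke') => k k6.
  by rewrite (kF _ _ _ _ _ _ ke ke') // (coframe_delta ke) // (coframe_delta ke').
split.
  exists (F kap' e) => x; rewrite fE.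
    by apply: (coframe_inj ke) => k k6; rewrite (kF _ _ _ _ _ _ ke' ke) // (kF _ _ _ _ _ _ ke ke').
  by apply: (coframe_inj ke') => k k6; rewrite (kF _ _ _ _ _ _ ke ke') // (kF _ _ _ _ _ _ ke' ke).
move=> x y; rewrite !fE; apply: (coframe_inj ke') => k k6.
rewrite (kF _ _ _ _ _ _ ke ke') // sT // sT' // /form.
apply: eq_big_seq => p /(allP bT) /and3P[p1 p2 _].
by rewrite /wedge !(kF _ _ _ _ _ _ ke ke').
Qed.

Lemma adapted_equivalent i e s t (b : 6.-tuple g) : perm_eq s (iota 0 6) ->
    all (fun i => t`_i != 0) (iota 0 6) -> adapted (table_index R i) e ->
    adapted (table_index R i) (fun i => t`_i *: b`_(nth 0%N s i)) ->
  equivalent_bases b (basis6 e).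
Proof.
move=> ps /allP t0 ad ad'; have [f [autf fE]] := adapted_automorphism ad' ad.
exists f; split=> // j.
have js : (j : nat) \in s by rewrite (perm_mem ps) mem_iota ltn_ord.
have k6 : (index (j : nat) s < 6)%N.
  by move: js; rewrite -index_mem (perm_size ps).
have t0k := t0 (index (j : nat) s); rewrite mem_iota in t0k.
exists (Ordinal k6), (t`_(index (j : nat) s))^-1; rewrite invr_neq0 ?t0k //; split=> //.
rewrite nth_basis6 -fE // linearZ /= nth_index // scalerA mulVf ?t0k ?scale1r //.
Qed.

(** An automorphism that permutes the coordinate lines preserves which brackets vanish and on which
    line the others lie, so its permutation matches the diagrams, whatever the scalars. *)
Lemma equivalent_isomorphic i j e e' : (i < 36)%N -> (j < 36)%N ->
  adapted (table_index R i) e -> adapted (table_index R j) e' ->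
  equivalent_bases (basis6 e) (basis6 e') -> isomorphic_diagrams i j.
Proof.
move=> i36 j36 [kap [ke _ sT]] [kap' [ke' _ sT']] [f [[bf fM] Hf]].
have nz := single_arrows ke (nth_normal_tables i36) sT.
have nz' := single_arrows ke' (nth_normal_tables j36) sT'.
set N := nth [::] normal_tables i in nz *; set N' := nth [::] normal_tables j in nz' *.
have bN : bounded 6 N by case/andP: (nth_normal_tables i36).
have bN' : bounded 6 N' by case/andP: (nth_normal_tables j36).
have ex k : exists p : nat * R, (k < 6)%N ->
    [/\ (p.1 < 6)%N, p.2 != 0 & f (e k) = p.2 *: e' p.1].
  case: (ltnP k 6) => k6; last by exists (0%N, 0).
  have [l [c [c0 E]]] := Hf (Ordinal k6); rewrite !nth_basis6 in E.
  by exists (l : nat, c) => _; split; [apply: ltn_ord|apply: c0|apply: E].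
(* Six witnesses are collected in a list, which turns the existence statements into a function
   without a choice principle. *)
have [ps Hps] : exists ps : seq (nat * R), forall k, (k < 6)%N ->
    [/\ ((nth (0%N, 0%R) ps k).1 < 6)%N, (nth (0%N, 0%R) ps k).2 != 0
      & f (e k) = (nth (0%N, 0%R) ps k).2 *: e' (nth (0%N, 0%R) ps k).1].
  have [p0 H0] := ex 0%N; have [p1 H1] := ex 1%N; have [p2 H2] := ex 2%N.
  have [p3 H3] := ex 3%N; have [p4 H4] := ex 4%N; have [p5 H5] := ex 5%N.
  exists [:: p0; p1; p2; p3; p4; p5].
  case=> [|[|[|[|[|[|k]]]]]]; [exact: H0|exact: H1|exact: H2|exact: H3|exact: H4|exact: H5|done].
pose pi k := (nth (0%N, 0%R) ps k).1; pose c k := (nth (0%N, 0%R) ps k).2.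
have pi6 k : (k < 6)%N -> (pi k < 6)%N by case/Hps.
have c0 k : (k < 6)%N -> c k != 0 by case/Hps.
have fE k : (k < 6)%N -> f (e k) = c k *: e' (pi k) by case/Hps.
have pi_inj : {in iota 0 6 &, injective pi}.
  move=> a b; rewrite !mem_iota /= => a6 b6 ab; apply/eqP; apply/negPn/negP => nab.
  have : c b *: e a = c a *: e b.
    by apply: (bij_inj bf); rewrite !linearZ /= !fE // ab !scalerA mulrC.
  move/(congr1 (kap a)); rewrite !(coframeZ ke) !(coframe_delta ke) // eqxx (negbTE nab).
  by rewrite mulr1 mulr0 => /eqP; apply/negP/c0.
pose s := map pi (iota 0 6).
have sE k : (k < 6)%N -> nth 0%N s k = pi k.
  by move=> k6; rewrite (nth_map 0%N) ?size_iota // nth_iota.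
have sP : s \in perms6.
  rewrite perms6E mem_permutations; apply: uniq_perm.
  - by rewrite map_inj_in_uniq ?iota_uniq.
  - exact: iota_uniq.
  have us : uniq s by rewrite map_inj_in_uniq ?iota_uniq.
  have sub : {subset s <= iota 0 6}.
    by move=> _ /mapP[k + ->]; rewrite !mem_iota /= => k6; apply: pi6.
  by have [_ E] := uniq_min_size us sub (leqnn _); exact: E.
have brE a b : (a < 6)%N -> (b < 6)%N -> f (lie_bracket (e a) (e b))
    = (c a * c b) *: lie_bracket (e' (pi a)) (e' (pi b)).
  by move=> a6 b6; rewrite fM !fE // bracketZl bracketZr scalerA.
have key a b : (a < 6)%N -> (b < 6)%N ->
    if head_of (arrows N) a b is k.+1
    then (0 < pi k.+1)%N && (head_of (arrows N') (pi a) (pi b) == pi k.+1)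
    else head_of (arrows N') (pi a) (pi b) == 0%N.
  move=> a6 b6; have := head_of_bounded a b bN.
  case E: (head_of (arrows N) a b) => [|k] k6.
    have z0 : lie_bracket (e a) (e b) = 0.
      apply: (coframe_inj ke) => m m6; rewrite (coframe0 ke); apply/eqP/negPn.
      by rewrite nz // E; case: m m6.
    have := brE a b a6 b6; rewrite z0 linear0 => /esym/eqP.
    rewrite scaler_eq0 mulf_eq0 (negbTE (c0 _ a6)) (negbTE (c0 _ b6)) /= => /eqP z0'.
    apply/negPn/negP => h0; have h6 := head_of_bounded (pi a) (pi b) bN'.
    have := nz' _ _ _ (pi6 _ a6) (pi6 _ b6) h6.
    by rewrite z0' (coframe0 ke') eqxx lt0n h0 eqxx.
  have [d d0 Ed] := bracket_basis ke nz a6 b6 k6 (ltn0Sn k) E.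
  rewrite -nz' ?pi6 //; apply/negP => /eqP z0.
  have := congr1 (kap' (pi k.+1)) (brE a b a6 b6).
  rewrite Ed linearZ /= fE // !(coframeZ ke') z0 (coframe_delta ke') ?pi6 // eqxx mulr0 mulr1.
  by apply/eqP; rewrite mulf_neq0 // c0.
rewrite /isomorphic_diagrams lazy_hasE; apply/hasP; exists s => //.
move: (s) sE => {sP}s sE.
rewrite /matches !lazy_allE -/N -/N' ifT.
  apply/allP => -[a b]; rewrite mem_pairs => /andP[ab b6] /=.
  have a6 := ltn_trans ab b6; rewrite !sE //; have := key a b a6 b6.
  have := head_of_bounded a b bN; case: (head_of (arrows N) a b) => // k k6.
  by rewrite sE //; case: (pi k.+1) => // m.
apply/allP => q /(allP (normal_tables_oriented i36)) /and4P[q1 q2 q0 /eqP hq].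
have q6 : (q.2 < 6)%N by rewrite -hq head_of_bounded.
rewrite !sE //; have := key _ _ q1 q2; rewrite hq.
by case: (q.2) q0 => // m _ /andP[].
Qed.

End Equivalence.

(** * Counting nice bases *)

(** Pairs of tables of non-isomorphic algebras, ordered so that the first has the property that the
    second lacks. *)
Definition inequivalent_pairs : seq (nat * nat) :=
  [:: (5, 10); (5, 22); (21, 10); (10, 22); (21, 22); (16, 18); (19, 18); (28, 29);
      (30, 29); (17, 32); (17, 33); (32, 33)]%N.

Lemma same_group_pairs i j : (i < 36)%N -> (j < 36)%N -> same_group i j ->
  [\/ i = j, (i, j) \in special_pairs, (i, j) \in inequivalent_pairs
    | (j, i) \in inequivalent_pairs].
Proof.
pose P (a b : nat) := same_group a b ==> [|| a == b, (a, b) \in special_pairs,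
  (a, b) \in inequivalent_pairs | (b, a) \in inequivalent_pairs].
have H : all (fun a => all (P a) (iota 0 36)) (iota 0 36) by vm_compute.
have mem_iota36 k : (k < 36)%N -> k \in iota 0 36 by move=> k36; rewrite mem_iota.
move=> /mem_iota36 /(allP H) Hi /mem_iota36 /(allP Hi) /implyP Hij /Hij.
case/or4P => [/eqP|||] ?;
  [exact: Or41|exact: Or42|exact: Or43|exact: Or44].
Qed.

Section Main.

Variables (R : rcfType) (g : lieAlgebra R).

Lemma eval_structure_table theta :
  evalT [::] (structure_of theta) = structure_table (- 1 : R) theta.
Proof.
rewrite /evalT /structure_table map_flatten -map_comp; congr flatten.
by apply: eq_map => k /=; rewrite -map_comp.
Qed.

Lemma inequivalent_presented i j : (i, j) \in inequivalent_pairs ->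
  presented g 6 (table_index R i) -> ~ presented g 6 (table_index R j).
Proof.
pose diff k l := presented g 6 (table_index R k) -> ~ presented g 6 (table_index R l).
have H5_10 : diff 5%N 10%N.
  by move=> /spanned_images5 h /not_spanned_images10.
have H5_22 : diff 5%N 22%N.
  by move=> /spanned_images5 h /not_spanned_images22.
have H16_18 : diff 16%N 18%N by move=> /square_zero16 h /not_square_zero18.
have H28_29 : diff 28%N 29%N by move=> /cube_zero28 h /not_cube_zero29.
have H17 : presented g 6 (table_index R 17) -> has_eigenpair g.
  by move=> /eigenpair17 [x [y [xy _]]]; exists x, y.
rewrite !inE => /or4P[/eqP[-> ->]|/eqP[-> ->]|/eqP[-> ->]|].
- exact: H5_10.
- exact: H5_22.
- by move/convert_21_5; apply: H5_10.
case/or4P=> [/eqP[-> ->]|/eqP[-> ->]|/eqP[-> ->]|].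
- by move=> /rank1_noncentral10 h /not_rank1_noncentral22.
- by move/convert_21_5; apply: H5_22.
- exact: H16_18.
case/or4P=> [/eqP[-> ->]|/eqP[-> ->]|/eqP[-> ->]|].
- by move/convert_19_16; apply: H16_18.
- exact: H28_29.
- by move/convert_30_28; apply: H28_29.
case/or3P=> /eqP[-> ->].
- by move=> /eigenpair17 h /not_nilpotent_eigenpair32.
- by move=> /H17 h /not_eigenpair33.
- by move=> /eigenpair32 h /not_eigenpair33.
Qed.

Lemma presented_index i j : (i < 36)%N -> (j < 36)%N ->
    presented g 6 (table_index R i) -> presented g 6 (table_index R j) ->
  i = j \/ (i, j) \in special_pairs.
Proof.
move=> i36 j36 pi pj.
case: (same_group_pairs i36 j36 (presented_same_group i36 j36 pi pj)) => [|||] h;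
  [by left|by right| |].
- by case: (inequivalent_presented h pi).
- by case: (inequivalent_presented h pj).
Qed.

Lemma special_pair_structure i j : (i, j) \in special_pairs ->
    presented g 6 (table_index R i) ->
  [\/ has_structure g N_6_2_5, has_structure g N_6_3_1 | has_structure g N_3_2_plus_N_3_2].
Proof.
have structureP theta : presented g 6 (evalT [::] (structure_of theta)) -> has_structure g theta.
  by rewrite eval_structure_table; apply: structure_of_presented.
rewrite !inE => /or4P[||| /or3P[]] /eqP[-> _].
- by move=> /convert_5_structure/structureP; apply: Or33.
- by move=> /convert_21_5 /convert_5_structure/structureP; apply: Or33.
- by move=> /convert_16_structure/structureP; apply: Or32.
- by move=> /convert_19_16 /convert_16_structure/structureP; apply: Or32.
- by move=> /convert_28_structure/structureP; apply: Or31.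
- by move=> /convert_30_28 /convert_28_structure/structureP; apply: Or31.
Qed.

Hypothesis nilg : lie_nilpotent g.

Lemma exactly_two_nice_bases i j : (i, j) \in special_pairs ->
    presented g 6 (table_index R i) -> presented g 6 (table_index R j) ->
  exactly_nice_bases g 6 2.
Proof.
move=> ij /presented_adapted[e ade] /presented_adapted[e' ade'].
have [i36 j36 ji uj] : [/\ (i < 36)%N, (j < 36)%N, (j, i) \in special_pairs
    & forall k, (i, k) \in special_pairs -> k = j].
  by move: ij; rewrite !inE => /or4P[||| /or3P[]] /eqP[-> ->]; split=> // k;
    rewrite !inE !xpair_eqE /= ?orbF => /eqP.
have neq a b f f' : (a, b) \in special_pairs -> (a < 36)%N -> (b < 36)%N ->
    adapted (g := g) (table_index R a) f -> adapted (table_index R b) f' ->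
    ~ equivalent_bases (basis6 f) (basis6 f').
  move=> ab a36 b36 af bf /(equivalent_isomorphic a36 b36 af bf).
  by apply/negP; apply: (allP special_diagrams _ ab).
exists (fun k : 'I_2 => if k == ord0 then basis6 e else basis6 e'); split.
- by move=> a; case: ifP => _; [apply: adapted_nice ade|apply: adapted_nice ade'].
- move=> [[|[|//]] a2] [[|[|//]] b2] //= _.
  + exact: neq ade ade'.
  + exact: neq ade' ade.
move=> b /(nice_normal_form nilg)[k [s [t [k36 ps t0 ad]]]].
have pk := adapted_presented ad.
case: (presented_index i36 k36 (adapted_presented ade) pk) => [ik|/uj kj].
  by exists ord0; rewrite eqxx; rewrite -ik in ad; apply: adapted_equivalent ps t0 ade ad.
by exists ord_max; rewrite kj in ad; apply: adapted_equivalent ps t0 ade' ad.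
Qed.

Lemma exactly_one_nice_basis i : (i < 36)%N -> presented g 6 (table_index R i) ->
    (forall j, (i, j) \notin special_pairs) ->
  exactly_nice_bases g 6 1.
Proof.
move=> i36 pi ni; have [e ade] := presented_adapted pi.
exists (fun=> basis6 e); split=> [_|a b|b].
- exact: adapted_nice ade.
- by rewrite !ord1 eqxx.
move=> /(nice_normal_form nilg)[k [s [t [k36 ps t0 ad]]]]; exists ord0.
case: (presented_index i36 k36 pi (adapted_presented ad)) => [ik|]; last by rewrite (negbTE (ni k)).
by rewrite -ik in ad; apply: adapted_equivalent ps t0 ade ad.
Qed.

End Main.

Theorem proposition3p1 (R : realType) (g : lieAlgebra R)
    (dimg : \dim {:g} = 6%N) (nilg : lie_nilpotent g) :
  [/\ (* (1) *)
      has_structure g N_6_1_4 ->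
        ~ exists e : 6.-tuple g, nice_basis e,
      (* (2) *)
      has_structure g N_6_2_5 \/ has_structure g N_6_3_1
        \/ has_structure g N_3_2_plus_N_3_2 ->
        exactly_nice_bases g 6 2
    & (* (3) *)
      ~ has_structure g N_6_1_4 -> ~ has_structure g N_6_2_5 ->
      ~ has_structure g N_6_3_1 -> ~ has_structure g N_3_2_plus_N_3_2 ->
        exactly_nice_bases g 6 1].
Proof.
split.
- move/(presented_of_structure (theta := N_6_1_4) isT); rewrite -eval_structure_table => p614.
  case=> b /(nice_normal_form nilg).
  case=> i [s [t [i36 _ _ /adapted_presented pi]]].
  have := presented_614_index i36 p614 pi => i14; rewrite i14 in pi.
  exact: (not_center_not_line614 p614) (center_not_line14 pi).
- case=> [/(presented_of_structure (theta := N_6_2_5) isT)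
    |[/(presented_of_structure (theta := N_6_3_1) isT)
    |/(presented_of_structure (theta := N_3_2_plus_N_3_2) isT)]];
    rewrite -eval_structure_table.
  + by move/convert_structure_28 => p;
    exact: (exactly_two_nice_bases (i := 28) (j := 30) nilg isT p (convert_28_30 p)).
  + by move/convert_structure_16 => p;
    exact: (exactly_two_nice_bases (i := 16) (j := 19) nilg isT p (convert_16_19 p)).
  + by move/convert_structure_5 => p;
    exact: (exactly_two_nice_bases (i := 5) (j := 21) nilg isT p (convert_5_21 p)).
- move=> n1 n2 n3 n4; case: (node0_abelian (presented0 dimg nilg)) => [[b]|//].
  move=> /(nice_normal_form nilg)[i [s [t [i36 _ _ /adapted_presented pi]]]].
  apply: (exactly_one_nice_basis nilg i36 pi) => j; apply/negP => ij.
  by case: (special_pair_structure ij pi).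
Qed.
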